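(* Let $0<r<R$ and $0<h<H$ be fixed real numbers. Then there exists a finite positive constant $C=C(r,R,h,H)$, depending only on $r,R,h,H$, such that the following holds for every integer $d\ge2$ and every $1<p\le2$. Let $Q=\{(x,y): x\in B^{d-1}(0,R),\ y\in(0,H)\}\subset\mathbb{R}^d$, and let $u$ be the $p$-harmonic function in $Q$ with Dirichlet boundary condition $$u(x,y)=\begin{cases}0,& y=0\ \text{or}\ |x|=R,\\ 1,& y=H\ \text{and}\ |x|<R.\end{cases}$$ Then for every $x_0\in\mathbb{R}^{d-1}$ with $|x_0|\le r$, $$u(x_0,h)\ge\exp\left(-\frac{Cd}{p-1}\right).$$
   Context: $B^{m}(0,R)$ is the ball of radius $R$ centered at $0$ in $\mathbb{R}^m$; points of $\mathbb{R}^d$ are written $(x,y)$ with $x\in\mathbb{R}^{d-1}$, $y\in\mathbb{R}$. $p$-harmonic function with Dirichlet boundary condition $F$ (Perron solution): For $1<p<\infty$, a function $h\in W^{1,p}_{loc}(D)$ is a weak solution of $\nabla\cdot(|\nabla h|^{p-2}\nabla h)=0$ in an open set $D$ if $\int_D|\nabla h|^{p-2}\nabla h\cdot\nabla\varphi=0$ for all $\varphi\in C_c^\infty(D)$. A function $u:Q\to\mathbb{R}$ is $p$-superharmonic if it is lower semicontinuous and, for every bounded open $D$ with $\overline D\subset Q$ and every $h\in C(\overline D)\cap W^{1,p}_{loc}(D)$ that is a weak solution in $D$, $h\le u$ on $\partial D$ implies $h\le u$ in $D$. A function $u$ is $p$-subharmonic if $-u$ is $p$-superharmonic. Let $\mathcal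 U_F$ be the class of $p$-superharmonic functions $u$ in $Q$ that are bounded below and satisfy $\liminf_{x\to z}u(x)\ge F(z)$ for all $z\in\partial Q$, and $\mathcal L_F$ the class of $p$-subharmonic functions $u$ in $Q$ that are bounded above and satisfy $\limsup_{x\to z}u(x)\le F(z)$ for all $z\in\partial Q$. Put $\overline H_F=\inf_{u\in\mathcal U_F}u$ and $\underline H_F=\sup_{u\in\mathcal L_F}u$. On a bounded Lipschitz domain and for upper (or lower) semicontinuous bounded $F$ one has $\overline H_F=\underline H_F$; this common function is called the $p$-harmonic function with Dirichlet boundary condition $F$. It takes the boundary value $F(z)$ continuously at every continuity point $z$ of $F$. *)

(* Defs.v *)
From HB Require Import structures.
From mathcomp Require Import all_boot all_order all_algebra.
From mathcomp Require Import all_classical all_reals all_analysis.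

Set Implicit Arguments.
Unset Strict Implicit.
Unset Printing Implicit Defensive.
Import Order.TTheory GRing.Theory Num.Theory.
Import numFieldNormedType.Exports.
Local Open Scope classical_set_scope.
Local Open Scope ring_scope.

(* Measurable structure on R^n: the sigma-algebra generated by the coordinates
   (hence the Borel one), as the library does for [n.-tuple T]. *)
Definition rV_display : measure_display.
Proof. by []. Qed.

Section measurable_rV.
Context {R : realType} (n : nat).

Definition rV_coord (i : 'I_n) (v : 'rV[R]_n) : measurableTypeR R := v ord0 i.

Let rV_set0 : g_sigma_preimage rV_coord set0.
Proof. exact: sigma_algebra0. Qed.

Let rV_setC A : g_sigma_preimage rV_coord A -> g_sigma_preimage rV_coord (~` A).
Proof. exact: sigma_algebraC. Qed.

Let rV_bigcup (F : _^nat) : (forall i, g_sigma_preimage rV_coord (F i)) ->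
  g_sigma_preimage rV_coord (\bigcup_i (F i)).
Proof. exact: sigma_algebra_bigcup. Qed.

HB.instance Definition _ := @isMeasurable.Build rV_display 'rV[R]_n
  (g_sigma_preimage rV_coord) rV_set0 rV_setC rV_bigcup.

Lemma measurable_rV_coord (i : 'I_n) : measurable_fun setT (rV_coord i).
Proof.
move=> _ Y mY; rewrite setTI; apply: sub_sigma_algebra => /=.
rewrite -bigcup_seq/=; exists i => /=; first by rewrite mem_index_enum.
by exists Y => //; rewrite setTI.
Qed.

Lemma measurable_fun_rVP d (T : measurableType d) (f : T -> 'rV[R]_n) :
  measurable_fun setT f <-> forall i, measurable_fun setT (rV_coord i \o f).
Proof.
split=> [mf i|mf].
  exact: measurableT_comp (measurable_rV_coord i) mf.
have h : measurable `<=` [set A | measurable (f @^-1` A)].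
  apply: smallest_sub.
    split=> /=.
    - by rewrite preimage_set0; exact: measurable0.
    - by move=> A mA; rewrite setTD preimage_setC; exact: measurableC.
    - by move=> F mF; rewrite preimage_bigcup; exact: bigcup_measurable.
  move=> A; rewrite -bigcup_seq => -[i _ [B mB <-]] /=.
  rewrite setTI -comp_preimage -[X in measurable X]setTI; exact: mf.
by move=> _ A mA; rewrite setTI; exact: h.
Qed.

End measurable_rV.

Section lebesgue_measure_rV.
Context {R : realType}.

Definition rV_cons n (z : measurableTypeR R * 'rV[R]_n) : 'rV[R]_n.+1 :=
  row_mx (const_mx z.1 : 'rV_1) z.2.

Lemma measurable_rV_cons n : measurable_fun setT (@rV_cons n).
Proof.
apply/measurable_fun_rVP => i.
case: (@split_ordP 1 n i) => j ij.
  rewrite (_ : _ \o _ = fst) //; apply/funext => z.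
  rewrite /= /rV_coord /rV_cons ij.
  by apply: etrans (row_mxEl _ _ _ _) _; rewrite mxE.
rewrite (_ : _ \o _ = rV_coord j \o snd).
  exact: measurableT_comp (measurable_rV_coord j) measurable_snd.
by apply/funext => z; rewrite /= /rV_coord /rV_cons ij; exact: row_mxEr.
Qed.

Lemma measurable_rV_uncons n :
  measurable_fun setT (fun v : 'rV[R]_n.+1 =>
    ((v ord0 ord0 : measurableTypeR R), rsubmx (v : 'rV_(1 + n)))).
Proof.
apply/measurable_fun_pairP; split => /=; first exact: measurable_rV_coord.
apply/measurable_fun_rVP => j.
rewrite (_ : _ \o _ = rV_coord (rshift 1 j)); first exact: measurable_rV_coord.
by apply/funext => v; rewrite /rV_coord /= mxE.
Qed.

Section step.
Variables (n : nat) (mu : {sigma_finite_measure set 'rV[R]_n -> \bar R}).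

Definition lebesgue_cons : set 'rV[R]_n.+1 -> \bar R :=
  pushforward (lebesgue_measure \x mu)%E (@rV_cons n).

Let lebesgue_cons0 : lebesgue_cons set0 = 0%E.
Proof. by rewrite /lebesgue_cons /pushforward preimage_set0 measure0. Qed.

Let lebesgue_cons_ge0 A : (0 <= lebesgue_cons A)%E.
Proof. by rewrite /lebesgue_cons /pushforward; exact: measure_ge0. Qed.

Let lebesgue_cons_sigma_additive : semi_sigma_additive lebesgue_cons.
Proof.
move=> F mF tF mUF; rewrite /lebesgue_cons /pushforward preimage_bigcup.
have mc A : measurable A -> measurable (@rV_cons n @^-1` A).
  by move=> mA; rewrite -[X in measurable X]setTI; exact: measurable_rV_cons.
apply: measure_semi_sigma_additive.
- by move=> k; exact: mc.
- apply/trivIsetP => /= i j _ _ ij; rewrite -preimage_setI.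
  by move/trivIsetP : tF => /(_ _ _ _ _ ij) ->//; rewrite preimage_set0.
- by rewrite -preimage_bigcup; exact: mc.
Qed.

HB.instance Definition _ := isMeasure.Build _ _ _ lebesgue_cons
  lebesgue_cons0 lebesgue_cons_ge0 lebesgue_cons_sigma_additive.

Let lebesgue_cons_sigma_finite : sigma_finite setT lebesgue_cons.
Proof.
have /sigma_finiteP[F [TF ndF Foo]] := sigma_finiteT (@lebesgue_measure R).
have /sigma_finiteP[G [TG ndG Goo]] := sigma_finiteT mu.
have rlshift0 : ord0 = lshift n ord0 :> 'I_(1 + n) by exact/val_inj.
pose g (v : 'rV[R]_n.+1) :=
  ((v ord0 ord0 : measurableTypeR R), rsubmx (v : 'rV_(1 + n))).
have gK : cancel (@rV_cons n) g.
  move=> -[x v]; rewrite /g /rV_cons /=; congr (_, _).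
    rewrite rlshift0.
    by apply: etrans (row_mxEl _ _ _ _) _; rewrite mxE.
  exact: row_mxKr.
exists (fun k => g @^-1` (F k `*` G k)).
  rewrite -preimage_bigcup (_ : \bigcup_k _ = setT) ?preimage_setT//.
  rewrite -subTset => -[x y] _.
  have [i _ Fx] : (\bigcup_i F i) x by rewrite -TF.
  have [j _ Gy] : (\bigcup_i G i) y by rewrite -TG.
  exists (maxn i j) => //; split => /=.
  - by move: x Fx; exact/subsetPset/ndF/leq_maxl.
  - by move: y Gy; exact/subsetPset/ndG/leq_maxr.
move=> k; have [mF ?] := Foo k; have [mG ?] := Goo k; split.
  rewrite -[X in measurable X]setTI; apply: measurable_rV_uncons => //.
  exact: measurableX.
rewrite /lebesgue_cons /pushforward -comp_preimage.
rewrite (_ : g \o _ = id); last by apply/funext => z; exact: gK.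
by rewrite preimage_id product_measure1E// lte_mul_pinfty// ge0_fin_numE.
Qed.

HB.instance Definition _ := Measure_isSigmaFinite.Build _ _ _ lebesgue_cons
  lebesgue_cons_sigma_finite.

End step.


Definition lebesgue_point : set 'rV[R]_0 -> \bar R := dirac (0 : 'rV[R]_0).

HB.instance Definition _ := Measure.on lebesgue_point.

Let lebesgue_point_sigma_finite : sigma_finite setT lebesgue_point.
Proof.
exists (fun=> setT); first by rewrite bigcup_const //; exists 0%N.
by move=> _; split=> //; rewrite /lebesgue_point diracT ltry.
Qed.

HB.instance Definition _ := Measure_isSigmaFinite.Build _ _ _
  lebesgue_point lebesgue_point_sigma_finite.

(* Lebesgue measure on R^n, as an iterated product of the one on R. *)
Fixpoint lebesgue_rV n : {sigma_finite_measure set 'rV[R]_n -> \bar R} :=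
  match n with
  | 0 => lebesgue_point
  | m.+1 => lebesgue_cons (lebesgue_rV m)
  end.

End lebesgue_measure_rV.

Section p_harmonic.
Context {R : realType}.

Definition dotv n (v w : 'rV[R]_n) : R := \sum_i v ord0 i * w ord0 i.

(* The norm [`|v|] of the library is the sup norm. *)
Definition enorm n (v : 'rV[R]_n) : R := Num.sqrt (dotv v v).

Definition boundary (T : topologicalType) (A : set T) : set T :=
  closure A `\` interior A.

Variable n : nat.
Implicit Types (p : R) (D Q : set 'rV[R]_n) (f h u phi : 'rV[R]_n -> R).
Implicit Type G : 'rV[R]_n -> 'rV[R]_n.

Definition partial (i : 'I_n) f : 'rV[R]_n -> R := 'D_(delta_mx ord0 i) f.

Definition gradient f (x : 'rV[R]_n) : 'rV[R]_n := \row_i partial i f x.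

(* C^oo : every iterated partial derivative exists and is differentiable. *)
Definition smooth f :=
  forall (s : seq 'I_n) (x : 'rV[R]_n), differentiable (foldr partial f s) x.

Definition fsupport f : set 'rV[R]_n := closure [set x | f x != 0].

Definition test_function D phi :=
  [/\ smooth phi, compact (fsupport phi) & fsupport phi `<=` D].

Local Notation mu := (lebesgue_rV n).

Definition Lp_loc p D f := measurable_fun D f /\
  forall K, compact K -> K `<=` D ->
    (\int[mu]_(x in K) (`|f x| `^ p)%:E < +oo)%E.

Definition weak_gradient D h G := forall phi, test_function D phi ->
  forall i : 'I_n,
    (\int[mu]_(x in D) (h x * partial i phi x)%:E =
     - \int[mu]_(x in D) (G x ord0 i * phi x)%:E)%E.

(* [h] is in W^{1,p}_loc(D), with gradient [G]; the gradient is unique up to a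
   null set, so that quantifying existentially over it below is harmless. *)
Definition sobolev_loc p D h G :=
  [/\ Lp_loc p D h, forall i, Lp_loc p D (fun x => G x ord0 i)
    & weak_gradient D h G].

(* Where [G x = 0] the vector [|G x|^(p-2) G x] is 0, also for [p < 2]. *)
Definition p_harmonic_weak p D h := exists2 G, sobolev_loc p D h G &
  forall phi, test_function D phi ->
    (\int[mu]_(x in D)
      ((enorm (G x) `^ (p - 2)) * dotv (G x) (gradient phi x))%:E = 0)%E.

(* Functions on a subset [Q] of R^n are represented by total functions, of which
   only the values on [Q] matter. *)
Definition p_superharmonic p Q u :=
  lower_semicontinuous (EFin \o u : subspace Q -> \bar R) /\
  forall D h, bounded_set D -> open D -> closure D `<=` Q ->
    {within closure D, continuous h} -> p_harmonic_weak p D h ->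
    (forall x, boundary D x -> h x <= u x) ->
    forall x, D x -> h x <= u x.

Definition p_subharmonic p Q u := p_superharmonic p Q (\- u).

Definition upper_class p Q (F : 'rV[R]_n -> R) : set ('rV[R]_n -> R) :=
  [set u | [/\ p_superharmonic p Q u,
    exists m, forall x, Q x -> m <= u x &
    forall z, boundary Q z ->
      ((F z)%:E <= limf_einf (EFin \o u) (within Q (nbhs z)))%E]].

Definition lower_class p Q (F : 'rV[R]_n -> R) : set ('rV[R]_n -> R) :=
  [set u | [/\ p_subharmonic p Q u,
    exists m, forall x, Q x -> u x <= m &
    forall z, boundary Q z ->
      (limf_esup (EFin \o u) (within Q (nbhs z)) <= (F z)%:E)%E]].

Definition upper_perron p Q F (x : 'rV[R]_n) : \bar R :=
  ereal_inf [set (u x)%:E | u in upper_class p Q F].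

Definition lower_perron p Q F (x : 'rV[R]_n) : \bar R :=
  ereal_sup [set (u x)%:E | u in lower_class p Q F].

(* [u] is the common value on [Q] of the two Perron solutions. *)
Definition p_harmonic_dirichlet p Q F u := forall x, Q x ->
  upper_perron p Q F x = (u x)%:E /\ lower_perron p Q F x = (u x)%:E.

End p_harmonic.

Section cylinder.
Context {R : realType} (m : nat).

(* Points (x, y) of R^m x R are written [xy_point x y]. *)
Definition xpart (z : 'rV[R]_(m + 1)) : 'rV[R]_m := lsubmx z.
Definition ypart (z : 'rV[R]_(m + 1)) : R := rsubmx z ord0 ord0.
Definition xy_point (x : 'rV[R]_m) (y : R) : 'rV[R]_(m + 1) :=
  row_mx x (const_mx y).

Definition cylinder (rad H : R) : set 'rV[R]_(m + 1) :=
  [set z | enorm (xpart z) < rad /\ 0 < ypart z < H].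

(* Only the values on the boundary of the cylinder matter. *)
Definition top_indicator (rad H : R) (z : 'rV[R]_(m + 1)) : R :=
  if (ypart z == H) && (enorm (xpart z) < rad) then 1 else 0.

End cylinder.

(* Main.v *)
(* Let d = m + 1, b = H / (Rad - r)^2, q (x, y) = y - b |x - x0|^2,
   lam (p - 1) = 2 b d and v = (exp (lam q) - 1) / (exp (lam H) - 1).  The
   second derivatives of q are 0 or - 2 b while |grad q| >= 1, so for p <= 2 the
   convexity of exp, which contributes lam (p - 1) |grad q|^2, outweighs the
   concavity of q: the p-flux of v has positive divergence.  Moreover q <= H, and q <= 0 on the bottom and the
   sides of the cylinder, so v belongs to the lower class once it is compared
   with weak solutions; then u >= v, and
   v (x0, h) = (exp (lam h) - 1) / (exp (lam H) - 1) >= lam h exp (- lam H).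

   Comparison of a weak solution h with the strict supersolution w = - v.  If
   h > w somewhere in D, the equation of h minus that of w is tested with
   f (g_s - e), where f t = exp (- 1 / t) for t > 0 and f t = 0 otherwise, and g_s
   is a mollification of g = h - w on D, extended by 0.  This is a genuine smooth
   test function, supported away from the boundary of D, so no Sobolev calculus is
   needed.  Monotonicity of the p-flux makes the main term nonnegative, the error
   made by replacing grad g_s by grad g tends to 0 with s by continuity of
   translations in L^p, and the strict supersolution term stays bounded away
   from 0. *)
Require Import Defs.
From HB Require Import structures.
From mathcomp Require Import all_boot all_order all_algebra.
From mathcomp Require Import all_classical all_reals all_analysis.
From mathcomp Require Import measurable_realfun.
From mathcomp Require Import ring lra.

Set Implicit Arguments.
Unset Strict Implicit.
Unset Printing Implicit Defensive.
Import Order.TTheory GRing.Theory Num.Theory.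
Import numFieldNormedType.Exports.
Local Open Scope classical_set_scope.
Local Open Scope ring_scope.

(** * Borel sets and Lebesgue measure of R^n *)

(** A weak solution may be tested only with smooth compactly supported functions, while the natural
    test function, a positive part of h - w, is merely Sobolev. Mollifying costs nested layers of D:
    g can exceed e / 2 only at depth 3r, hence the test function lives at depth 2r, hence the
    mollifiers centred there, of radius at most r, live at depth r, where all gradients can be cut
    off to become p-integrable. Strictness of the supersolution replaces any discussion of equality
    in the monotonicity of the flux: a fixed positive integral is bounded by an arbitrarily small
    error. The factor d / (p - 1) of the exponent is lam up to a constant. The d - 1 horizontal
    second derivatives of q cost 2 b (d - 1), and lam (p - 1) = 2 b d leaves a surplus of at least 2
    b. The value of b is dictated by the sides: |x0| <= r gives |x - x0| >= Rad - r there, so b |x -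
    x0|^2 >= H >= y. The prefactor lam h is bounded below by 4 b h because d / (p - 1) >= 2, and is
    absorbed into C. *)

Section borel_rV.
Context {R : realType} (n : nat).
Implicit Types (U : set 'rV[R]_n) (x : 'rV[R]_n).

Lemma rV_ballE x (e : R) : 0 < e ->
  ball x e = [set y : 'rV[R]_n | forall i, `|x ord0 i - y ord0 i| < e].
Proof.
move=> e0; apply/seteqP; split=> y /=; first by move=> [_ h] i; exact: h.
by move=> h; split=> // i j; rewrite ord1; exact: h.
Qed.

Lemma measurable_rV_ball x (e : R) : 0 < e -> measurable (ball x e : set 'rV[R]_n).
Proof.
move=> e0; rewrite rV_ballE//.
rewrite (_ : [set _ | _] =
   \bigcap_(i in [set: 'I_n]) (rV_coord i @^-1` ball (x ord0 i) e)); last first.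
  by apply/seteqP; split=> y /= h i => [_|]; exact: (h i).
apply: fin_bigcap_measurable => //= i _; rewrite -[X in measurable X]setTI.
by apply: measurable_rV_coord => //; exact: open_measurable (ball_open _ _).
Qed.

(** The sigma-algebra is generated by coordinates, so a countable union of boxes is required: balls
    with rational centres and radii 1/(j+1), enumerated by [unpickle]; a code that gives no ball
    inside [U] contributes the empty set. *)
Lemma open_measurable_rV U : open U -> measurable U.
Proof.
move=> oU.
pose F (k : nat) : set 'rV[R]_n := if (unpickle k : option ('rV[rat]_n * nat)) is Some (q, j)
  then let B := ball (map_mx ratr q : 'rV[R]_n) (j.+1%:R^-1 : R) in
       if `[< B `<=` U >] then B else set0 else set0.
rewrite (_ : U = \bigcup_k F k); last first.
  apply/seteqP; split=> [x Ux|x [k _]]; last first.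
    rewrite /F; case: unpickle => [[q j]|//] /=.
    by case: asboolP => // + ?; exact.
  have /nbhs_ballP[e /= e0 xeU] : nbhs x U by exact: open_nbhs_nbhs.
  (* With a rational centre within [t] of [x], the ball of radius [t] contains [x] and lies in the
     ball of radius 2t around [x]. *)
  have [j je] : exists j : nat, j.+1%:R^-1 < e / 2.
    exists (Num.trunc (2 / e)); rewrite invf_plt ?posrE ?divr_gt0// invf_div.
    exact: truncnS_gt.
  have j0 : 0 < (j.+1%:R : R)^-1 by [].
  set t := (j.+1%:R)^-1 in je j0.
  have /choice[q qx] : forall i, exists q : rat, `|x ord0 i - ratr q| < t.
    move=> i; have : x ord0 i - t < x ord0 i + t.
      by lra.
    by move=> /rat_in_itvoo[q]; rewrite in_itv/= -ltr_distlC => h; exists q.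
  exists (pickle (\row_i q i : 'rV[rat]_n, j)) => //.
  rewrite /F pickleK /=.
  have xB : ball (map_mx ratr (\row_i q i) : 'rV[R]_n) t x.
    by rewrite rV_ballE// => i; rewrite !mxE distrC.
  case: asboolP => // nU; exfalso; apply: nU => y yB; apply: xeU.
  apply: (@le_ball _ _ _ (t + t)); first by lra.
  exact: ball_triangle (ball_sym xB) yB.
apply: bigcupT_measurable => k; rewrite /F; case: unpickle => [[q j]|//] /=.
by case: asboolP => // _; apply: measurable_rV_ball.
Qed.

Lemma closed_measurable_rV U : closed U -> measurable U.
Proof. by move/closed_openC/open_measurable_rV/measurableC; rewrite setCK. Qed.

Lemma compact_measurable_rV U : compact U -> measurable U.
Proof. by move/(compact_closed (@norm_hausdorff _ _))/closed_measurable_rV. Qed.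

Lemma continuous_measurable_rV (f : 'rV[R]_n -> R) :
  continuous f -> measurable_fun setT f.
Proof.
move=> /continuousP cf; apply: (measurability _ (RGenOpens.measurableE R)).
move=> _ [_ [a [b ->] <-]]; rewrite setTI; apply: open_measurable_rV.
exact/cf/interval_open.
Qed.

Lemma measurable_rV_add x : measurable_fun setT (+%R^~ x : 'rV[R]_n -> 'rV[R]_n).
Proof.
apply/measurable_fun_rVP => i.
rewrite (_ : _ \o _ = fun y => rV_coord i y + x ord0 i); last first.
  by apply/funext => y; rewrite /rV_coord /= mxE.
apply: measurable_funD => //; exact: measurable_rV_coord.
Qed.

(* The open measurable sets form a pi-system generating the sigma-algebra. *)
Lemma rV_open_induction (P : set_system 'rV[R]_n) :
  (forall U, open U -> P U) ->
  (forall A, measurable A -> P A -> P (~` A)) ->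
  (forall F : (set 'rV[R]_n)^nat, (forall k, measurable (F k)) ->
     trivIset setT F -> (forall k, P (F k)) -> P (\bigcup_k F k)) ->
  forall A, measurable A -> P A.
Proof.
move=> PU PC Pbig A mA.
have E : @measurable _ 'rV[R]_n = <<s @open 'rV[R]_n >>.
  apply/seteqP; split; last first.
    apply: smallest_sub; first exact: sigma_algebra_measurable.
    by move=> U; exact: open_measurable_rV.
  apply: smallest_sub; first exact: smallest_sigma_algebra.
  move=> B; rewrite -bigcup_seq => -[i _ [C mC <-]]; rewrite setTI.
  have : @measurable _ (measurableTypeR R) `<=` [set C : set R | <<s @open 'rV[R]_n >> (rV_coord i @^-1` C)].
    rewrite RGenOpens.measurableE; apply: smallest_sub.
      split=> /=.
      - by rewrite preimage_set0; exact: sigma_algebra0.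
      - by move=> D; rewrite setTD preimage_setC; exact: sigma_algebraC.
      - by move=> F; rewrite preimage_bigcup; exact: sigma_algebra_bigcup.
    move=> _ [a [b ->]] /=; apply: sub_sigma_algebra.
    move: (@coord_continuous R 1 n ord0 i) => /continuousP; apply.
    exact: interval_open.
  by apply.
apply: (dynkin_induction E) => //; last by rewrite -E.
- by move=> U V; exact: openI.
- exact/PU/openT.
Qed.

End borel_rV.

(** * Translation invariance of Lebesgue measure and volume of balls *)

Section translation.
Context {R : realType}.

Lemma ge0_integral_measure_preserving d (T : measurableType d)
    (mu : {measure set T -> \bar R}) (phi : T -> T) (f : T -> \bar R) :
  measurable_fun setT phi ->
  (forall A, measurable A -> mu (phi @^-1` A) = mu A) ->
  measurable_fun setT f -> (forall x, 0 <= f x)%E ->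
  (\int[mu]_x f (phi x) = \int[mu]_x f x)%E.
Proof.
move=> mphi muphi mf f0.
rewrite -[LHS](_ : (\int[pushforward mu phi]_y f y = _)%E); last first.
  by rewrite ge0_integral_pushforward//.
by apply: eq_measure_integral => A mA _; exact: muphi.
Qed.

(** The pushforward under the translation agrees with Lebesgue measure on half-open intervals, and
    these determine it. *)
Lemma lebesgue_measure_translation (a : R) (A : set R) : measurable A ->
  lebesgue_measure ((+%R^~ a) @^-1` A) = lebesgue_measure A.
Proof.
move=> mA; pose f := (+%R^~ a : measurableTypeR R -> measurableTypeR R).
have mf : measurable_fun setT f by apply: measurable_funD.
pose nu := pushforward (@lebesgue_measure R) f.
suff -> : lebesgue_measure A = nu A by [].
apply: (@lebesgue_measure_unique R nu) => // X [[x y] _ <-] /=.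
rewrite /nu /pushforward /=.
rewrite (_ : f @^-1` _ = `]x - a, y - a]%classic); last first.
  by apply/seteqP; split=> z; rewrite /f /= !in_itv/= ltrBlDr lerBrDr.
rewrite [LHS]lebesgue_measure_itv [RHS]lebesgue_measure_itv/= !lte_fin ltrD2r.
by case: ifPn => // _; rewrite -!EFinB opprB addrA subrK.
Qed.

Lemma rV_consl n (z : R * 'rV[R]_n) (j : 'I_1) :
  rV_cons z ord0 (lshift n j) = z.1.
Proof. by apply: etrans (row_mxEl _ _ _ _) _; rewrite mxE. Qed.

Lemma rV_consr n (z : R * 'rV[R]_n) (j : 'I_n) :
  rV_cons z ord0 (rshift 1 j) = z.2 ord0 j.
Proof. exact: row_mxEr. Qed.

(** Induction along the iterated product: the tail of [a] translates each section, which keeps its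
    measure, and the head of [a] translates the variable that indexes the sections. *)
Lemma lebesgue_rV_translation n (a : 'rV[R]_n) (A : set 'rV[R]_n) : measurable A ->
  lebesgue_rV n ((+%R^~ a) @^-1` A) = lebesgue_rV n A.
Proof.
elim: n a A => [|n ih] a A mA.
  by rewrite (_ : +%R^~ a = id) // funeqE => x; apply/rowP => -[].
rewrite /= /lebesgue_cons /pushforward /product_measure1 /=.
have mcA : measurable (@rV_cons R n @^-1` A).
  by rewrite -[X in measurable X]setTI; exact: measurable_rV_cons.
pose a0 : R := a ord0 ord0; pose a' : 'rV[R]_n := rsubmx (a : 'rV_(1 + n)).
pose f (t : R) : \bar R := lebesgue_rV n (xsection (@rV_cons R n @^-1` A) t).
transitivity (\int[lebesgue_measure]_x f (x + a0)%R)%E.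
  apply: eq_integral => t _.
  have mx : measurable (xsection (@rV_cons R n @^-1` A) (t + a0)).
    exact: measurable_xsection.
  apply: etrans (ih a' _ mx).
  have E v : rV_cons (t, v) + a = rV_cons (t + a0, v + a').
    apply/rowP => i; rewrite mxE; case: (@split_ordP 1 n i) => j ->.
      rewrite !rV_consl ord1 /a0.
      by congr (_ + a _ _); exact/val_inj.
    by rewrite !rV_consr !mxE.
  congr (lebesgue_rV n _); apply/seteqP.
  by split => v; rewrite /xsection /= !inE /= E.
apply: (@ge0_integral_measure_preserving _ (measurableTypeR R) lebesgue_measure
  (+%R^~ a0) f) => //.
- exact: measurable_funD.
- by move=> B mB; exact: lebesgue_measure_translation.
- exact: measurable_fun_xsection.
Qed.

Lemma ge0_integral_translation n (a : 'rV[R]_n) (f : 'rV[R]_n -> \bar R) :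
  measurable_fun setT f -> (forall x, 0 <= f x)%E ->
  (\int[lebesgue_rV n]_x f (x + a)%R = \int[lebesgue_rV n]_x f x)%E.
Proof.
move=> mf f0; apply: (@ge0_integral_measure_preserving _ _ (lebesgue_rV n) (+%R^~ a) f) => //.
- exact: measurable_rV_add.
- by move=> A mA; exact: lebesgue_rV_translation.
Qed.

Lemma integral_translation n (a : 'rV[R]_n) (f : 'rV[R]_n -> \bar R) :
  measurable_fun setT f ->
  (\int[lebesgue_rV n]_x f (x + a)%R = \int[lebesgue_rV n]_x f x)%E.
Proof.
move=> mf; rewrite integralE [RHS]integralE; congr (_ - _)%E.
- rewrite -(ge0_integral_translation a (f := f^\+%E))//; last first.
    exact: measurable_funepos.
  by apply: eq_integral => x _; rewrite !funeposE.
- rewrite -(ge0_integral_translation a (f := f^\-%E))//; last first.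
    exact: measurable_funeneg.
  by apply: eq_integral => x _; rewrite !funenegE.
Qed.

Lemma integrable_translation n (a : 'rV[R]_n) (f : 'rV[R]_n -> \bar R) :
  (lebesgue_rV n).-integrable setT f ->
  (lebesgue_rV n).-integrable setT (fun x => f (x + a)%R).
Proof.
move=> /integrableP[mf fy]; apply/integrableP; split.
  exact: measurableT_comp (measurable_rV_add a).
rewrite (ge0_integral_translation a (f := fun x => `|f x|%E))//.
exact: measurableT_comp.
Qed.

(** Balls of the sup norm are cubes, hence products of an interval and a cube of one dimension
    less. *)
Lemma lebesgue_rV_ball n (x : 'rV[R]_n) (e : R) : 0 < e ->
  lebesgue_rV n (ball x e) = ((e *+ 2) ^+ n)%:E.
Proof.
move=> e0; elim: n x => [|n ih] x.
  rewrite rV_ballE//= /lebesgue_point diracE expr0 (_ : (_ \in _) = true)//.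
  by apply/mem_set => -[].
rewrite /= /lebesgue_cons /pushforward /product_measure1 /=.
pose x0 : R := x ord0 ord0; pose x' : 'rV[R]_n := rsubmx (x : 'rV_(1 + n)).
rewrite (_ : _ @^-1` _ = ball x0 e `*` ball x' e); last first.
  rewrite !rV_ballE//; apply/seteqP; split => -[t v] /=.
    move=> h; split => [|i].
      have := h (@lshift 1 n ord0); rewrite rV_consl.
      by congr (`|x _ _ - _| < _); exact: (@ord_inj n.+1).
    by have := h (@rshift 1 n i); rewrite rV_consr /x' mxE.
  move=> [h1 h2] i; case: (@split_ordP 1 n i) => j ->.
    rewrite rV_consl; have -> : @lshift 1 n j = ord0.
      by apply: (@ord_inj n.+1); rewrite /= ord1.
    exact: h1.
  by rewrite rV_consr; have := h2 j; rewrite /x' mxE.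
rewrite (_ : (\int[_]_x _)%E = (lebesgue_measure \x lebesgue_rV n)%E
  (ball x0 e `*` ball x' e))//.
rewrite product_measure1E; last 2 first.
- exact: open_measurable (ball_open _ _).
- exact: measurable_rV_ball.
rewrite ih exprS EFinM; congr (_ * _)%E.
exact: lebesgue_measure_ball (ltW e0).
Qed.

Lemma bounded_lebesgue_rV n (A : set 'rV[R]_n) : measurable A -> bounded_set A ->
  (lebesgue_rV n A < +oo)%E.
Proof.
move=> mA [M [_ bA]]; apply: (@le_lt_trans _ _ (lebesgue_rV n (ball 0 (`|M| + 2)))).
  apply: le_measure; rewrite ?inE//; first exact: measurable_rV_ball.
  move=> x Ax; rewrite -ball_normE/= sub0r normrN.
  apply: le_lt_trans (bA (`|M| + 1) _ x Ax) _; last by rewrite ltrD2l ltr1n.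
  by rewrite ltr_pwDr// ler_norm.
by rewrite lebesgue_rV_ball ?ltry.
Qed.

End translation.

(** * Smooth functions *)

Lemma is_derive_comp (R : realType) (V : normedModType R) (q : V -> R)
    (f : R -> R) (x v : V) (f' : R) :
  differentiable q x -> is_derive (q x) 1 f f' ->
  is_derive x v (f \o q) (f' * 'D_v q x).
Proof.
move=> dq [df <-]; have df' : differentiable f (q x) by exact/derivable1_diffP.
apply: DeriveDef; first exact/diff_derivable/differentiable_comp.
rewrite deriveE; last exact: differentiable_comp.
rewrite diff_comp//= diff1E//= derive1E [RHS]mulrC !deriveE//.
Qed.

Section flat.
Context {R : realType}.
Implicit Types (P : {poly R}) (t : R).

(* The derivatives of exp(-1/t) are of the form P(1/t) exp(-1/t). *)
Definition flat P t : R := if 0 < t then P.[t^-1] * expR (- t^-1) else 0.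

Lemma flat_le0 P t : t <= 0 -> flat P t = 0.
Proof. by rewrite /flat; case: ltP. Qed.

Lemma flat1_gt0 t : 0 < t -> 0 < flat 1 t.
Proof. by move=> t0; rewrite /flat t0 hornerC mul1r expR_gt0. Qed.

Lemma flat1_ge0 t : 0 <= flat 1 t.
Proof. by rewrite /flat; case: ifP => // _; rewrite hornerC mul1r expR_ge0. Qed.

Lemma flat1_nondecreasing : {homo flat 1 : s t / s <= t}.
Proof.
move=> s t st; have [s0|s0] := leP s 0; first by rewrite (flat_le0 _ s0) flat1_ge0.
have t0 := lt_le_trans s0 st.
by rewrite /flat s0 t0 !hornerC !mul1r ler_expR lerN2 lef_pV2 ?posrE.
Qed.

(** With s = 1/t and k the size of [P], |P(s)| is at most a constant times s^k, while exp s
    dominates s^(k+2)/(k+2)!. The two spare powers leave t^2, which makes the derivative at the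
    origin vanish. *)
Lemma flat_near0 P : exists2 C, 0 <= C & forall t, `|t| <= 1 -> `|flat P t| <= C * t ^+ 2.
Proof.
pose k := size P.
exists ((\sum_(i < size P) `|P`_i|) * (k.+2)`!%:R).
  by rewrite mulr_ge0// sumr_ge0.
move=> t t1; have [t0|t0] := leP t 0.
  by rewrite flat_le0// normr0 mulr_ge0 ?sqr_ge0// mulr_ge0// sumr_ge0.
rewrite /flat t0; set s := t^-1.
have s1 : 1 <= s by rewrite /s invf_ge1// (le_trans (ler_norm _) t1).
have s0 : 0 < s by rewrite invr_gt0.
rewrite normrM (ger0_norm (expR_ge0 _)).
have hP : `|P.[s]| <= (\sum_(i < size P) `|P`_i|) * s ^+ k.
  rewrite horner_coef (le_trans (ler_norm_sum _ _ _))// mulr_suml ler_sum// => i _.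
  rewrite normrM ler_wpM2l// ger0_norm ?exprn_ge0 ?(ltW s0)//.
  by rewrite ler_weXn2l// ltnW.
have he : expR (- s) <= (k.+2)`!%:R / s ^+ k.+2.
  rewrite expRN -[leRHS]invrK invf_div lef_pV2 ?posrE ?expR_gt0//; last first.
    by rewrite divr_gt0 ?exprn_gt0// ltr0n fact_gt0.
  by apply: le_trans (expR_ge1Dxn k.+1 (ltW s0)); rewrite lerDr.
apply: le_trans (ler_pM (normr_ge0 _) (expR_ge0 _) hP he) _.
rewrite -!mulrA ler_wpM2l ?sumr_ge0// [leLHS]mulrCA ler_wpM2l//.
by rewrite -addn2 exprD invfM mulrA mulfV ?expf_neq0 ?gt_eqF// mul1r /s exprVn invrK.
Qed.

(** For t > 0 the inner derivative of 1/t gives the factor X^2 and a sign, so P becomes X^2 (P -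
    P'). At 0 the quadratic bound applies. The family is thus closed under differentiation. *)
Lemma is_derive_flat P t :
  is_derive t 1 (flat P) (flat ('X^2 * (P - P^`())) t).
Proof.
have [t0|t0|->] := ltgtP t 0.
- rewrite (flat_le0 _ (ltW t0)); apply: (@near_eq_is_derive _ _ _ (cst 0)).
  by near=> s; rewrite flat_le0// ltW//; near: s; exact: lt_nbhsl.
- apply: (@near_eq_is_derive _ _ _ ((horner P \o GRing.inv) * ((expR \o -%R) \o GRing.inv))).
    by near=> s; rewrite /flat (_ : 0 < s)//; near: s; exact: lt_nbhsr.
  have tn0 : t != 0 by rewrite gt_eqF.
  have dinv : differentiable (GRing.inv : R -> R) t by exact: differentiable_Rinv.
  have Dinv : 'D_1 (GRing.inv : R -> R) t = - t ^- 2.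
    by rewrite deriveE// diff_Rinv//= /GRing.scale/= mulr1.
  have dP : is_derive t^-1 1 (horner P) P^`().[t^-1].
    rewrite derivE derive1E; apply: derivableP; exact: derivable_horner.
  have dei : is_derive t^-1 1 (expR \o -%R) (- expR (- t^-1)).
    have dN : differentiable (-%R : R -> R) t^-1 by [].
    have := @is_derive_comp R R -%R expR t^-1 1 _ dN (is_derive_expR _).
    by rewrite deriveN// derive_id mulrN1.
  have := is_deriveM (@is_derive_comp R R GRing.inv _ t 1 _ dinv dP)
                     (@is_derive_comp R R GRing.inv _ t 1 _ dinv dei).
  rewrite Dinv => H; apply: (is_derive_eq H).
  rewrite /flat t0 /= !(hornerE, hornerXn) /= /GRing.scale /= -exprVn.
  have ringE (a b c d : R) : a * (- c * - d) + c * (b * - d) = d * (a - b) * c.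
    by ring.
  exact: ringE.
- rewrite flat_le0//; have [C C0 hC] := flat_near0 P.
  suff h : h^-1 *: ((flat P \o shift 0) (h *: (1:R)) - flat P 0) @[h --> 0^'] --> (0 : R).
    by apply: DeriveDef; [apply/cvg_ex; exists 0|exact: cvg_lim].
  rewrite (flat_le0 _ (lexx 0)); apply/cvgr0Pnorm_le => e e0.
  near=> h; rewrite /= subr0 addr0 [_%:A]mulr1 normrZ normfV.
  have h0 : h != 0 by near: h; exact: nbhs_dnbhs_neq.
  rewrite mulrC ler_pdivrMr ?normr_gt0//.
  apply: le_trans (hC _ _) _.
    by near: h; apply: dnbhs0_le.
  rewrite -real_normK ?num_real// expr2 mulrA ler_wpM2r//.
  apply: (@le_trans _ _ ((C + 1) * `|h|)); first by rewrite ler_wpM2r// lerDl.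
  rewrite mulrC -ler_pdivlMr ?ltr_wpDl//; near: h; apply: dnbhs0_le.
  by rewrite divr_gt0// ltr_wpDl.
Unshelve. all: by end_near. Qed.

Lemma differentiable_flat P t : differentiable (flat P) t.
Proof. by apply/derivable1_diffP; have [] := is_derive_flat P t. Qed.

End flat.

Section smooth.
Context {R : realType} {n : nat}.
Implicit Types (f g q : 'rV[R]_n -> R) (i : 'I_n).

Lemma smooth_differentiable f x : smooth f -> differentiable f x.
Proof. by move=> /(_ [::] x). Qed.

Lemma smooth_continuous f : smooth f -> continuous f.
Proof. by move=> sf x; exact/differentiable_continuous/smooth_differentiable. Qed.

Lemma smooth_partial f i : smooth f -> smooth (partial i f).
Proof.
by move=> sf s x; have := sf (rcons s i) x; rewrite -cats1 foldr_cat.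
Qed.

(** A coinduction principle: to prove smoothness, exhibit a class of differentiable functions stable
    under partial derivatives, instead of computing iterated derivatives. *)
Lemma smooth_stable (S : set ('rV[R]_n -> R)) :
  (forall f, S f -> forall x, differentiable f x) ->
  (forall f i, S f -> S (partial i f)) -> S `<=` @smooth R n.
Proof.
move=> Sd Sp f Sf s; suff /Sd : S (foldr (@partial R n) f s) by [].
by elim: s => //= i s; exact: Sp.
Qed.

Lemma partialD f g i : (forall x, differentiable f x) ->
  (forall x, differentiable g x) -> partial i (f + g) = partial i f + partial i g.
Proof.
by move=> df dg; apply/funext => x; apply: deriveD; exact: diff_derivable.
Qed.

Lemma partialM f g i : (forall x, differentiable f x) ->
  (forall x, differentiable g x) ->
  partial i (f * g) = f * partial i g + g * partial i f.
Proof.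
by move=> df dg; apply/funext => x; apply: deriveM; exact: diff_derivable.
Qed.

Lemma partial_cst (a : R) i : partial i (cst a : 'rV[R]_n -> R) = cst 0.
Proof. by apply/funext => x; exact: derive_cst. Qed.

Lemma smooth_cst (a : R) : smooth (cst a : 'rV[R]_n -> R).
Proof.
apply: (@smooth_stable [set f | exists a, f = cst a]); last by exists a.
- by move=> _ [b ->] x.
- by move=> _ i [b ->]; exists 0; exact: partial_cst.
Qed.

Lemma partial_coord i j :
  partial i (fun x : 'rV[R]_n => x ord0 j) = cst ((i == j)%:R : R).
Proof.
apply/funext => x; rewrite /partial.
have @f : {linear 'rV[R]_n -> R}.
  by exists (fun N : 'rV[R]_n => N ord0 j); do 2![eexists]; do ?[constructor];
     rewrite ?mxE// => ? *; rewrite ?mxE//; move=> ?; rewrite !mxE.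
rewrite deriveE; last exact: differentiable_coord.
rewrite (_ : (fun _ => _) = f)// diff_lin /=; last exact: coord_continuous.
by rewrite mxE eqxx eq_sym.
Qed.

Lemma smooth_coord j : smooth (fun x : 'rV[R]_n => x ord0 j).
Proof.
apply: (@smooth_stable [set f | smooth f \/ f = (fun x => x ord0 j)]); last by right.
- move=> f [sf x|-> x]; [exact: smooth_differentiable|exact: differentiable_coord].
- move=> f i [sf|->]; left; first exact: smooth_partial.
  by rewrite partial_coord; exact: smooth_cst.
Qed.

Lemma partial_flat q P i : (forall x, differentiable q x) ->
  partial i (flat P \o q) = (flat ('X^2 * (P - P^`())) \o q) * partial i q.
Proof.
move=> dq; apply/funext => x.
have [_] := is_derive_comp (delta_mx ord0 i) (dq x) (is_derive_flat P (q x)).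
by [].
Qed.

(** The algebra generated by the smooth functions and all [flat P \o q]. The Leibniz and chain rules
    keep it stable under partial derivatives, so one application of [smooth_stable] yields
    smoothness of composites, sums and products together. *)
Inductive flat_algebra q : ('rV[R]_n -> R) -> Prop :=
| flat_algebra_smooth f : smooth f -> flat_algebra q f
| flat_algebra_flat P : flat_algebra q (flat P \o q)
| flat_algebraD f g : flat_algebra q f -> flat_algebra q g -> flat_algebra q (f + g)
| flat_algebraM f g : flat_algebra q f -> flat_algebra q g -> flat_algebra q (f * g).

Lemma flat_algebra_sub q : smooth q -> flat_algebra q `<=` @smooth R n.
Proof.
move=> sq; have d f : flat_algebra q f -> forall x, differentiable f x.
  elim=> {f} [f sf x|P x|f g _ df _ dg x|f g _ df _ dg x].
  - exact: smooth_differentiable.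
  - apply: differentiable_comp; first exact: smooth_differentiable.
    exact: differentiable_flat.
  - exact: differentiableD.
  - exact: differentiableM.
apply: smooth_stable => // f i; elim=> {f} [f sf|P|f g Qf ihf Qg ihg|f g Qf ihf Qg ihg].
- exact/flat_algebra_smooth/smooth_partial.
- rewrite partial_flat; last by move=> x; exact: smooth_differentiable.
  apply: flat_algebraM; first exact: flat_algebra_flat.
  exact/flat_algebra_smooth/smooth_partial.
- by rewrite partialD; [exact: flat_algebraD|exact: d|exact: d].
- rewrite partialM; [|exact: d|exact: d].
  by apply: flat_algebraD; exact: flat_algebraM.
Qed.

Lemma smooth_flat q P : smooth q -> smooth (flat P \o q).
Proof. by move=> sq; apply: (flat_algebra_sub sq); exact: flat_algebra_flat. Qed.

(** Any smooth function can play the part of [q] in [flat_algebra]; here it is [f]. *)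
Lemma smoothD f g : smooth f -> smooth g -> smooth (f + g).
Proof.
move=> sf sg; apply: (flat_algebra_sub sf).
by apply: flat_algebraD; exact: flat_algebra_smooth.
Qed.

Lemma smoothM f g : smooth f -> smooth g -> smooth (f * g).
Proof.
move=> sf sg; apply: (flat_algebra_sub sf).
by apply: flat_algebraM; exact: flat_algebra_smooth.
Qed.

Lemma smooth_sum (I : Type) (r : seq I) (F : I -> 'rV[R]_n -> R) :
  (forall k, smooth (F k)) -> smooth (\sum_(k <- r) F k).
Proof.
move=> sF; apply: big_ind => //; first exact: (smooth_cst 0).
exact: smoothD.
Qed.

Lemma partial_shift f (a : 'rV[R]_n) i :
  partial i (fun x => f (x + a)) = (fun x => partial i f (x + a)).
Proof.
apply/funext => x; rewrite /partial /derive; congr (lim (_ @ 0^')).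
by apply/funext => h /=; rewrite addrA.
Qed.

Lemma smooth_shift f (a : 'rV[R]_n) : smooth f -> smooth (fun x => f (x + a)).
Proof.
move=> sf; apply: (@smooth_stable [set f | exists2 g, smooth g & f = (fun x => g (x + a))]).
- move=> _ [g sg ->] x; apply: differentiable_comp => //.
  exact: smooth_differentiable.
- move=> _ i [g sg ->]; exists (partial i g); first exact: smooth_partial.
  by rewrite partial_shift.
- by exists f.
Qed.

End smooth.

(** * Integration by parts *)

Section bounded_support.
Context {R : realType} {n : nat}.
Implicit Types (f g k : 'rV[R]_n -> R) (x y v : 'rV[R]_n).
Local Notation mu := (@lebesgue_rV R n).

(** Compact support phrased with a radius: it passes to derivatives, shifts and products without
    handling closures. *)
Definition bounded_support f := exists M, forall x, M <= `|x| -> f x = 0.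

Lemma bounded_support_gt0 f : bounded_support f ->
  exists2 M, 0 < M & forall x, M <= `|x| -> f x = 0.
Proof.
move=> [M hM]; exists (`|M| + 1); first by rewrite ltr_wpDl.
move=> x Mx; apply: hM; apply: le_trans Mx.
by rewrite (le_trans (ler_norm _))// lerDl.
Qed.

Lemma compact_bounded_support K f : compact K -> (forall x, ~ K x -> f x = 0) ->
  bounded_support f.
Proof.
move=> /compact_bounded[M [_ bK]] Kf; exists (`|M| + 2) => x Mx; apply: Kf => Kx.
have M1 : M < `|M| + 1 by rewrite ltr_pwDr ?ler_norm.
by have := le_trans Mx (bK _ M1 x Kx); rewrite lerD2l; lra.
Qed.

Lemma bounded_support_partial f i : bounded_support f ->
  bounded_support (partial i f).
Proof.
(* The extra unit makes [f] vanish on a neighbourhood of [x], so the derivative is that of the zero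
   function. *)
move=> [M hM]; exists (M + 1) => x Mx.
rewrite /partial (near_eq_derive _ (g := cst 0)) ?derive_cst//.
near=> y; apply: hM.
have : `|x - y| < 1.
  by near: y; apply/nbhs_ballP; exists 1 => //= y; rewrite -ball_normE.
by have := ler_distD y x 0; rewrite !subr0; lra.
Unshelve. all: by end_near. Qed.

Lemma bounded_support_shift f (a : 'rV[R]_n) : bounded_support f ->
  bounded_support (fun x => f (x + a)).
Proof.
move=> [M hM]; exists (M + `|a|) => x Mx; apply: hM.
by have := ler_normB (x + a) a; rewrite addrK; lra.
Qed.

Lemma bounded_supportMr f g : bounded_support f -> bounded_support (g * f).
Proof. by move=> [M hM]; exists M => x /hM; rewrite !fctE => ->; rewrite mulr0. Qed.

Lemma continuous_bounded_support_bounded f : continuous f -> bounded_support f ->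
  exists2 C, 0 <= C & forall x, `|f x| <= C.
Proof.
move=> cf /bounded_support_gt0[M M0 hM].
have cK : compact (closed_ball 0 M : set 'rV[R]_n).
  apply: bounded_closed_compact; last exact: closed_ball_closed.
  exists M; split; first by rewrite num_real.
  move=> N MN x; rewrite closed_ballE// /closed_ball_/= sub0r normrN => h.
  exact: le_trans h (ltW MN).
have /compact_bounded[C [_ hC]] : compact (f @` closed_ball 0 M).
  by apply: continuous_compact => //; exact: continuous_subspaceT.
exists (`|C| + 1); first by rewrite addr_ge0.
move=> x; have [Mx|xM] := leP M `|x|; first by rewrite hM// normr0 addr_ge0.
apply: hC; first by rewrite ltr_pwDr ?ler_norm.
exists x => //; rewrite closed_ballE// /closed_ball_/= sub0r normrN; exact: ltW.
Qed.

Lemma integrable_indic_rV_ball x (e : R) : 0 < e ->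
  mu.-integrable setT (fun y => (\1_(ball x e) y)%:E).
Proof.
move=> e0; have mB : measurable (ball x e : set 'rV[R]_n) by exact: measurable_rV_ball.
apply/integrableP; split.
  by apply/measurable_EFinP; exact: measurable_indic.
under eq_integral do rewrite gee0_abs ?lee_fin//.
rewrite integral_indic// setIT.
suff : (mu (ball x e) < +oo)%E by [].
by rewrite lebesgue_rV_ball// ltry.
Qed.

Lemma bounded_support_integrable f : measurable_fun setT f ->
  bounded_support f -> (exists C, forall x, `|f x| <= C) ->
  mu.-integrable setT (EFin \o f).
Proof.
move=> mf /bounded_support_gt0[M M0 hM] [C hC].
apply: (@le_integrable _ _ _ mu _ measurableT _ (EFin \o (fun x => C * \1_(ball 0 M) x))).
- exact/measurable_EFinP.
- move=> x _ /=; rewrite lee_fin indicE -ball_normE.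
  have [xM|Mx] := boolP (_ \in _); first by rewrite mulr1 (le_trans (hC x))// ler_norm.
  rewrite mulr0 normr0 hM ?normr0//.
  by move: Mx; rewrite notin_setE /= sub0r normrN => /negP; rewrite -leNgt.
- rewrite (_ : EFin \o _ = (fun x => C%:E * (\1_(ball 0 M) x)%:E)%E)//.
  apply: integrableZl => //; exact: integrable_indic_rV_ball.
Qed.

Lemma smooth_bounded_support_integrable f : continuous f -> bounded_support f ->
  mu.-integrable setT (EFin \o f).
Proof.
move=> cf bf; apply: bounded_support_integrable => //.
  exact: continuous_measurable_rV.
by have [C _ hC] := continuous_bounded_support_bounded cf bf; exists C.
Qed.

Lemma rV_sum_delta v : v = \sum_i v ord0 i *: delta_mx ord0 i.
Proof. exact: row_sum_delta. Qed.

Lemma diff_partial f x v : differentiable f x ->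
  'd f x v = \sum_i v ord0 i * partial i f x.
Proof.
move=> df; rewrite {1}[v]rV_sum_delta linear_sum; apply: eq_bigr => i _.
by rewrite linearZ /partial deriveE.
Qed.

Lemma rV_norm_coord v i : `|v ord0 i| <= `|v|.
Proof.
rewrite [leRHS]/Num.Def.normr/= mx_normrE.
exact: (le_bigmax _ (fun ij => `|v ij.1 ij.2|) (ord0, i)).
Qed.

Lemma rV_norm_le v (C : R) : 0 <= C -> (forall i, `|v ord0 i| <= C) -> `|v| <= C.
Proof.
move=> C0 h; rewrite [leLHS]/Num.Def.normr/= mx_normrE.
by apply: bigmax_le => // -[i j] _; rewrite ord1; exact: h.
Qed.

Lemma mean_value_rV f x v : (forall y, differentiable f y) ->
  exists c : R, [/\ 0 <= c, c <= 1 &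
    f (x + v) - f x = \sum_i v ord0 i * partial i f (x + c *: v)].
Proof.
move=> df; pose l (t : R) := x + t *: v.
have [||c] := @MVT_segment R (f \o l) (fun t => 'd f (l t) v) 0 1 ler01.
- move=> t _; apply: DeriveDef; first exact/derivable1_diffP/differentiable_comp.
  rewrite deriveE; last exact: differentiable_comp.
  rewrite diff_comp//=; suff -> : 'd l t 1 = v by [].
  by rewrite /l diff_val /= /cst add0r scale1r.
- apply: continuous_subspaceT => t.
  exact/differentiable_continuous/differentiable_comp.
rewrite in_itv/= => /andP[c0 c1]; rewrite /= /l scale1r scale0r addr0 subr0 mulr1.
by move=> ->; exists c; split => //; rewrite diff_partial.
Qed.

Lemma smooth_bounded_support_lipschitz f : smooth f -> bounded_support f ->
  exists2 C, 0 <= C & forall x v, `|f (x + v) - f x| <= C * `|v|.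
Proof.
move=> sf bf.
have /choice[c hc] : forall i, exists c, forall x, `|partial i f x| <= c.
  move=> i; have [|c _ hc] := @continuous_bounded_support_bounded (partial i f) _
    (bounded_support_partial i bf); last by exists c.
  exact/smooth_continuous/smooth_partial.
have c0 i : 0 <= c i by exact: le_trans (hc i 0).
exists (\sum_i c i); first by rewrite sumr_ge0.
move=> x v; have [t [_ _ ->]] := mean_value_rV x v (sf [::]).
rewrite (le_trans (ler_norm_sum _ _ _))// mulr_suml ler_sum// => i _.
by rewrite normrM mulrC ler_pM//; exact: rV_norm_coord.
Qed.

(** The mean value theorem expresses the increment by partial derivatives at an intermediate point,
    and these are Lipschitz. The constant is uniform in [x], as differentiation under an integral
    requires. *)
Lemma smooth_bounded_support_taylor f : smooth f -> bounded_support f ->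
  exists2 C, 0 <= C & forall x v,
    `|f (x + v) - f x - \sum_i v ord0 i * partial i f x| <= C * `|v| ^+ 2.
Proof.
move=> sf bf.
have /choice[c hc] : forall i, exists c, 0 <= c /\
    forall x v, `|partial i f (x + v) - partial i f x| <= c * `|v|.
  move=> i; have [|c] := @smooth_bounded_support_lipschitz (partial i f) _
    (bounded_support_partial i bf); last by exists c.
  exact/smooth_partial.
exists (\sum_i c i); first by rewrite sumr_ge0// => i _; have [] := hc i.
move=> x v; have [t [t0 t1 ->]] := mean_value_rV x v (sf [::]).
rewrite -sumrB (le_trans (ler_norm_sum _ _ _))// mulr_suml ler_sum// => i _.
have [ci0 hci] := hc i.
rewrite -mulrBr normrM expr2 mulrCA ler_pM//; first exact: rV_norm_coord.
apply: le_trans (hci _ _) _; rewrite ler_wpM2l// normrZ ger0_norm//.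
by rewrite ler_piMl.
Qed.

End bounded_support.

Section integration_by_parts.
Context {R : realType} {n : nat}.
Implicit Types (f g F : 'rV[R]_n -> R) (x v : 'rV[R]_n) (i : 'I_n).
Local Notation mu := (lebesgue_rV n : {measure set 'rV[R]_n -> \bar R}).

Lemma Rintegral_translation v f : measurable_fun setT f ->
  \int[mu]_x f (x + v) = \int[mu]_x f x.
Proof.
move=> mf; congr fine; apply: (integral_translation v (f := EFin \o f)).
exact/measurable_EFinP.
Qed.

(** Every difference quotient of [F] has integral 0 by translation invariance; dominated convergence
    passes to the derivative. *)
Lemma Rintegral_partial F i : (forall x, differentiable F x) ->
  continuous (partial i F) -> bounded_support F ->
  \int[mu]_x partial i F x = 0.
Proof.
move=> dF cF bF; have cF' : continuous F.
  by move=> x; exact: differentiable_continuous.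
have iF := smooth_bounded_support_integrable cF' bF.
have [C C0 hC] := continuous_bounded_support_bounded cF (bounded_support_partial i bF).
have [M M0 hM] := bounded_support_gt0 bF.
pose e : 'rV[R]_n := delta_mx ord0 i.
have ne : `|e| <= 1.
  by apply: rV_norm_le => // j; rewrite mxE eqxx /=; case: eqP => _; rewrite ?normr1 ?normr0.
pose t (k : nat) : R := k.+1%:R^-1.
have t0 k : 0 < t k by rewrite invr_gt0.
have t1 k : t k <= 1 by rewrite invf_le1// ler1n.
pose u k x := (t k)^-1 * (F (x + t k *: e) - F x).
have iFt k : mu.-integrable setT (EFin \o (fun x => F (x + t k *: e))).
  exact: (integrable_translation (t k *: e) iF).
have Iu k : \int[mu]_x u k x = 0.
  rewrite RintegralZl//; last exact: (@integrableB _ _ _ mu _ measurableT _ _ (iFt k) iF).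
  by rewrite RintegralB// Rintegral_translation ?subrr ?mulr0//; exact: continuous_measurable_rV.
have mu_ k : measurable_fun setT (u k).
  apply: measurable_funM => //; apply: measurable_funB.
    by apply: measurableT_comp (measurable_rV_add _); exact: continuous_measurable_rV.
  exact: continuous_measurable_rV.
have cvgu x : u k x @[k --> \oo] --> partial i F x.
  have h0 : (fun h : R => h^-1 *: ((F \o shift x) (h *: e) - F x)) h @[h --> 0^'] -->
      partial i F x by exact: (diff_derivable (dF x)).
  have tc : t k @[k --> \oo] --> 0^'.
    move=> A /= /cvg_harmonic tA; change (\forall k \near \oo, A (t k)).
    near=> k; have : t k != 0 -> A (t k) by near: k.
    by apply; rewrite gt_eqF.
  have := cvg_comp _ _ tc h0; apply: cvg_trans; apply: near_eq_cvg.
  by apply: nearW => k /=; rewrite /u [x + _]addrC.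
(* Dominating function: the mean value theorem bounds the quotients by [C], and since the steps are
   at most 1 they vanish beyond radius M + 1. *)
pose g x := C * \1_(ball 0 (M + 1)) x.
have ug k x : `|u k x| <= g x.
  rewrite /g indicE; have [xB|xB] := boolP (x \in _); last first.
    have {}xB : M + 1 <= `|x|.
      move: xB; rewrite notin_setE -ball_normE /= sub0r normrN => /negP.
      by rewrite -leNgt.
    rewrite /u !hM ?subr0 ?mulr0 ?normr0//; first by apply: le_trans xB; rewrite lerDl.
    have := ler_normB (x + t k *: e) (t k *: e); rewrite addrK.
    rewrite normrZ gtr0_norm//.
    have : t k * `|e| <= 1 by rewrite mulr_ile1// ltW.
    lra.
  have [c [_ _ E]] := mean_value_rV x (t k *: e) dF.
  rewrite /u E (bigD1 i)//= big1 ?addr0 => [|j ji]; last first.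
    by rewrite !mxE (negbTE ji) /= ?andbF mulr0 mul0r.
  by rewrite !mxE !eqxx mulr1 mulrA mulVf ?gt_eqF// mul1r mulr1.
have [] := @dominated_convergence _ _ _ mu setT measurableT (fun k => EFin \o u k)
  (EFin \o partial i F) (EFin \o g).
- by move=> k; exact/measurable_EFinP.
- by apply/measurable_EFinP; exact: continuous_measurable_rV.
- apply/aeW => x _; apply: cvg_EFin; first exact: nearW.
  exact: cvgu.
- rewrite (_ : EFin \o _ = (fun x => C%:E * (\1_(ball 0 (M + 1)) x)%:E)%E)//.
  apply: integrableZl => //; apply: integrable_indic_rV_ball.
  by rewrite addr_gt0.
- by apply/aeW => x k _; rewrite /= lee_fin; exact: ug.
move=> _ _ /=; rewrite (_ : (fun _ => _) = cst 0%E); last first.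
  apply/funext => k; rewrite -[LHS]fineK.
    by congr EFin; exact: Iu.
  apply: (@integrable_fin_num _ _ _ mu setT) => //.
  rewrite (_ : (fun _ => _) = (fun x => (t k)^-1%:E *
    ((F (x + t k *: e))%:E - (F x)%:E))%E)//.
  apply: integrableZl => //; exact: (@integrableB _ _ _ mu _ measurableT _ _ (iFt k) iF).
move=> h; rewrite /Rintegral; have := cvg_lim (@ereal_hausdorff R) h.
by rewrite lim_cst//= => <-.
Unshelve. all: by end_near. Qed.

Lemma Rintegral_by_parts f g i :
  (forall x, differentiable f x) -> (forall x, differentiable g x) ->
  continuous (partial i f) -> continuous (partial i g) -> bounded_support g ->
  \int[mu]_x (f x * partial i g x) = - \int[mu]_x (partial i f x * g x).
Proof.
move=> df dg cf cg bg.
have cf' : continuous f by move=> x; exact: differentiable_continuous.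
have cg' : continuous g by move=> x; exact: differentiable_continuous.
have bg' := bounded_support_partial i bg.
have i1 : mu.-integrable setT (EFin \o (f * partial i g)).
  apply: smooth_bounded_support_integrable; last exact: bounded_supportMr.
  by move=> x; apply: continuousM; [exact: cf'|exact: cg].
have i2 : mu.-integrable setT (EFin \o (partial i f * g)).
  apply: smooth_bounded_support_integrable; last exact: bounded_supportMr.
  by move=> x; apply: continuousM; [exact: cf|exact: cg'].
apply/eqP; rewrite -addr_eq0 -RintegralD//.
apply/eqP; rewrite -[RHS](@Rintegral_partial (f * g) i).
- by apply: eq_Rintegral => x _; rewrite partialM// !fctE [g x * _]mulrC.
- by move=> x; exact: differentiableM.
- rewrite partialM// => x; apply: continuousD; apply: continuousM.
  + exact: cf'.
  + exact: cg.
  + exact: cg'.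
  + exact: cf.
- exact: bounded_supportMr.
Qed.

End integration_by_parts.

(** * Convolution and mollifiers *)

Lemma continuous_sum (R : realType) (T : topologicalType) (I : Type) (r : seq I)
    (F : I -> T -> R) :
  (forall i, continuous (F i)) -> continuous (fun x => \sum_(i <- r) F i x).
Proof.
move=> cF; apply: (@continuous_big R _ _ _ _ _ T r F) => // z.
exact: add_continuous.
Qed.

(** A quadratic remainder is negligible with respect to the increment, and uniqueness of the
    differential identifies it with [L]. *)
Lemma quadratic_differentiable (R : realType) (V : normedModType R) (f : V -> R)
    (L : {linear V -> R}) (x : V) (C : R) : continuous L -> 0 <= C ->
  (forall v, `|v| <= 1 -> `|f (x + v) - f x - L v| <= C * `|v| ^+ 2) ->
  differentiable f x /\ 'd f x = L :> (V -> R).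
Proof.
move=> cL C0 hf.
have key : f \o shift x = cst (f x) + L +o_ 0 id.
  apply/eqaddoP => e e0; near=> v.
  rewrite /= !fctE /= opprD addrA [v + x]addrC.
  have v1 : `|v| <= 1 by near: v; apply: nbhs0_le.
  apply: le_trans (hf v v1) _.
  rewrite expr2 mulrA ler_wpM2r//.
  have : `|v| <= e / (C + 1) by near: v; apply: nbhs0_le; rewrite divr_gt0// ltr_wpDl.
  rewrite ler_pdivlMr; last by rewrite ltr_wpDl.
  by apply: le_trans; rewrite mulrC ler_wpM2l// lerDl.
have dE := diff_unique cL key.
by split => //; apply/diff_locallyP; rewrite dE; split.
Unshelve. all: by end_near. Qed.

Lemma Rintegral_sum d (T : measurableType d) (R : realType)
    (mu : {measure set T -> \bar R}) (D : set T) (mD : measurable D)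
    (I : Type) (r : seq I) (F : I -> T -> R) :
  (forall i, mu.-integrable D (EFin \o F i)) ->
  mu.-integrable D (EFin \o (fun x => \sum_(i <- r) F i x)) /\
  \int[mu]_(x in D) (\sum_(i <- r) F i x) = \sum_(i <- r) \int[mu]_(x in D) F i x.
Proof.
move=> iF; elim: r => [|i r [ih IH]].
  rewrite (_ : (fun _ => _) = cst 0); last by apply/funext => x; rewrite big_nil.
  split; first exact: (@integrable0 _ _ _ mu).
  by rewrite big_nil [LHS](Rintegral_cst mu mD) mul0r.
rewrite (_ : (fun _ => _) = (fun x => F i x + \sum_(j <- r) F j x)); last first.
  by apply/funext => x; rewrite big_cons.
split; first exact: (@integrableD _ _ _ mu _ mD _ _ (iF i) ih).
by rewrite RintegralD// IH big_cons.
Qed.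

Section convolution.
Context {R : realType} {n : nat}.
Implicit Types (f g k : 'rV[R]_n -> R) (x y v : 'rV[R]_n) (i : 'I_n).
Local Notation mu := (lebesgue_rV n : {measure set 'rV[R]_n -> \bar R}).

(* The kernel is reflected: [k (y - x)] instead of [k (x - y)]. *)
Definition convol k g x : R := \int[mu]_y (g y * k (y - x)).

Variable g : 'rV[R]_n -> R.
Hypothesis mg : measurable_fun setT g.
Variable B : R.
Hypothesis gB : forall x, `|g x| <= B.

Let B0 : 0 <= B. Proof. exact: le_trans (gB 0). Qed.

Lemma convol_integrable k x : continuous k -> bounded_support k ->
  mu.-integrable setT (EFin \o (fun y => g y * k (y - x))).
Proof.
move=> ck bk; apply: bounded_support_integrable.
- apply: measurable_funM => //.
  by apply: measurableT_comp (measurable_rV_add _); exact: continuous_measurable_rV.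
- by apply: bounded_supportMr; exact: bounded_support_shift.
- have [C C0 hC] := continuous_bounded_support_bounded ck bk.
  by exists (B * C) => y; rewrite normrM ler_pM.
Qed.

(** Differentiation under the integral by the uniform Taylor expansion of the kernel; the minus sign
    comes from the reflection in [convol], where [x] enters as y - x. *)
Lemma convol_diff k x : smooth k -> bounded_support k ->
  differentiable (convol k g) x /\
  forall v, 'd (convol k g) x v = - \sum_i v ord0 i * convol (partial i k) g x.
Proof.
move=> sk bk.
have [C C0 hC] := smooth_bounded_support_taylor sk bk.
have [M M0 hM] := bounded_support_gt0 bk.
have ck := smooth_continuous sk.
have cpk i : continuous (partial i k) by exact/smooth_continuous/smooth_partial.
have bpk i : bounded_support (partial i k) by exact: bounded_support_partial.
pose L v := - \sum_i v ord0 i * convol (partial i k) g x.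
have linL : linear L.
  move=> a u v; rewrite /L /GRing.scale /= mulrN -opprD mulr_sumr -big_split/=.
  by congr (- _); apply: eq_bigr => i _; rewrite !mxE mulrDl mulrA.
pose HL := GRing.isLinear.Build _ _ _ _ _ linL.
pose LL : {linear 'rV[R]_n -> R} := HB.pack L HL.
have cL : continuous LL.
  move=> v; rewrite /= /L; apply: continuousN; apply: continuous_sum => i.
  move=> w; apply: cvgM; [exact: nbhs_filter|exact: coord_continuous|apply: cvg_cst; exact: nbhs_filter].
(* The Taylor remainder of [k] at y - x for the increment -v. *)
pose E y v := k (y - (x + v)) - k (y - x) + \sum_i v ord0 i * partial i k (y - x).
have hE y v : `|E y v| <= C * `|v| ^+ 2.
  have := hC (y - x) (- v); rewrite normrN.
  have -> : y - x - v = y - (x + v) by rewrite opprD addrA.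
  have -> : \sum_i (- v) ord0 i * partial i k (y - x) =
      - \sum_i v ord0 i * partial i k (y - x).
    by rewrite -sumrN; apply: eq_bigr => i _; rewrite mxE mulNr.
  by rewrite opprK.
have intE v : mu.-integrable setT (EFin \o (fun y => g y * E y v)) /\
    \int[mu]_y (g y * E y v) = convol k g (x + v) - convol k g x - L v.
  have i1 j : mu.-integrable setT
      (EFin \o (fun y => v ord0 j * (g y * partial j k (y - x)))).
    rewrite (_ : EFin \o _ =
      (fun y => (v ord0 j)%:E * (g y * partial j k (y - x))%:E)%E)//.
    by apply: integrableZl => //; exact: convol_integrable.
  have [i2 I2] := Rintegral_sum (mu := mu) measurableT (index_enum 'I_n) i1.
  have i3 := @integrableB _ _ _ mu _ measurableT _ _
    (convol_integrable (x + v) ck bk) (convol_integrable x ck bk).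
  have e : (fun y => g y * E y v) = (fun y =>
     (g y * k (y - (x + v)) - g y * k (y - x)) +
     \sum_i v ord0 i * (g y * partial i k (y - x))).
    apply/funext => y; rewrite /E mulrDr mulrBr mulr_sumr; congr (_ + _).
    by apply: eq_bigr => i _; rewrite mulrCA.
  rewrite e; split; first exact: (@integrableD _ _ _ mu _ measurableT _ _ i3 i2).
  rewrite RintegralD// RintegralB//; [|exact: convol_integrable|exact: convol_integrable].
  rewrite I2 /L opprK; congr (_ + _); apply: eq_bigr => i _.
  by rewrite RintegralZl//; exact: convol_integrable.
(* For |v| <= 1 the remainder vanishes once |y - x| >= M + 2: both values of [k] are then 0 and so
   are the partial derivatives. *)
pose V := fine (mu (ball x (M + 2))).
have M2 : 0 < M + 2 by rewrite addr_gt0.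
have V0 : 0 <= V by rewrite fine_ge0.
have bound v : `|v| <= 1 -> `|convol k g (x + v) - convol k g x - L v| <= B * C * V * `|v| ^+ 2.
  move=> v1; have [iE <-] := intE v.
  apply: le_trans (le_normr_Rintegral _ iE) _ => //.
  have iball : mu.-integrable setT
      (EFin \o (fun y => B * C * `|v| ^+ 2 * \1_(ball x (M + 2)) y)).
    rewrite (_ : EFin \o _ = (fun y => (B * C * `|v| ^+ 2)%:E *
      (\1_(ball x (M + 2)) y)%:E)%E)//.
    by apply: integrableZl => //; exact: integrable_indic_rV_ball.
  apply: (@le_trans _ _ (\int[mu]_y (B * C * `|v| ^+ 2 * \1_(ball x (M + 2)) y))).
    apply: le_Rintegral => //.
      exact: (integrable_abse iE).
    move=> y _; rewrite indicE; have [yB|yB] := boolP (y \in _).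
      by rewrite normrM mulr1 -mulrA ler_pM.
    rewrite mulr0 (_ : E y v = 0) ?mulr0 ?normr0//.
    have {}yB : M + 2 <= `|y - x|.
      by move: yB; rewrite notin_setE -ball_normE /= distrC => /negP; rewrite -leNgt.
    rewrite /E !hM; last 2 first.
    - by lra.
    - have := ler_normB (y - x) v; have := ler_normD (y - (x + v)) v.
      by rewrite opprD addrA addrNK; lra.
    rewrite subrr add0r big1// => i _; rewrite /partial.
    rewrite (near_eq_derive _ (g := cst 0)) ?derive_cst ?mulr0//.
    near=> z; apply: hM.
    have : `|y - x - z| < 1.
      by near: z; apply/nbhs_ballP; exists 1 => //= z; rewrite -ball_normE.
    by have := ler_distD z (y - x) 0; rewrite !subr0; lra.
  rewrite RintegralZl//; last exact: integrable_indic_rV_ball.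
  rewrite mulrAC ler_wpM2r// ?sqr_ge0// ler_wpM2l// ?mulr_ge0//.
  by rewrite /Rintegral integral_indic ?setIT//; exact: measurable_rV_ball.
have BCV0 : 0 <= B * C * V by rewrite !mulr_ge0.
have [dE dL] := quadratic_differentiable cL BCV0 bound.
by split => // v; rewrite dL.
Unshelve. all: by end_near. Qed.

Lemma partial_convol k i : smooth k -> bounded_support k ->
  partial i (convol k g) = - convol (partial i k) g.
Proof.
move=> sk bk; apply/funext => x; have [dk E] := convol_diff x sk bk.
rewrite /partial deriveE// E (bigD1 i)//= big1 ?addr0.
  by rewrite mxE !eqxx mul1r.
by move=> j ji; rewrite mxE (negbTE ji) andbF mul0r.
Qed.

Lemma convolN k : smooth k -> bounded_support k -> convol (- k) g = - convol k g.
Proof.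
move=> sk bk; apply/funext => x; rewrite /convol !fctE.
rewrite -mulN1r -RintegralZl//; last first.
  by apply: convol_integrable => //; exact: smooth_continuous.
by apply: eq_Rintegral => y _; rewrite mulrN mulN1r.
Qed.

Lemma smooth_convol k : smooth k -> bounded_support k -> smooth (convol k g).
Proof.
move=> sk bk; apply: (@smooth_stable _ _
  [set f | exists k, [/\ smooth k, bounded_support k & f = convol k g]]).
- by move=> _ [l [sl bl ->]] x; have [] := convol_diff x sl bl.
- move=> _ i [l [sl bl ->]]; exists (- partial i l).
  have spl := smooth_partial i sl; have bpl := bounded_support_partial i bl.
  split; last by rewrite partial_convol// convolN.
    rewrite (_ : - _ = cst (-1) * partial i l); first exact/smoothM/spl/smooth_cst.
    by apply/funext => x; rewrite !fctE mulN1r.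
  by move: bpl => [M hM]; exists M => x /hM; rewrite !fctE => ->; rewrite oppr0.
- by exists k.
Qed.

End convolution.

Section mollifier.
Context {R : realType} {n : nat}.
Implicit Types (x y v : 'rV[R]_n) (i : 'I_n).
Local Notation mu := (lebesgue_rV n : {measure set 'rV[R]_n -> \bar R}).

(** The left-hand side is the integral of the constant [c] over the cube [ball x e]. *)
Lemma Rintegral_gt0 (f : 'rV[R]_n -> R) (c e : R) x : measurable_fun setT f ->
  (forall y, 0 <= f y) -> mu.-integrable setT (EFin \o f) ->
  0 < c -> 0 < e -> (forall y, ball x e y -> c <= f y) ->
  c * (e *+ 2) ^+ n <= \int[mu]_y f y.
Proof.
move=> mf f0 iF c0 e0 hc.
have iball : mu.-integrable setT (EFin \o (fun y => c * \1_(ball x e) y)).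
  rewrite (_ : EFin \o _ = (fun y => c%:E * (\1_(ball x e) y)%:E)%E)//.
  by apply: integrableZl => //; exact: integrable_indic_rV_ball.
apply: (@le_trans _ _ (\int[mu]_y (c * \1_(ball x e) y))).
  rewrite RintegralZl//; last exact: integrable_indic_rV_ball.
  rewrite /Rintegral integral_indic ?setIT//; last exact: measurable_rV_ball.
  suff -> : mu (ball x e) = ((e *+ 2) ^+ n)%:E by [].
  exact: lebesgue_rV_ball.
apply: le_Rintegral => // y _; rewrite indicE.
have [/set_mem yB|_] := boolP (y \in _); first by rewrite mulr1 hc.
by rewrite mulr0.
Qed.

(** The squared Euclidean norm is a polynomial, which gives smoothness at once; the support lies in
    the Euclidean ball of radius [e], hence in the sup-norm one. *)
Definition bump (e : R) x : R := flat 1 (e ^+ 2 - dotv x x).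

Lemma smooth_bump e : smooth (bump e).
Proof.
pose q := cst (e ^+ 2) + cst (-1) *
  \sum_i ((fun x : 'rV[R]_n => x ord0 i) * (fun x => x ord0 i)) : 'rV[R]_n -> R.
rewrite (_ : bump e = flat 1 \o q).
  apply: smooth_flat; apply: smoothD; first exact: smooth_cst.
  apply: smoothM; first exact: smooth_cst.
  by apply: smooth_sum => i; apply: smoothM; exact: smooth_coord.
by apply/funext => x; rewrite /bump /q /dotv /= !fctE fct_sumE mulN1r.
Qed.

Lemma bump_ge0 e x : 0 <= bump e x. Proof. exact: flat1_ge0. Qed.

Lemma bump_support e x : 0 < e -> e <= `|x| -> bump e x = 0.
Proof.
move=> e0 ex; rewrite /bump flat_le0// subr_le0 leNgt; apply/negP => xe.
have : `|x| < e; last by rewrite ltNge ex.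
have [->|/mx_norm_neq0 [[i j]]] := eqVneq `|x| 0; first by [].
rewrite ord1 /= -[mx_norm _]/(`|x|) => ->.
rewrite -(@ltr_pXn2r _ 2)// ?nnegrE ?(ltW e0)//; apply: le_lt_trans xe.
rewrite real_normK ?num_real// /dotv (bigD1 j)//= -expr2 lerDl sumr_ge0// => k _.
by rewrite -expr2 sqr_ge0.
Qed.

Lemma bump_bounded_support e : 0 < e -> bounded_support (bump e).
Proof. by move=> e0; exists e => x; exact: bump_support. Qed.

Lemma bump_integral_gt0 e : 0 < e -> 0 < \int[mu]_x bump e x.
Proof.
move=> e0; have c0 : 0 < bump e 0.
  rewrite flat1_gt0// /dotv big1 ?subr0 ?exprn_gt0// => i _.
  by rewrite mxE mul0r.
have cb : continuous (bump e) by exact/smooth_continuous/smooth_bump.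
have /cvgr_gt/(_ (bump e 0 / 2)) := cb 0.
rewrite gtr_pMr// invf_lt1// ltr1n => /(_ isT) /nbhs_ballP[r /= r0 hr].
apply: (@lt_le_trans _ _ (bump e 0 / 2 * (r *+ 2) ^+ n)).
  by rewrite mulr_gt0 ?divr_gt0// exprn_gt0// mulrn_wgt0.
apply: (@Rintegral_gt0 (bump e) (bump e 0 / 2) r 0) => //.
- exact: continuous_measurable_rV.
- by move=> y; exact: bump_ge0.
- by apply: smooth_bounded_support_integrable => //; exact: bump_bounded_support.
- by rewrite divr_gt0.
- by move=> y yB; apply/ltW/hr.
Qed.

Definition mollifier (e : R) x : R := (\int[mu]_y bump e y)^-1 * bump e x.

Variables (e : R) (e0 : 0 < e).

Lemma smooth_mollifier : smooth (mollifier e).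
Proof. exact: (smoothM (smooth_cst _) (smooth_bump e)). Qed.

Lemma continuous_mollifier : continuous (mollifier e).
Proof. exact: smooth_continuous smooth_mollifier. Qed.

Lemma measurable_mollifier : measurable_fun setT (mollifier e).
Proof. exact: continuous_measurable_rV continuous_mollifier. Qed.

Lemma mollifier_ge0 x : 0 <= mollifier e x.
Proof. by rewrite mulr_ge0 ?bump_ge0// invr_ge0 ltW// bump_integral_gt0. Qed.

Lemma mollifier_support x : e <= `|x| -> mollifier e x = 0.
Proof. by move=> ex; rewrite /mollifier bump_support// mulr0. Qed.

Lemma mollifier_bounded_support : bounded_support (mollifier e).
Proof. by exists e => x; exact: mollifier_support. Qed.

Lemma mollifier_integrable : mu.-integrable setT (EFin \o mollifier e).
Proof.
apply: smooth_bounded_support_integrable mollifier_bounded_support.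
exact: continuous_mollifier.
Qed.

Lemma integral_mollifier : \int[mu]_x mollifier e x = 1.
Proof.
rewrite RintegralZl//; first by rewrite mulVf// gt_eqF// bump_integral_gt0.
apply: smooth_bounded_support_integrable; last exact: bump_bounded_support.
exact/smooth_continuous/smooth_bump.
Qed.

End mollifier.

(** * Continuity of translations in L^p *)

Section powR_facts.
Context {R : realType}.

(** The sum is at most twice the larger of the two absolute values. This crude constant serves every
    nonnegative exponent without convexity. *)
Lemma powR_normD (p a b : R) : 0 <= p ->
  `|a + b| `^ p <= 2 `^ p * (`|a| `^ p + `|b| `^ p).
Proof.
move=> p0; wlog ab : a b / `|a| <= `|b|.
  move=> H; have [/H//|/ltW/H] := leP `|a| `|b|.
  by rewrite [b + a]addrC [X in _ * X]addrC.
apply: (@le_trans _ _ ((2 * `|b|) `^ p)).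
  by apply: ge0_ler_powR; rewrite ?nnegrE ?mulr_ge0//; have := ler_normD a b; lra.
by rewrite powRM// ler_wpM2l ?powR_ge0// lerDr powR_ge0.
Qed.

End powR_facts.

Section translation_continuity.
Context {R : realType} {n : nat} (p : R) (p0 : 0 < p).
Implicit Types (f g : 'rV[R]_n -> R) (x y v : 'rV[R]_n) (A U : set 'rV[R]_n).
Local Notation mu := (lebesgue_rV n : {measure set 'rV[R]_n -> \bar R}).

(** The p-th power of the L^p norm. Leaving out the root, [pmeanD] stands in for the triangle
    inequality. *)
Definition pmean f : \bar R := (\int[mu]_x (`|f x| `^ p)%:E)%E.

Lemma measurable_powR_norm f : measurable_fun setT f ->
  measurable_fun setT (fun x => (`|f x| `^ p)%:E).
Proof.
move=> mf; apply/measurable_EFinP.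
apply: (measurableT_comp (measurable_powR p)).
exact: (measurableT_comp (@normr_measurable R setT)).
Qed.

Lemma pmean_ge0 f : (0 <= pmean f)%E.
Proof. by apply: integral_ge0 => x _; rewrite lee_fin powR_ge0. Qed.

Lemma pmeanD f g : measurable_fun setT f -> measurable_fun setT g ->
  (pmean (f \+ g)%R <= (2 `^ p)%:E * (pmean f + pmean g))%E.
Proof.
move=> mf mg; rewrite /pmean.
have m1 := measurable_powR_norm mf; have m2 := measurable_powR_norm mg.
have m3 := measurable_powR_norm (measurable_funD mf mg).
rewrite -ge0_integralD// -ge0_integralZl//; last 2 first.
- exact: emeasurable_funD.
- by move=> x _; rewrite adde_ge0.
apply: ge0_le_integral => //.
- by apply: measurable_funeM; exact: emeasurable_funD.
- by move=> x _; rewrite -EFinD -EFinM lee_fin powR_normD// ltW.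
Qed.

Lemma pmeanZ (c : R) f : measurable_fun setT f ->
  pmean (fun x => c * f x) = ((`|c| `^ p)%:E * pmean f)%E.
Proof.
move=> mf; have m1 := measurable_powR_norm mf; rewrite /pmean -ge0_integralZl//.
by apply: eq_integral => x _; rewrite normrM powRM// EFinM.
Qed.

Lemma pmean_translation v f : measurable_fun setT f ->
  pmean (fun x => f (x + v)) = pmean f.
Proof.
move=> mf; apply: (ge0_integral_translation v (f := fun x => (`|f x| `^ p)%:E)).
  exact: measurable_powR_norm.
by move=> x; rewrite lee_fin powR_ge0.
Qed.

Definition translation_continuous f := measurable_fun setT f /\
  forall e : R, 0 < e -> exists2 d, 0 < d & forall v, `|v| < d ->
    (pmean (fun x => f (x + v)%R - f x)%R <= e%:E)%E.

Lemma measurable_translation v f : measurable_fun setT f ->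
  measurable_fun setT (fun x => f (x + v)).
Proof. by move=> mf; exact: measurableT_comp (measurable_rV_add v). Qed.

Lemma translation_continuous_closed f : measurable_fun setT f ->
  (forall e : R, 0 < e ->
    exists2 g, translation_continuous g & (pmean (f \- g)%R <= e%:E)%E) ->
  translation_continuous f.
Proof.
move=> mf H; split => // e e0.
pose c : R := 2 `^ p; have c0 : 0 < c by exact: powR_gt0.
(* Solution of c (d + c (d + d)) = e, the outcome of applying [pmeanD] twice to a sum of three terms
   of mean at most [d]. *)
pose d : R := e / (c * (1 + c * 2)).
have d0 : 0 < d by rewrite divr_gt0// mulr_gt0// addr_gt0// mulr_gt0.
have [g [mg tg] fg] := H d d0.
have [r r0 hr] := tg d d0; exists r => // v vr.
have mfg : measurable_fun setT (f \- g) by exact: measurable_funB.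
have mgf : measurable_fun setT (g \- f) by exact: measurable_funB.
pose F1 x := (f \- g) (x + v); pose F2 x := g (x + v) - g x.
have m1 : measurable_fun setT F1 by exact: measurable_translation.
have m2 : measurable_fun setT F2.
  by apply: measurable_funB => //; exact: measurable_translation.
rewrite (_ : (fun x => f (x + v) - f x) = F1 \+ (F2 \+ (g \- f))); last first.
  by apply/funext => x; rewrite /F1 /F2 /=; ring.
have h1 : (pmean F1 <= d%:E)%E by rewrite pmean_translation.
have h3 : (pmean (g \- f)%R <= d%:E)%E.
  apply: le_trans fg; rewrite le_eqVlt; apply/orP; left; apply/eqP.
  by apply: eq_integral => x _; rewrite distrC.
apply: le_trans (pmeanD m1 (measurable_funD m2 mgf)) _.
have h23 : (pmean (F2 \+ (g \- f))%R <= (c * (d + d))%:E)%E.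
  apply: le_trans (pmeanD m2 mgf) _; rewrite EFinM lee_wpmul2l ?lee_fin ?(ltW c0)//.
  by rewrite EFinD; apply: leeD; [exact: (hr v vr)|exact: h3].
apply: (@le_trans _ _ (c%:E * (d%:E + (c * (d + d))%:E))%E).
  by apply: lee_wpmul2l; [rewrite lee_fin ltW|apply: leeD; [exact: h1|exact: h23]].
rewrite -EFinD -EFinM lee_fin /d.
suff -> : c * (d + c * (d + d)) = e by [].
rewrite /d; field; rewrite gt_eqF ?gt_eqF// addr_gt0// mulr_gt0//.
Qed.

Lemma translation_continuousD f g : translation_continuous f ->
  translation_continuous g -> translation_continuous (f \+ g).
Proof.
move=> [mf tf] [mg tg]; split; first exact: measurable_funD.
move=> e e0; pose c : R := 2 `^ p; have c0 : 0 < c by exact: powR_gt0.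
have e'0 : 0 < e / (2 * c) by rewrite divr_gt0// mulr_gt0.
have [r r0 hr] := tf _ e'0; have [s s0 hs] := tg _ e'0.
exists (Num.min r s); first by rewrite lt_min r0.
move=> v; rewrite lt_min => /andP[vr vs].
rewrite (_ : (fun x => _) =
  (fun x => f (x + v) - f x) \+ (fun x => g (x + v) - g x)); last first.
  by apply/funext => x /=; ring.
apply: le_trans (pmeanD _ _) _.
- by apply: measurable_funB => //; exact: measurable_translation.
- by apply: measurable_funB => //; exact: measurable_translation.
apply: (@le_trans _ _ (c%:E * ((e / (2 * c))%:E + (e / (2 * c))%:E))%E).
  by rewrite lee_wpmul2l ?lee_fin ?(ltW c0)// leeD ?hr ?hs.
rewrite -EFinD -EFinM lee_fin.
suff -> : c * (e / (2 * c) + e / (2 * c)) = e by [].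
by field; rewrite gt_eqF.
Qed.

Lemma translation_continuousZ (c : R) f : translation_continuous f ->
  translation_continuous (fun x => c * f x).
Proof.
move=> [mf tf]; split; first exact: measurable_funM.
move=> e e0; pose k := `|c| `^ p; have k0 : 0 <= k := powR_ge0 _ _.
have e'0 : 0 < e / (k + 1) by rewrite divr_gt0// ltr_wpDl.
have [r r0 hr] := tf _ e'0; exists r => // v vr.
under eq_fun do rewrite -mulrBr.
rewrite pmeanZ; last by apply: measurable_funB => //; exact: measurable_translation.
apply: le_trans (lee_wpmul2l _ (hr v vr)) _; first by rewrite lee_fin.
by rewrite -EFinM lee_fin mulrCA ler_piMr ?(ltW e0)// ler_pdivrMr ?ltr_wpDl// mul1r lerDl.
Qed.

Lemma translation_continuous_sum (I : Type) (r : seq I) (F : I -> 'rV[R]_n -> R) :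
  (forall i, translation_continuous (F i)) ->
  translation_continuous (fun x => \sum_(i <- r) F i x).
Proof.
move=> tF; elim: r => [|i r ih].
  rewrite (_ : (fun _ => _) = cst 0); last by apply/funext => x; rewrite big_nil.
  split => // e e0; exists 1 => // v _.
  rewrite /pmean integral0_eq ?lee_fin ?(ltW e0)// => x _ /=.
  by rewrite subrr normr0 powR0// gt_eqF.
rewrite (_ : (fun _ => _) = F i \+ (fun x => \sum_(j <- r) F j x)); last first.
  by apply/funext => x; rewrite big_cons.
exact: (translation_continuousD (tF i) ih).
Qed.

End translation_continuity.

Section translation_continuous_indic.
Context {R : realType} {n : nat} (p : R) (p0 : 0 < p).
Implicit Types (f g : 'rV[R]_n -> R) (x y v : 'rV[R]_n) (A U : set 'rV[R]_n).
Local Notation mu := (lebesgue_rV n : {measure set 'rV[R]_n -> \bar R}).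
Local Notation translation_continuous := (translation_continuous p).
Local Notation pmean := (pmean p).

Lemma integrable_indic_fin A : measurable A -> (mu A < +oo)%E ->
  mu.-integrable setT (EFin \o \1_A).
Proof.
move=> mA Afin; apply/integrableP; split.
  by apply/measurable_EFinP; exact: measurable_indic.
under eq_integral do rewrite gee0_abs ?lee_fin//.
by rewrite integral_indic// setIT.
Qed.

Lemma pmean_indic A : measurable A -> pmean \1_A = mu A.
Proof.
move=> mA; rewrite -[A in RHS]setIT -integral_indic// /pmean.
apply: eq_integral => x _; rewrite indicE; case: (_ \in _).
  by rewrite normr1 powR1.
by rewrite normr0 powR0// gt_eqF.
Qed.

(** The absolute value of 1_U(x + v) - 1_U(x) is this difference, whose integral is 0, plus twice
    the positive part [h] of its opposite. That part is dominated by 1_U and tends to 0 pointwise: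
    for x in [U], x + v is eventually in the open set [U]. *)
Lemma translation_continuous_open U : open U -> (mu U < +oo)%E ->
  translation_continuous \1_U.
Proof.
move=> oU Ufin; have mU := open_measurable_rV oU.
have mf : measurable_fun setT (\1_U : 'rV[R]_n -> R) by exact: measurable_indic.
split => // e e0.
have iU := integrable_indic_fin mU Ufin.
have iUv v : mu.-integrable setT (EFin \o (fun x => \1_U (x + v) : R)).
  exact: (integrable_translation v iU).
pose h v x : R := Num.max 0 (\1_U x - \1_U (x + v)).
have mh v : measurable_fun setT (h v).
  apply: measurable_maxr => //; apply: measurable_funB => //.
  exact: measurable_translation.
have h0 v x : 0 <= h v x by rewrite le_max lexx.
have hU v x : h v x <= \1_U x.
  by rewrite ge_max gerBl !indicE !ler0n.
have ih v : mu.-integrable setT (EFin \o h v).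
  apply: le_integrable iU => //; first exact/measurable_EFinP.
  by move=> x _; rewrite /= lee_fin !ger0_norm ?indicE.
have normE v x : `|\1_U (x + v) - \1_U x| = (\1_U (x + v) - \1_U x) + 2 * h v x.
  rewrite /h; have [le|lt] := leP (\1_U x - \1_U (x + v) : R) 0.
    by rewrite mulr0 addr0 ger0_norm//; lra.
  by rewrite ler0_norm; lra.
have E v : pmean (fun x => \1_U (x + v) - \1_U x) = (2 * \int[mu]_x h v x)%:E.
  transitivity (\int[mu]_x (`|\1_U (x + v) - \1_U x|)%:E)%E.
    apply: eq_integral => x _; rewrite !indicE.
    do 2 case: (_ \in _); rewrite ?subrr ?subr0 ?sub0r ?normrN ?normr1 ?normr0 ?powR1//.
      by rewrite powR0// gt_eqF.
    by rewrite powR0// gt_eqF.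
  have i2h : mu.-integrable setT (EFin \o (fun x => 2 * h v x)).
    rewrite (_ : EFin \o _ = (fun x => 2%:E * (h v x)%:E)%E)//.
    by apply: integrableZl => //; exact: ih.
  have iB := @integrableB _ _ _ mu _ measurableT _ _ (iUv v) iU.
  rewrite -[LHS]fineK; last first.
    apply: (@integrable_fin_num _ _ _ mu setT) => //.
    rewrite (_ : (fun _ => _) = EFin \o (fun x => (\1_U (x + v) - \1_U x) + 2 * h v x)).
      exact: (@integrableD _ _ _ mu _ measurableT _ _ iB i2h).
    by apply/funext => x /=; rewrite normE.
  congr EFin; transitivity (\int[mu]_x ((\1_U (x + v) - \1_U x) + 2 * h v x)).
    by apply: eq_Rintegral => x _; exact: normE.
  rewrite RintegralD// RintegralB// RintegralZl//.
  by rewrite (Rintegral_translation v mf) subrr add0r.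
(* Failure would produce a sequence of translations tending to 0 with means above [e], to which
   sequential dominated convergence applies. *)
have [//|H] := pselect (exists2 d, 0 < d & forall v, `|v| < d ->
    (pmean (fun x => \1_U (x + v)%R - \1_U x)%R <= e%:E)%E).
have /choice[w hw] : forall k : nat, exists v, `|v| < k.+1%:R^-1 /\ e < 2 * \int[mu]_x h v x.
  move=> k; apply: contrapT => nk; apply: H; exists k.+1%:R^-1 => // v vk.
  rewrite E lee_fin leNgt; apply/negP => le; apply: nk.
  by exists v.
have w0 : w k @[k --> \oo] --> (0 : 'rV[R]_n).
  apply/cvgr0Pnorm_lt => d d0; near=> k; apply: lt_trans (hw k).1 _.
  by near: k; exact: (near_infty_natSinv_lt (PosNum d0)).
have [|||||_ _ /=] := @dominated_convergence _ _ _ mu setT measurableT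
    (fun k => EFin \o h (w k)) (cst 0%E) (EFin \o \1_U).
- by move=> k; exact/measurable_EFinP.
- by [].
- apply/aeW => x _; apply: cvg_near_cst.
  have [xU|xU] := pselect (U x); last first.
    by near=> k; rewrite /= /h indicE memNset//= sub0r max_l// oppr_le0.
  have : \forall k \near \oo, U (x + w k).
    have : x + w k @[k --> \oo] --> x + 0 by apply: cvgD => //; exact: cvg_cst.
    by rewrite addr0; apply; exact: open_nbhs_nbhs.
  apply: filterS => k xwU; rewrite /= /h !indicE !mem_set//= subrr.
  by rewrite max_l.
- exact: iU.
- apply/aeW => x k _; rewrite /= lee_fin ger0_norm//.
rewrite integral0 => /fine_cvgP[_].
move=> /cvgr0Pnorm_lt/(_ (e / 2)); rewrite divr_gt0// => /(_ isT)[N _ /(_ N)].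
rewrite /= leqnn => /(_ isT); rewrite -[fine _]/(\int[mu]_x h (w N) x).
have := (hw N).2; rewrite ger0_norm ?Rintegral_ge0//.
by move=> /= a; rewrite ltr_pdivlMr// mulrC => /(lt_trans a); rewrite ltxx.
Unshelve. all: by end_near. Qed.

End translation_continuous_indic.

Import HBNNSimple.

Section translation_continuous_Lp.
Context {R : realType} {n : nat} (p : R) (p0 : 0 < p).
Implicit Types (f g : 'rV[R]_n -> R) (x y v : 'rV[R]_n) (A U : set 'rV[R]_n).
Local Notation mu := (lebesgue_rV n : {measure set 'rV[R]_n -> \bar R}).
Local Notation translation_continuous := (translation_continuous p).
Local Notation pmean := (pmean p).

(** From open sets to all measurable sets by [rV_open_induction]; intersecting with a fixed ball
    keeps every measure finite, complements included. *)
Lemma translation_continuous_indic A (M : R) : 0 < M -> measurable A ->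
  translation_continuous \1_(A `&` ball 0 M).
Proof.
move=> M0; pose Q : set 'rV[R]_n := ball 0 M.
have mQ : measurable Q by exact: measurable_rV_ball.
have Qfin : (mu Q < +oo)%E.
  by suff -> : mu Q = ((M *+ 2) ^+ n)%:E; [exact: ltry|exact: lebesgue_rV_ball].
move: A; apply: rV_open_induction.
- move=> U oU; apply: (translation_continuous_open p0).
    by apply: openI => //; exact: ball_open.
  apply: le_lt_trans Qfin; apply: le_measure; rewrite ?inE//; apply: measurableI => //.
  exact: open_measurable_rV.
- move=> A mA tA.
  rewrite (_ : \1__ = \1_Q \+ (fun x => -1 * \1_(A `&` Q) x)).
    apply: (translation_continuousD p0); last exact: translation_continuousZ.
    by apply: (translation_continuous_open p0) => //; exact: ball_open.
  apply/funext => x /=; rewrite mulN1r !indicE !in_setI in_setC.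
  by case: (x \in A); case: (x \in Q) => /=; rewrite ?subr0 ?subrr.
- move=> F mF tF tcF.
  have mUF : measurable (\bigcup_k F k) by exact: bigcup_measurable.
  have mE m : measurable ((\bigcup_(k in [set k | (m <= k)%N]) F k) `&` Q).
    by apply: measurableI => //; exact: bigcup_measurable.
  (* The tail of the disjoint union is what a partial sum of indicators misses. The tails decrease
     to the empty set inside [Q], so their measures tend to 0. *)
  pose E m := (\bigcup_(k in [set k | (m <= k)%N]) F k) `&` Q.
  apply: (translation_continuous_closed p0).
    by apply: measurable_indic; exact: measurableI.
  move=> e e0.
  have : mu (E m) @[m --> \oo] --> 0%E.
    rewrite -(measure0 mu).
    have capE : \bigcap_m E m = set0.
      apply/seteqP; split => // x Ex; have [[k _ Fkx] Qx] := Ex 0%N Logic.I.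
      have [[j /= kj Fjx] _] := Ex k.+1 Logic.I.
      move/trivIsetP : tF => /(_ k j Logic.I Logic.I).
      rewrite ltn_eqF// => /(_ isT) kj0.
      by have : (F k `&` F j) x by []; rewrite kj0.
    rewrite -capE; apply: nonincreasing_cvg_mu => //.
    + apply: le_lt_trans Qfin; apply: le_measure; last by move=> x [].
        by rewrite inE; exact: mE.
      by rewrite inE.
    + by rewrite capE.
    + move=> m k mk; apply/subsetPset => x [[j /= kj Fjx] Qx]; split => //.
      by exists j => //=; exact: leq_trans kj.
  move=> /fine_cvgP[Efin] /cvgr0Pnorm_lt/(_ _ e0) EN.
  have [m [Emfin Ee]] : exists m, mu (E m) \is a fin_num /\ `|fine (mu (E m))| < e.
    have [N _ HN] := filterI Efin EN; exists N; exact: (HN N (leqnn N)).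
  exists (fun x => \sum_(k < m) \1_(F k `&` Q) x).
    by apply: (translation_continuous_sum p0) => k; exact: tcF.
  rewrite (_ : (_ \- _) = \1_(E m)).
    rewrite (pmean_indic p0); last exact: mE.
    suff : (mu (E m) <= e%:E)%E by [].
    rewrite -(fineK Emfin) lee_fin.
    by rewrite (le_trans (ler_norm _))// ltW.
  apply/funext => x /=.
  have [Qx|Qx] := pselect (Q x); last first.
    rewrite !indicE memNset; last by case.
    rewrite memNset; last by case.
    by rewrite big1 ?subrr// => k _; rewrite indicE memNset// => -[].
  have [[k _ Fkx]|nF] := pselect ((\bigcup_k F k) x); last first.
    rewrite !indicE memNset; last by case.
    rewrite memNset; last by move=> [[k _ Fkx] _]; apply: nF; exists k.
    rewrite big1 ?subrr// => k _; rewrite indicE memNset// => -[Fkx _].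
    by apply: nF; exists k.
  have Fj j : F j x -> j = k.
    move=> Fjx; apply/eqP; apply: contrapT => /negP jk.
    move/trivIsetP : tF => /(_ j k Logic.I Logic.I jk) jk0.
    by have : (F j `&` F k) x by []; rewrite jk0.
  rewrite indicE mem_set//=; last by split => //; exists k.
  have [km|mk] := ltnP k m.
    rewrite (bigD1 (Ordinal km))//= big1 ?addr0; last first.
      move=> j jk; rewrite indicE memNset// => -[/Fj jk' _].
      by move: jk => /eqP; apply; exact/val_inj.
    rewrite !indicE mem_set//= subrr memNset// => -[[j /= mj /Fj jk] _].
    by move: km; rewrite ltnNge -jk mj.
  rewrite big1 ?subr0; last first.
    move=> j _; rewrite indicE memNset// => -[/Fj jk' _].
    by have := ltn_ord j; rewrite jk' ltnNge mk.
  by rewrite indicE mem_set//; split => //; exists k.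
Qed.

(** Simple functions increasing to [f] approximate it in p-mean, by domination by |f|^p, and they
    are finite combinations of indicators. *)
Lemma translation_continuous_ge0 f (M : R) : 0 < M -> measurable_fun setT f ->
  (forall x, 0 <= f x) -> (forall x, M <= `|x| -> f x = 0) ->
  (pmean f < +oo)%E -> translation_continuous f.
Proof.
move=> M0 mf f0 fM fp.
have mf' : measurable_fun setT (EFin \o f) by exact/measurable_EFinP.
pose s := nnsfun_approx measurableT mf'.
have cs x : s k x @[k --> \oo] --> f x.
  have := @cvg_nnsfun_approx _ _ _ _ measurableT _ mf' (fun x _ => f0 x) x Logic.I.
  by move=> /fine_cvgP[_].
have sf k x : s k x <= f x.
  have nd : nondecreasing_seq (fun k => s k x).
    by move=> a b ab; have /lefP := nd_nnsfun_approx measurableT mf' ab; exact.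
  have <- := cvg_lim (@Rhausdorff R) (cs x).
  by apply: nondecreasing_cvgn_le => //; apply/cvg_ex; exists (f x).
have ts k : translation_continuous (s k).
  have [N [r hr]] : exists N (r : 'I_N -> R), forall x,
      s k x = \sum_i r i * \1_(s k @^-1` [set r i]) x.
    by do 2 eexists; exact: fimfunEord.
  (* Cutting the level sets to the ball changes nothing, since outside it 0 <= s k <= f = 0. *)
  rewrite (_ : (s k : _ -> _) = fun x => \sum_i r i * \1_((s k @^-1` [set r i]) `&` ball 0 M) x).
    apply: (translation_continuous_sum p0) => i; apply: translation_continuousZ.
    by apply: translation_continuous_indic => //; exact: measurable_sfunP.
  apply/funext => x; rewrite hr; apply: eq_bigr => i _ /=.
  rewrite !indicE in_setI; have [xQ|xQ] := boolP (x \in (ball 0 M : set 'rV[R]_n)).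
    by rewrite andbT.
  rewrite andbF; have [/set_mem /= si|_] := boolP (_ \in _); last by [].
  have : f x = 0.
    apply: fM; move: xQ; rewrite notin_setE -ball_normE /= sub0r normrN => /negP.
    by rewrite -leNgt.
  move=> fx0; have : r i <= 0 by rewrite -si -fx0 sf.
  by rewrite le_eqVlt => /orP[/eqP ->|]; [rewrite !mul0r|rewrite ltNge -si fun_ge0].
have ip : mu.-integrable setT (fun x => (`|f x| `^ p)%:E).
  apply/integrableP; split; first exact: measurable_powR_norm.
  by under eq_integral do rewrite gee0_abs ?lee_fin ?powR_ge0//.
have ms k : measurable_fun setT (f \- s k) by apply: measurable_funB.
have [|||||_ _ /=] := @dominated_convergence _ _ _ mu setT measurableT
    (fun k x => (`|f x - s k x| `^ p)%:E) (cst 0%E) (fun x => (`|f x| `^ p)%:E).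
- by move=> k; exact: (measurable_powR_norm _ (ms k)).
- by [].
- apply/aeW => x _; apply: cvg_EFin; first exact: nearW.
  apply/cvgr0Pnorm_le => e e0.
  have : f x - s k x @[k --> \oo] --> 0.
    by rewrite -(subrr (f x)); apply: cvgB => //; exact: cvg_cst.
  move=> /cvgr0Pnorm_le/(_ (e `^ p^-1)); rewrite powR_gt0// => /(_ isT).
  apply: filterS => k h /=; rewrite ger0_norm ?powR_ge0//.
  rewrite -[leRHS](powRr1 (ltW e0)) -(mulVf (lt0r_neq0 p0)) powRrM.
  by apply: ge0_ler_powR; rewrite ?nnegrE ?powR_ge0// ltW.
- exact: ip.
- apply/aeW => x k _; rewrite gee0_abs ?lee_fin ?powR_ge0//.
  apply: ge0_ler_powR; rewrite ?nnegrE ?(ltW p0)//.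
  rewrite !ger0_norm ?subr_ge0//; by rewrite gerBl fun_ge0.
rewrite integral0 => /fine_cvgP[pfin /cvgr0Pnorm_lt pe].
apply: (translation_continuous_closed p0) => // e e0.
have [N _ HN] := filterI pfin (pe e e0); exists (s N) => //.
have [h1 h2] := HN N (leqnn N).
rewrite /(pmean _) -(fineK h1) lee_fin.
by rewrite (le_trans (ler_norm _))// ltW.
Unshelve. all: by end_near. Qed.

Lemma translation_continuous_Lp f (M : R) : 0 < M -> measurable_fun setT f ->
  (forall x, M <= `|x| -> f x = 0) ->
  (pmean f < +oo)%E -> translation_continuous f.
Proof.
move=> M0 mf fM fp.
have part (c : R) : `|c| = 1 -> translation_continuous (fun x => Num.max 0 (c * f x)).
  move=> c1; apply: (@translation_continuous_ge0 (fun x => Num.max 0 (c * f x)) M M0).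
  - by apply: measurable_maxr => //; exact: measurable_funM.
  - by move=> x; rewrite le_max lexx.
  - by move=> x /fM ->; rewrite mulr0 maxxx.
  have m1 := measurable_powR_norm p mf.
  have mm : measurable_fun setT (fun x => Num.max 0 (c * f x)).
    by apply: measurable_maxr => //; exact: measurable_funM.
  have m2 := measurable_powR_norm p mm.
  apply: le_lt_trans fp; apply: ge0_le_integral => //.
  move=> x _; rewrite lee_fin; apply: ge0_ler_powR; rewrite ?nnegrE ?(ltW p0)//.
  rewrite ger0_norm ?le_max ?lexx// ge_max normr_ge0/=.
  by rewrite (le_trans (ler_norm _))// normrM c1 mul1r.
rewrite (_ : f = (fun x => Num.max 0 (1 * f x)) \+
                 (fun x => -1 * Num.max 0 (-1 * f x))).
  apply: (translation_continuousD p0); first by apply: part; rewrite normr1.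
  by apply: translation_continuousZ; apply: part; rewrite normrN normr1.
apply/funext => x /=; rewrite mul1r !mulN1r.
by have [h|h] := leP 0 (f x); have [h'|h'] := leP 0 (- f x); lra.
Qed.

End translation_continuous_Lp.

(** * The p-flux [|a|^(p-2) a] *)

Section euclidean.
Context {R : realType} {n : nat}.
Implicit Types (a b c : 'rV[R]_n) (k : R).

Lemma dotvC a b : dotv a b = dotv b a.
Proof. by apply: eq_bigr => i _; rewrite mulrC. Qed.

Lemma dotvDl a b c : dotv (a + b) c = dotv a c + dotv b c.
Proof. by rewrite /dotv -big_split; apply: eq_bigr => i _; rewrite mxE mulrDl. Qed.

Lemma dotvZl k a b : dotv (k *: a) b = k * dotv a b.
Proof. by rewrite /dotv mulr_sumr; apply: eq_bigr => i _; rewrite mxE mulrA. Qed.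

Lemma dotvNl a b : dotv (- a) b = - dotv a b.
Proof. by rewrite -scaleN1r dotvZl mulN1r. Qed.

Lemma dotvBl a b c : dotv (a - b) c = dotv a c - dotv b c.
Proof. by rewrite dotvDl dotvNl. Qed.

Lemma dotvv_ge0 a : 0 <= dotv a a.
Proof. by apply: sumr_ge0 => i _; rewrite -expr2 sqr_ge0. Qed.

Lemma enorm_ge0 a : 0 <= enorm a. Proof. exact: sqrtr_ge0. Qed.

Lemma sqr_enorm a : enorm a ^+ 2 = dotv a a.
Proof. by rewrite sqr_sqrtr// dotvv_ge0. Qed.

Lemma ler_coord_enorm a i : `|a ord0 i| <= enorm a.
Proof.
rewrite -(@ler_pXn2r _ 2)// ?nnegrE ?enorm_ge0// sqr_enorm.
rewrite real_normK ?num_real// /dotv (bigD1 i)//= -expr2 lerDl.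
by apply: sumr_ge0 => j _; rewrite -expr2 sqr_ge0.
Qed.

Lemma ler_norm_enorm a : `|a| <= enorm a.
Proof. by apply: rV_norm_le => [|i]; [exact: enorm_ge0|exact: ler_coord_enorm]. Qed.

Lemma enorm_eq0 a : enorm a = 0 -> a = 0.
Proof. by move=> a0; have := ler_norm_enorm a; rewrite a0 normr_le0 => /eqP. Qed.

(** Cauchy-Schwarz, from the nonnegative square of |b| a - |a| b. *)
Lemma dotv_le_enorm a b : dotv a b <= enorm a * enorm b.
Proof.
have [/enorm_eq0 ->|a0] := eqVneq (enorm a) 0.
  by rewrite /dotv big1 ?mulr_ge0 ?enorm_ge0// => i _; rewrite mxE mul0r.
have [/enorm_eq0 ->|b0] := eqVneq (enorm b) 0.
  by rewrite /dotv big1 ?mulr_ge0 ?enorm_ge0// => i _; rewrite mxE mulr0.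
have ab0 : 0 < enorm a * enorm b by rewrite mulr_gt0// lt_def ?a0 ?b0 enorm_ge0.
have := dotvv_ge0 (enorm b *: a - enorm a *: b).
rewrite dotvBl !dotvZl ![dotv _ (_ - _)]dotvC !dotvBl !dotvZl [dotv b a]dotvC -!sqr_enorm.
set x := enorm a in ab0 *; set y := enorm b in ab0 *; set d := dotv a b => h.
by rewrite -(ler_pM2l ab0); nra.
Qed.

Lemma enormD a b : enorm (a + b) <= enorm a + enorm b.
Proof.
rewrite -(@ler_pXn2r _ 2)// ?nnegrE ?addr_ge0 ?enorm_ge0//.
rewrite sqr_enorm dotvDl ![dotv _ (a + b)]dotvC !dotvDl sqrrD !sqr_enorm [dotv b a]dotvC.
by have := dotv_le_enorm a b; rewrite mulr2n; lra.
Qed.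

Lemma enorm_le_norm a : enorm a <= n%:R * `|a|.
Proof.
have [n0|n0] := posnP n.
  rewrite /enorm (_ : dotv a a = 0) ?sqrtr0 ?mulr_ge0//.
  by rewrite /dotv; apply: big1 => i _; have := ltn_ord i; rewrite [X in (_ < X)%N]n0.
rewrite -(@ler_pXn2r _ 2)// ?nnegrE ?enorm_ge0 ?mulr_ge0// sqr_enorm.
apply: (@le_trans _ _ (\sum_(i < n) `|a| ^+ 2)).
  apply: ler_sum => i _; rewrite -expr2 -real_normK ?num_real//.
  by rewrite lerXn2r ?nnegrE//; exact: rV_norm_coord.
rewrite sumr_const card_ord exprMn -[leLHS]mulr_natl ler_wpM2r ?sqr_ge0//.
by rewrite expr2 -natrM ler_nat leq_pmulr.
Qed.

Lemma continuous_enorm : continuous (@enorm R n).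
Proof.
move=> a; apply: continuous_comp; last exact: sqrt_continuous.
apply: continuous_sum => i b.
by apply: cvgM; [exact: nbhs_filter|exact: coord_continuous|exact: coord_continuous].
Qed.

Definition pflux (p : R) a : 'rV[R]_n := enorm a `^ (p - 2) *: a.

Variables (p : R) (p1 : 1 < p).

Lemma powR_pred k : 0 <= k -> k `^ (p - 1) * k = k `^ p.
Proof.
move=> k0; rewrite -[X in _ * X](powRr1 k0) -powRD ?subrK//.
by apply/implyP; rewrite gt_eqF// (lt_trans ltr01).
Qed.

Lemma powR_pred2 k : 0 < k -> k `^ (p - 2) * k = k `^ (p - 1).
Proof.
move=> k0; rewrite -[X in _ * X](powRr1 (ltW k0)) -powRD.
  by congr (_ `^ _); ring.
by apply/implyP => _; rewrite gt_eqF.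
Qed.

Lemma pflux_le a b : dotv (pflux p a) b <= enorm a `^ (p - 1) * enorm b.
Proof.
rewrite dotvZl; have [/enorm_eq0 ->|a0] := eqVneq (enorm a) 0.
  rewrite (_ : dotv 0 b = 0) ?mulr0 ?mulr_ge0 ?powR_ge0 ?enorm_ge0//.
  by rewrite /dotv big1// => i _; rewrite mxE mul0r.
have a1 : 0 < enorm a by rewrite lt_def a0 enorm_ge0.
by rewrite -powR_pred2// -mulrA ler_wpM2l ?powR_ge0// dotv_le_enorm.
Qed.

Lemma pflux_self a : dotv (pflux p a) a = enorm a `^ p.
Proof.
rewrite dotvZl; have [a0|a0] := eqVneq (enorm a) 0.
  rewrite a0 (enorm_eq0 a0) [RHS]powR0; last by rewrite gt_eqF// (lt_trans ltr01).
  by rewrite /dotv big1 ?mulr0// => i _; rewrite mxE mul0r.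
have a1 : 0 < enorm a by rewrite lt_def a0 enorm_ge0.
by rewrite -sqr_enorm expr2 mulrA powR_pred2// powR_pred// ltW.
Qed.

(** Bounding the cross terms by [pflux_le] reduces the claim to (X - Y)(x - y) >= 0 with x, y the
    two norms and X, Y their powers of exponent p - 1, which are increasing. *)
Lemma pflux_monotone a b : 0 <= dotv (pflux p a - pflux p b) (a - b).
Proof.
rewrite dotvBl ![dotv _ (a - b)]dotvC !dotvBl ![dotv _ (pflux p _)]dotvC !pflux_self.
have := pflux_le a b; have := pflux_le b a.
rewrite -(powR_pred (enorm_ge0 a)) -(powR_pred (enorm_ge0 b)).
set x := enorm a; set y := enorm b; set X := x `^ _; set Y := y `^ _ => h1 h2.
suff : 0 <= (X - Y) * (x - y) by nra.
have p10 : 0 <= p - 1 by rewrite subr_ge0 ltW.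
have [xy|/ltW yx] := leP x y.
  rewrite -mulrNN !opprB mulr_ge0 ?subr_ge0//.
  by apply: ge0_ler_powR; rewrite ?nnegrE ?enorm_ge0.
rewrite mulr_ge0 ?subr_ge0//.
by apply: ge0_ler_powR; rewrite ?nnegrE ?enorm_ge0.
Qed.

Lemma pflux_coord_le a i : `|pflux p a ord0 i| <= enorm a `^ (p - 1).
Proof.
have [a0|a0] := eqVneq (enorm a) 0.
  by rewrite (enorm_eq0 a0) mxE mxE mulr0 normr0 powR_ge0.
have a1 : 0 < enorm a by rewrite lt_def a0 enorm_ge0.
rewrite mxE normrM ger0_norm ?powR_ge0// -powR_pred2// ler_wpM2l ?powR_ge0//.
exact: ler_coord_enorm.
Qed.

(* A crude Young inequality: either [y <= k * x] or [x <= k^-1 * y]. *)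
Lemma powR_young (k x y : R) : 0 < k -> 0 <= x -> 0 <= y ->
  x `^ (p - 1) * y <= k * x `^ p + k^-1 `^ (p - 1) * y `^ p.
Proof.
move=> k0 x0 y0; have p10 : 0 <= p - 1 by rewrite subr_ge0 ltW.
have [yx|xy] := leP y (k * x).
  apply: (@le_trans _ _ (k * x `^ p)); last by rewrite lerDl mulr_ge0 ?powR_ge0.
  by rewrite -powR_pred// mulrCA ler_wpM2l ?powR_ge0.
apply: (@le_trans _ _ (k^-1 `^ (p - 1) * y `^ p)).
  rewrite -(powR_pred y0) mulrA ler_wpM2r// -powRM ?invr_ge0 ?(ltW k0)//.
  apply: ge0_ler_powR; rewrite ?nnegrE ?mulr_ge0 ?invr_ge0 ?(ltW k0)//.
  by rewrite mulrC ler_pdivlMr// mulrC ltW.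
by rewrite lerDr mulr_ge0 ?powR_ge0 ?(ltW k0).
Qed.

End euclidean.

(** * Mollification of functions defined on an open set *)

Section inner_points.
Context {R : realType} {n : nat}.
Implicit Types (D K : set 'rV[R]_n) (x y v : 'rV[R]_n).

(** Depth at least [r] below the complement, written without an infimum: an intersection of closed
    conditions, hence compact when [D] is bounded and [r] positive. *)
Definition inner D (r : R) := [set x | forall y, ~ D y -> r <= `|x - y|].

Lemma inner_sub D r : 0 < r -> inner D r `<=` D.
Proof.
move=> r0 x xD; apply: contrapT => nDx; have := xD x nDx.
by rewrite subrr normr0 leNgt r0.
Qed.

Lemma inner_le D r s : r <= s -> inner D s `<=` inner D r.
Proof. by move=> rs x xD y /xD; exact: le_trans. Qed.

Lemma inner_shift D r s x v : inner D (r + s) x -> `|v| <= s -> inner D r (x + v).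
Proof.
move=> xD vs y /xD; have := ler_normB (x + v - y) v.
by rewrite addrAC addrK; lra.
Qed.

Lemma closed_inner D r : closed (inner D r).
Proof.
rewrite (_ : inner D r = \bigcap_(y in ~` D) [set x | r <= `|x - y|]); last first.
  by apply/seteqP; split => x /=; exact.
apply: closed_bigI => y _.
apply: (preimage_closed (f := fun x => `|x - y|) _ (@closed_ge _ r)).
move=> x _; apply: continuous_comp; last exact: norm_continuous.
by apply: continuousB => //; exact: cst_continuous.
Qed.

Lemma compact_inner D r : bounded_set D -> 0 < r -> compact (inner D r).
Proof.
move=> [M [Mr bD]] r0; apply: bounded_closed_compact; last exact: closed_inner.
by exists M; split => // N MN x /(inner_sub r0) /(bD N MN).
Qed.

Lemma bounded_closure D : bounded_set D -> compact (closure D).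
Proof.
move=> [M [Mr bD]]; apply: bounded_closed_compact; last exact: closed_closure.
exists M; split => // N MN x.
have cN : closed [set y : 'rV[R]_n | `|y| <= N].
  apply: (preimage_closed (f := fun y : 'rV[R]_n => `|y|) _ (@closed_le _ N)).
  by move=> y _; exact: norm_continuous.
have : closure D `<=` [set y : 'rV[R]_n | `|y| <= N].
  rewrite [X in _ `<=` X](closure_id _).1//; apply: closure_subset => y.
  exact: (bD _ MN).
exact.
Qed.

(** Compactness of the closure makes a local choice of [d] uniform: around a point of [D] a ball
    fits inside [D], and around a boundary point [f] stays below [e], so the condition is void. *)
Lemma boundary_layer D (f : 'rV[R]_n -> R) (e : R) : open D -> bounded_set D ->
  {within closure D, continuous f} -> (forall x, boundary D x -> f x <= 0) ->
  0 < e -> exists2 d, 0 < d & forall x, D x -> e < f x -> inner D d x.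
Proof.
move=> oD bD /subspace_continuousP cf fb e0.
have := bounded_closure bD; rewrite compact_near_coveringP.
move=> /(_ R (at_right 0) (fun d x => closure D x -> e < f x -> inner D d x)).
have H : forall x, closure D x ->
    \forall x' \near x & i \near at_right (0 : R),
      closure D x' -> e < f x' -> inner D i x'.
  move=> x cDx; have [Dx|nDx] := pselect (D x).
    have /nbhs_ballP[r /= r0 hr] : nbhs x D by exact: open_nbhs_nbhs.
    exists (ball x (r / 2), [set d | d <= r / 2]) => /=.
      split; first by apply: nbhsx_ballx; rewrite divr_gt0.
      by apply: nbhs_right_le; rewrite divr_gt0.
    move=> [x' d] [xx' dr] _ _ y nDy; apply: (le_trans dr).
    rewrite leNgt; apply/negP => x'y; apply: nDy; apply: hr.
    move: xx'; rewrite -!ball_normE /= => xx'.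
    by have := ler_distD x' x y; lra.
  have /fb fx0 : boundary D x by split=> //; move=> /interior_subset.
  have := cf x cDx; move=> /cvgr_lt/(_ e (le_lt_trans fx0 e0)) => fe.
  exists ([set x' | closure D x' -> f x' < e], setT) => /=.
    by split; [exact: fe|exact: filterT].
  by move=> [x' d] /= [h _] /h h1 h2; have := lt_trans h1 h2; rewrite ltxx.
move=> /(_ _ H) near_d.
have [d [d0 hd]] : exists d : R, 0 < d /\ closure D `<=`
    (fun x => closure D x -> e < f x -> inner D d x).
  by near (at_right (0 : R)) => d; exists d; split => //; near: d.
exists d => // x Dx efx; apply: hd => //; exact: subset_closure.
Unshelve. all: by end_near. Qed.

End inner_points.

Section mollification.
Context {R : realType} {n : nat}.
Implicit Types (a : R) (g z : 'rV[R]_n -> R) (x y v : 'rV[R]_n).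
Local Notation mu := (lebesgue_rV n : {measure set 'rV[R]_n -> \bar R}).
Variables (e : R) (e0 : 0 < e).

Lemma convol_translate z x : measurable_fun setT z ->
  convol (mollifier e) z x = \int[mu]_y (z (y + x) * mollifier e y).
Proof.
move=> mz; rewrite /convol -(Rintegral_translation x).
  by apply: eq_Rintegral => y _; rewrite addrK.
apply: measurable_funM => //; apply: measurable_translation.
exact: measurable_mollifier.
Qed.

Lemma mollifier_scaled_integrable a :
  mu.-integrable setT (EFin \o (fun y => a * mollifier e y)).
Proof.
rewrite (_ : EFin \o _ = (fun y => a%:E * (mollifier e y)%:E)%E)//.
by apply: integrableZl => //; exact: mollifier_integrable.
Qed.

Lemma convol_integrable_translate z x : measurable_fun setT z ->
  (exists B, forall y, `|z y| <= B) ->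
  mu.-integrable setT (EFin \o (fun y => z (y + x) * mollifier e y)).
Proof.
move=> mz [B zB].
have := @convol_integrable R n (fun y => z (y + x)) (measurable_translation x mz) B
  (fun y => zB (y + x)) (mollifier e) 0.
under eq_fun do rewrite subr0; apply.
  exact: continuous_mollifier.
exact: mollifier_bounded_support.
Qed.

Lemma convol_le z x a : measurable_fun setT z -> (exists B, forall y, `|z y| <= B) ->
  (forall y, `|y| < e -> z (y + x) <= a) -> convol (mollifier e) z x <= a.
Proof.
move=> mz bz za; rewrite convol_translate//.
apply: (@le_trans _ _ (\int[mu]_y (a * mollifier e y))).
  apply: le_Rintegral => //.
  - exact: convol_integrable_translate.
  - exact: mollifier_scaled_integrable.
  - move=> y _; have [ey|ye] := leP e `|y|; first by rewrite mollifier_support// !mulr0.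
    by rewrite ler_wpM2r ?mollifier_ge0// za.
rewrite RintegralZl//; last exact: mollifier_integrable.
by rewrite integral_mollifier// mulr1.
Qed.

Lemma convol_ge z x a : measurable_fun setT z -> (exists B, forall y, `|z y| <= B) ->
  (forall y, `|y| < e -> a <= z (y + x)) -> a <= convol (mollifier e) z x.
Proof.
move=> mz bz za; rewrite convol_translate//.
apply: (@le_trans _ _ (\int[mu]_y (a * mollifier e y))).
  rewrite RintegralZl//; last exact: mollifier_integrable.
  by rewrite integral_mollifier// mulr1.
apply: le_Rintegral => //.
- exact: mollifier_scaled_integrable.
- exact: convol_integrable_translate.
- move=> y _; have [ey|ye] := leP e `|y|; first by rewrite mollifier_support// !mulr0.
  by rewrite ler_wpM2r ?mollifier_ge0// za.
Qed.

Lemma convol_dist_le z x : measurable_fun setT z -> mu.-integrable setT (EFin \o z) ->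
  (`|convol (mollifier e) z x - z x|%:E <=
   \int[mu]_y (`|z (y + x) - z x| * mollifier e y)%:E)%E.
Proof.
move=> mz iz; rewrite convol_translate//.
have i1 : mu.-integrable setT (EFin \o (fun y => z (y + x) * mollifier e y)).
  have [C C0 hC] := continuous_bounded_support_bounded
    (@continuous_mollifier R n e) (mollifier_bounded_support e0).
  have izC : mu.-integrable setT (EFin \o (fun y => C * z (y + x))).
    rewrite (_ : EFin \o _ = (fun y => C%:E * (z (y + x))%:E)%E)//.
    by apply: integrableZl => //; exact: (integrable_translation x iz).
  apply: le_integrable izC => //.
    apply/measurable_EFinP; apply: measurable_funM; first exact: measurable_translation.
    exact: measurable_mollifier.
  move=> y _; rewrite /= lee_fin normrM [in leRHS]normrM (ger0_norm C0).
  by rewrite [leRHS]mulrC ler_wpM2l.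
have i2 := mollifier_scaled_integrable (z x).
have -> : \int[mu]_y (z (y + x) * mollifier e y) - z x =
    \int[mu]_y ((z (y + x) - z x) * mollifier e y).
  under [RHS]eq_Rintegral do rewrite mulrBl.
  rewrite RintegralB// RintegralZl//; last exact: mollifier_integrable.
  by rewrite integral_mollifier// mulr1.
have i3 : mu.-integrable setT (EFin \o (fun y => (z (y + x) - z x) * mollifier e y)).
  rewrite (_ : (fun y => _) = fun y => z (y + x) * mollifier e y - z x * mollifier e y).
    exact: (@integrableB _ _ _ mu _ measurableT _ _ i1 i2).
  by apply/funext => y; rewrite mulrBl.
rewrite EFin_normr_Rintegral//.
apply: le_trans (le_abse_integral _ _ _) _ => //; first by case/integrableP : i3.
rewrite le_eqVlt; apply/orP; left; apply/eqP; apply: eq_integral => y _.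
by rewrite /= normrM (ger0_norm (mollifier_ge0 e0 y)).
Qed.

End mollification.

(** * Replacing a gradient by its mollification inside a flux integral *)

Section mollification_error.
Context {R : realType} {n : nat}.
Implicit Types (z b t : 'rV[R]_n -> R) (x y v : 'rV[R]_n).
Local Notation mu := (lebesgue_rV n : {measure set 'rV[R]_n -> \bar R}).

Lemma measurable_rV_addp :
  measurable_fun setT (fun u : 'rV[R]_n * 'rV[R]_n => u.2 + u.1).
Proof.
apply/measurable_fun_rVP => i.
rewrite (_ : _ \o _ = (fun u => rV_coord i u.2 + rV_coord i u.1)); last first.
  by apply/funext => u; rewrite /rV_coord /= mxE.
apply: measurable_funD.
  exact: measurableT_comp (measurable_rV_coord i) measurable_snd.
exact: measurableT_comp (measurable_rV_coord i) measurable_fst.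
Qed.

Variables (p : R) (p1 : 1 < p).

(** In the application [b] is a difference of fluxes, of growth p - 1 in the p-integrable [t], and
    [z] a difference of gradients. The error for one translation is small by Young and continuity of
    translations; Tonelli averages it over the mollifier. [zc] has to be the mollification only
    where [b] is nonzero, since the gradient of a mollified function is known only inside. *)
Lemma mollification_error z b t (C : R) :
  translation_continuous p z -> mu.-integrable setT (EFin \o z) ->
  measurable_fun setT b -> measurable_fun setT t -> (forall x, 0 <= t x) ->
  0 <= C -> (forall x, `|b x| <= C * t x `^ (p - 1)) -> (pmean p t < +oo)%E ->
  forall k : R, 0 < k -> exists2 d, 0 < d & forall e zc, 0 < e -> e < d ->
    measurable_fun setT zc ->
    (forall x, b x != 0 -> zc x = convol (mollifier e) z x) ->
    (\int[mu]_x (`|b x| * `|zc x - z x|)%:E <= k%:E)%E.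
Proof.
move=> tz iz mb mt t0 C0 bt pt k k0.
have [mz tz'] := tz.
pose P := fine (pmean p t).
have PE : pmean p t = P%:E by rewrite fineK// ge0_fin_numE// pmean_ge0.
have P0 : 0 <= P by rewrite fine_ge0// pmean_ge0.
(* [a] is the weight in Young's inequality and [s] the allowed p-mean of z(x + v) - z(x): each of
   the two terms contributes at most k / 2. The added ones avoid division by 0. *)
pose a := k / (2 * (C + 1) * (P + 1)).
have a0 : 0 < a by rewrite divr_gt0// !mulr_gt0// ltr_wpDl.
pose c := a^-1 `^ (p - 1); have c0 : 0 < c by rewrite powR_gt0// invr_gt0.
pose s := k / (2 * (C + 1) * c).
have s0 : 0 < s by rewrite divr_gt0// !mulr_gt0// ltr_wpDl.
have [d d0 hd] := tz' s s0.
exists d => // e zc e0 ed mzc hzc.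
pose T v := (\int[mu]_x (`|b x| * `|z (x + v)%R - z x|%R)%:E)%E.
have Tk v : `|v| < d -> (T v <= k%:E)%E.
  move=> /hd vd.
  have m1 : measurable_fun setT (fun x => z (x + v) - z x).
    by apply: measurable_funB => //; exact: measurable_translation.
  apply: (@le_trans _ _ (\int[mu]_x (((C * a)%:E * (`|t x| `^ p)%:E) +
      (C * c)%:E * (`|z (x + v) - z x| `^ p)%:E))%E).
    apply: ge0_le_integral => //.
    - apply/measurable_EFinP; apply: measurable_funM.
        exact: measurableT_comp.
      exact: measurableT_comp.
    - by apply: emeasurable_funD; apply: measurable_funeM; exact: measurable_powR_norm.
    - move=> x _; rewrite -!EFinM -EFinD lee_fin.
      rewrite (ger0_norm (t0 x)).
      have yg := powR_young p1 a0 (t0 x) (normr_ge0 (z (x + v) - z x)).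
      apply: (@le_trans _ _ (C * t x `^ (p - 1) * `|z (x + v) - z x|)).
        by rewrite ler_wpM2r.
      by rewrite -[leLHS]mulrA -(mulrA C a) -(mulrA C c) -mulrDr ler_wpM2l.
  have m2 := measurable_powR_norm p mt; have m3 := measurable_powR_norm p m1.
  have Ca0 : (0 <= (C * a)%:E)%E by rewrite lee_fin mulr_ge0// ltW.
  have Cc0 : (0 <= (C * c)%:E)%E by rewrite lee_fin mulr_ge0// ltW.
  have cq2 x : (0 <= (C * a)%:E * (`|t x| `^ p)%:E)%E by exact: mule_ge0.
  have cq3 x : (0 <= (C * c)%:E * (`|z (x + v)%R - z x|%R `^ p)%:E)%E.
    exact: mule_ge0.
  have cm2 := measurable_funeM (C * a)%:E m2.
  have cm3 := measurable_funeM (C * c)%:E m3.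
  rewrite ge0_integralD// !ge0_integralZl//.
  rewrite -/(pmean p t) PE.
  apply: (@le_trans _ _ ((C * a)%:E * P%:E + (C * c)%:E * s%:E)%E).
    apply: leeD => //; apply: lee_wpmul2l; first by rewrite lee_fin mulr_ge0// ltW.
    exact: vd.
  rewrite -!EFinM -EFinD lee_fin.
  have Cn : C + 1 != 0 by rewrite gt_eqF// ltr_wpDl.
  have Pn : P + 1 != 0 by rewrite gt_eqF// ltr_wpDl.
  have cn : c != 0 by rewrite gt_eqF.
  have h1 : C * a * P <= k / 2.
    rewrite /a -[leRHS]mulr1.
    have -> : C * (k / (2 * (C + 1) * (P + 1))) * P =
      k / 2 * ((C / (C + 1)) * (P / (P + 1))).
      by field; rewrite Cn Pn.
    rewrite ler_wpM2l ?divr_ge0 ?(ltW k0)//.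
    by rewrite mulr_ile1 ?divr_ge0 ?addr_ge0// ler_pdivrMr ?ltr_wpDl// mul1r lerDl.
  have h2 : C * c * s <= k / 2.
    rewrite /s -[leRHS]mulr1.
    have -> : C * c * (k / (2 * (C + 1) * c)) = k / 2 * (C / (C + 1)).
      by field; rewrite Cn cn.
    rewrite ler_wpM2l ?divr_ge0 ?(ltW k0)//.
    by rewrite ler_pdivrMr ?ltr_wpDl// mul1r lerDl.
  lra.
pose F (u : 'rV[R]_n * 'rV[R]_n) : \bar R :=
  (`|b u.1| * (`|z (u.2 + u.1) - z u.1| * mollifier e u.2))%:E.
have mF : measurable_fun setT F.
  have mb1 : measurable_fun setT (fun u : 'rV[R]_n * 'rV[R]_n => b u.1).
    exact: measurableT_comp mb measurable_fst.
  have mz1 : measurable_fun setT (fun u : 'rV[R]_n * 'rV[R]_n => z u.1).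
    exact: measurableT_comp mz measurable_fst.
  have mz2 : measurable_fun setT (fun u : 'rV[R]_n * 'rV[R]_n => z (u.2 + u.1)).
    exact: measurableT_comp mz measurable_rV_addp.
  have mm : measurable_fun setT (fun u : 'rV[R]_n * 'rV[R]_n => mollifier e u.2).
    apply: measurableT_comp measurable_snd.
    exact: measurable_mollifier.
  apply/measurable_EFinP; apply: measurable_funM; first exact: measurableT_comp.
  apply: measurable_funM => //; apply: measurableT_comp => //.
  exact: measurable_funB.
have F0 u : (0 <= F u)%E by rewrite lee_fin mulr_ge0// mulr_ge0// mollifier_ge0.
apply: (@le_trans _ _ (\int[mu]_x \int[mu]_y F (x, y))%E).
  apply: ge0_le_integral => //.
  - apply/measurable_EFinP; apply: measurable_funM; first exact: measurableT_comp.
    by apply: measurableT_comp => //; exact: measurable_funB.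
  - exact: (@measurable_fun_fubini_tonelli_F _ _ _ _ _ (lebesgue_rV n)).
  - move=> x _; have [bx|bx] := eqVneq (b x) 0.
      by rewrite bx normr0 mul0r; exact: integral_ge0.
    rewrite hzc// EFinM; apply: (@le_trans _ _ (`|b x|%:E *
      \int[mu]_y (`|z (y + x) - z x| * mollifier e y)%:E)%E).
      by apply: lee_wpmul2l; [rewrite lee_fin|exact: convol_dist_le].
    have mG : measurable_fun setT (fun y => (`|z (y + x) - z x| * mollifier e y)%:E).
      apply/measurable_EFinP; apply: measurable_funM; last exact: measurable_mollifier.
      apply: measurableT_comp => //; apply: measurable_funB => //.
      exact: measurable_translation.
    have G0 y : (0 <= (`|z (y + x)%R - z x|%R * mollifier e y)%:E)%E.
      by rewrite lee_fin mulr_ge0// mollifier_ge0.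
    by rewrite -ge0_integralZl.
rewrite (@fubini_tonelli _ _ _ _ _ (lebesgue_rV n) (lebesgue_rV n) F)//.
apply: (@le_trans _ _ (\int[mu]_y (k * mollifier e y)%:E)%E).
  apply: ge0_le_integral => //.
  - by move=> y _; exact: integral_ge0.
  - exact: (@measurable_fun_fubini_tonelli_G _ _ _ _ _ (lebesgue_rV n)).
  - apply/measurable_EFinP; apply: measurable_funM => //.
    exact: measurable_mollifier.
  - move=> y _; have [ey|ye] := leP e `|y|.
      rewrite mollifier_support// mulr0 integral0_eq// => x _.
      by rewrite /F /= mollifier_support// !mulr0.
    rewrite mulrC EFinM.
    rewrite [leLHS](_ : _ = ((mollifier e y)%:E * T y)%E).
      apply: lee_wpmul2l; first by rewrite lee_fin mollifier_ge0.
      by apply: Tk; exact: lt_trans ed.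
    have mG : measurable_fun setT (fun x => (`|b x| * `|z (x + y) - z x|)%:E).
      apply/measurable_EFinP; apply: measurable_funM; first exact: measurableT_comp.
      apply: measurableT_comp => //; apply: measurable_funB => //.
      exact: measurable_translation.
    have me0 : (0 <= (mollifier e y)%:E)%E by rewrite lee_fin mollifier_ge0.
    rewrite /T -ge0_integralZl//.
    apply: eq_integral => x _; rewrite /F /= -EFinM [y + x]addrC.
    by congr EFin; rewrite mulrA mulrC.
have := integral_mollifier e0 (n := n); rewrite /Rintegral => I1.
have Ifin : (\int[mu]_y (mollifier e y)%:E)%E \is a fin_num.
  by apply: integrable_fin_num => //; exact: mollifier_integrable.
under eq_integral do rewrite EFinM.
rewrite integralZl//; last exact: mollifier_integrable.
by rewrite -(fineK Ifin) I1 mule1.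
Qed.

End mollification_error.

(** * p-integrable functions on the whole space *)

Section Lp_finite.
Context {R : realType} {n : nat} (p : R) (p1 : 1 < p).
Implicit Types (f g t : 'rV[R]_n -> R) (x y v : 'rV[R]_n).
Local Notation mu := (lebesgue_rV n : {measure set 'rV[R]_n -> \bar R}).

Let p0 : 0 < p. Proof. exact: lt_trans p1. Qed.

Definition Lp_finite f := measurable_fun setT f /\ (pmean p f < +oo)%E.

Lemma le_pmean f g : measurable_fun setT f -> measurable_fun setT g ->
  (forall x, `|f x| <= `|g x|) -> (pmean p f <= pmean p g)%E.
Proof.
move=> mf mg fg; have m1 := measurable_powR_norm p mf.
have m2 := measurable_powR_norm p mg.
apply: ge0_le_integral => // x _.
by rewrite lee_fin ge0_ler_powR ?nnegrE// ltW.
Qed.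

Lemma Lp_finiteD f g : Lp_finite f -> Lp_finite g -> Lp_finite (f \+ g).
Proof.
move=> [mf ff] [mg gg]; split; first exact: measurable_funD.
apply: le_lt_trans (pmeanD p0 mf mg) _.
apply: lte_mul_pinfty; [by rewrite lee_fin powR_ge0|by []|].
by apply: lte_add_pinfty.
Qed.

Lemma Lp_finiteZ (k : R) f : Lp_finite f -> Lp_finite (fun x => k * f x).
Proof.
move=> [mf ff]; split; first exact: measurable_funM.
rewrite pmeanZ//; apply: lte_mul_pinfty; [by rewrite lee_fin powR_ge0|by []|].
exact: ff.
Qed.

Lemma Lp_finiteB f g : Lp_finite f -> Lp_finite g -> Lp_finite (f \- g).
Proof.
move=> Ff Fg; rewrite (_ : _ \- _ = f \+ (fun x => -1 * g x)).
  exact/Lp_finiteD/Lp_finiteZ.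
by apply/funext => x /=; rewrite mulN1r.
Qed.

Lemma Lp_finite_norm f : Lp_finite f -> Lp_finite (fun x => `|f x|).
Proof.
move=> [mf ff]; split; first exact: measurableT_comp.
apply: le_lt_trans ff; apply: le_pmean => //; first exact: measurableT_comp.
by move=> x; rewrite normr_id.
Qed.

Lemma Lp_finite_sum (I : Type) (r : seq I) (F : I -> 'rV[R]_n -> R) :
  (forall i, Lp_finite (F i)) -> Lp_finite (fun x => \sum_(i <- r) F i x).
Proof.
move=> FF; elim: r => [|i r ih].
  rewrite (_ : (fun _ => _) = cst 0); last by apply/funext => x; rewrite big_nil.
  split => //; rewrite /pmean integral0_eq ?ltry// => x _ /=.
  by rewrite normr0 powR0// gt_eqF.
rewrite (_ : (fun _ => _) = F i \+ (fun x => \sum_(j <- r) F j x)); last first.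
  by apply/funext => x; rewrite big_cons.
exact: (Lp_finiteD (FF i) ih).
Qed.

Lemma Lp_finite_integrable_powR t : Lp_finite t ->
  mu.-integrable setT (fun x => (`|t x| `^ p)%:E).
Proof.
move=> [mt ft]; apply/integrableP; split; first exact: measurable_powR_norm.
by under eq_integral do rewrite gee0_abs ?lee_fin ?powR_ge0//.
Qed.

(** The constant 1 is integrable on a ball, so with [powR_le1D] this covers growth of any exponent
    between 0 and [p], in particular 1 and p - 1. *)
Lemma Lp_finite_integrable f t : measurable_fun setT f -> bounded_support f ->
  Lp_finite t -> (forall x, `|f x| <= 1 + `|t x| `^ p) ->
  mu.-integrable setT (EFin \o f).
Proof.
move=> mf /bounded_support_gt0[M M0 hM] Ft ft.
have i1 := integrable_indic_rV_ball (0 : 'rV[R]_n) M0.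
have i2 := Lp_finite_integrable_powR Ft.
have i3 : mu.-integrable setT (EFin \o (fun x => \1_(ball 0 M) x + `|t x| `^ p)).
  exact: (@integrableD _ _ _ mu _ measurableT _ _ i1 i2).
apply: le_integrable i3 => //; first exact/measurable_EFinP.
move=> x _; rewrite /= lee_fin.
have h0 : 0 <= \1_(ball 0 M) x + `|t x| `^ p by rewrite addr_ge0// ?powR_ge0.
rewrite (ger0_norm h0) indicE; have [xM|Mx] := boolP (_ \in _); first exact: ft.
rewrite hM ?normr0 ?addr_ge0 ?powR_ge0//.
by move: Mx; rewrite notin_setE -ball_normE /= sub0r normrN => /negP; rewrite -leNgt.
Qed.

Lemma powR_le1D (a b : R) : 0 <= a -> 0 <= b -> b <= p -> a `^ b <= 1 + a `^ p.
Proof.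
move=> a0 b0 bp; have [a1|/ltW a1] := leP a 1.
  apply: (@le_trans _ _ 1); last by rewrite lerDl powR_ge0.
  have : a `^ b <= 1 `^ b by apply: ge0_ler_powR; rewrite ?nnegrE.
  by rewrite powR1.
apply: (@le_trans _ _ (a `^ p)); last by rewrite lerDr.
by rewrite ler_powR.
Qed.

Lemma Lp_finite_integrable1 f : bounded_support f -> Lp_finite f ->
  mu.-integrable setT (EFin \o f).
Proof.
move=> bf Ff; apply: (Lp_finite_integrable Ff.1 bf Ff) => x.
by rewrite -[leLHS]powRr1// powR_le1D// ltW.
Qed.

Lemma Lp_finite_patch D K f : open D -> Lp_loc p D f -> compact K -> K `<=` D ->
  Lp_finite (f \_ K).
Proof.
move=> oD [mf fK] cK KD; have mK := compact_measurable_rV cK; split.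
  apply/(measurable_restrictT _ mK).
  exact: (measurable_funS (open_measurable_rV oD) KD mf).
apply: le_lt_trans (fK K cK KD); rewrite [leRHS]integral_mkcond.
rewrite le_eqVlt; apply/orP; left; apply/eqP; apply: eq_integral => x _.
rewrite !patchE; case: ifP => // _.
by rewrite normr0 powR0// gt_eqF.
Qed.

Lemma bounded_support_patch K f : compact K -> bounded_support (f \_ K).
Proof.
move=> cK; apply: (compact_bounded_support cK) => x nKx.
by rewrite patchE memNset.
Qed.

Lemma continuous_Lp_loc D f : open D -> continuous f -> Lp_loc p D f.
Proof.
move=> oD cf; split.
  apply: measurable_funTS; exact: continuous_measurable_rV.
move=> K cK KD; have mK := compact_measurable_rV cK.
have /compact_bounded[C [_ hC]] : compact (f @` K).
  by apply: continuous_compact => //; exact: continuous_subspaceT.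
have mfp : measurable_fun K (fun x => (`|f x| `^ p)%:E).
  by apply: measurable_funTS; apply: measurable_powR_norm; exact: continuous_measurable_rV.
apply: (@le_lt_trans _ _ (\int[mu]_(x in K) ((`|C| + 1) `^ p)%:E)%E).
  apply: ge0_le_integral => // x Kx; rewrite lee_fin ge0_ler_powR ?nnegrE ?(ltW p0)//.
  by apply: hC; [rewrite ltr_pwDr ?ler_norm|exists x].
rewrite integral_cst// lte_mul_pinfty ?lee_fin ?powR_ge0//.
by apply: (bounded_lebesgue_rV mK); exact: compact_bounded.
Qed.

End Lp_finite.

(** The function is the derivative of exp(-1/t), namely s^2 exp(-s) with s = 1/t, and exp s >= 1 +
    s^2 / 2. *)
Lemma flat1_deriv_bounds {R : realType} (t : R) :
  0 <= flat ('X^2 * (1 - 1^`())) t <= 2.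
Proof.
rewrite /flat; case: ifPn => t0; last by rewrite lexx ler0n.
rewrite derivC subr0 mulr1 hornerXn; set s := t^-1.
have s0 : 0 < s by rewrite invr_gt0.
rewrite mulr_ge0 ?exprn_ge0 ?expR_ge0 ?(ltW s0)//= expRN ler_pdivrMr ?expR_gt0//.
have h : 1 + s ^+ 2 / 2 <= expR s by exact: (expR_ge1Dxn 1 (ltW s0)).
lra.
Qed.

(** * Comparison with weak p-harmonic functions *)

Section test_functions.
Context {R : realType} {n : nat}.
Implicit Types (D K : set 'rV[R]_n) (f g phi : 'rV[R]_n -> R) (x : 'rV[R]_n).
Local Notation mu := (lebesgue_rV n : {measure set 'rV[R]_n -> \bar R}).

(** [inner D r] is closed, so it contains the support as well as the points where [phi] is
    nonzero. *)
Lemma inner_test_function D phi (r : R) : bounded_set D -> 0 < r -> smooth phi ->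
  (forall x, phi x != 0 -> inner D r x) -> test_function D phi.
Proof.
move=> bD r0 sphi phiD.
have sub : fsupport phi `<=` inner D r.
  by rewrite [X in _ `<=` X](closure_id _).1; [exact: closure_subset|exact: closed_inner].
split => //; last exact: subset_trans sub (inner_sub r0).
apply: (subclosed_compact _ (compact_inner bD r0) sub); exact: closed_closure.
Qed.

Lemma inner_bounded_support D phi (r : R) : bounded_set D -> 0 < r ->
  (forall x, phi x != 0 -> inner D r x) -> bounded_support phi.
Proof.
move=> bD r0 phiD; apply: (compact_bounded_support (compact_inner bD r0)) => x nx.
by apply/eqP; apply: contra_notT nx; exact: phiD.
Qed.

Lemma partial_inner D phi (r : R) i x :
  (forall x, phi x != 0 -> inner D r x) -> ~ inner D r x -> partial i phi x = 0.
Proof.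
move=> phiD nx; rewrite /partial (near_eq_derive _ (g := cst 0)) ?derive_cst//.
have : nbhs x (~` inner D r).
  by apply: open_nbhs_nbhs; split => //; rewrite openC; exact: closed_inner.
by apply: filterS => y ny; apply/eqP; apply: contra_notT ny; exact: phiD.
Qed.

Lemma Rintegral_zero_outside D f : (forall x, ~ D x -> f x = 0) ->
  \int[mu]_(x in D) f x = \int[mu]_x f x.
Proof.
move=> fD; rewrite Rintegral_mkcond; apply: eq_Rintegral => x _.
by rewrite patchE; case: ifPn => // /negP xD; rewrite fD// => Dx; apply: xD; rewrite inE.
Qed.

Lemma integrableMr f g : mu.-integrable setT (EFin \o f) -> measurable_fun setT g ->
  (exists C, forall x, `|g x| <= C) -> mu.-integrable setT (EFin \o (fun x => f x * g x)).
Proof.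
move=> intf mg [C gC]; have C0 : 0 <= C by exact: le_trans (gC 0).
have intCf : mu.-integrable setT (EFin \o (fun x => C * f x)).
  rewrite (_ : EFin \o _ = (fun x => C%:E * (f x)%:E)%E)//.
  exact: integrableZl.
apply: le_integrable intCf => //.
  apply/measurable_EFinP; apply: measurable_funM => //.
  by apply/measurable_EFinP; case/integrableP : intf.
by move=> x _; rewrite /= lee_fin normrM [in leRHS]normrM (ger0_norm C0) mulrC ler_wpM2r.
Qed.

End test_functions.

Section comparison.
Context {R : realType} {n : nat}.
Variables (p : R) (p1 : 1 < p).
Implicit Types (x y v : 'rV[R]_n) (i : 'I_n).
Local Notation mu := (lebesgue_rV n : {measure set 'rV[R]_n -> \bar R}).

Variables (D : set 'rV[R]_n) (oD : open D) (bD : bounded_set D).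
Variables (h : 'rV[R]_n -> R) (G : 'rV[R]_n -> 'rV[R]_n).
Hypothesis ch : {within closure D, continuous h}.
Hypothesis hG : sobolev_loc p D h G.
Hypothesis hE : forall phi, test_function D phi ->
  (\int[lebesgue_rV n]_(x in D)
    ((enorm (G x) `^ (p - 2)) * dotv (G x) (gradient phi x))%:E = 0)%E.
(** [w] is the strict supersolution, [W] its gradient and [c > 0] minus its p-Laplacian. [wW] and
    [wc] state this weakly, on the whole space, since the barrier is defined globally. *)
Variables (w : 'rV[R]_n -> R) (W : 'rV[R]_n -> 'rV[R]_n) (c : 'rV[R]_n -> R).
Hypothesis cw : continuous w.
Hypothesis cW : forall i, continuous (fun x => W x ord0 i).
Hypothesis cA : forall i, continuous (fun x => pflux p (W x) ord0 i).
Hypothesis cc : continuous c.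
Hypothesis c0 : forall x, 0 < c x.
Hypothesis wW : forall phi i, smooth phi -> bounded_support phi ->
  \int[mu]_x (w x * partial i phi x) = - \int[mu]_x (W x ord0 i * phi x).
Hypothesis wc : forall phi, smooth phi -> bounded_support phi ->
  \int[mu]_x dotv (pflux p (W x)) (gradient phi x) = \int[mu]_x (c x * phi x).
Hypothesis hw : forall x, boundary D x -> h x <= w x.

Let mD : measurable D. Proof. exact: open_measurable_rV. Qed.

Let g := (h \- w) \_ D.

Let g_bounded : exists B, forall x, `|g x| <= B.
Proof.
have chw : {within closure D, continuous (h \- w)}.
  move=> x; apply: continuousB; first exact: ch.
  exact: continuous_subspaceT.
have /compact_bounded[B [_ hB]] : compact ((h \- w) @` closure D).
  by apply: continuous_compact => //; exact: bounded_closure.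
exists (`|B| + 1) => x; rewrite /g patchE; case: ifPn => [/set_mem Dx|_].
  apply: hB; first by rewrite ltr_pwDr ?ler_norm.
  by exists x => //; exact: subset_closure.
by rewrite normr0 addr_ge0.
Qed.

Let mg : measurable_fun setT g.
Proof.
apply/(measurable_restrictT _ mD); apply: measurable_funB; first by case: hG => -[].
by apply: measurable_funTS; exact: continuous_measurable_rV.
Qed.

(** * Weak gradient and energy identity at a fixed depth *)

Section fixed_radius.
Variables (r : R) (r0 : 0 < r).
(** [N] will carry the test function of the energy identity, [K] the mollifiers of radius at most
    [r] centred in [N]. *)
Let K := inner D r.
Let N := inner D (r + r).

Let KD : K `<=` D. Proof. exact: inner_sub. Qed.
Let NK : N `<=` K. Proof. by apply: inner_le; rewrite lerDl ltW. Qed.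
Let cK : compact K. Proof. exact: compact_inner. Qed.
Let cN : compact N. Proof. by apply: compact_inner => //; exact: addr_gt0. Qed.
Let mN : measurable N. Proof. exact: compact_measurable_rV. Qed.

(** [G] is only locally p-integrable in [D]; cut off on the compact set [K] it is p-integrable on
    the whole space, where translations act. *)
Let GK i : 'rV[R]_n -> R := (fun x => G x ord0 i) \_ K.
Let WK i : 'rV[R]_n -> R := (fun x => W x ord0 i) \_ K.
Let Z i : 'rV[R]_n -> R := GK i \- WK i.

Let GK_Lp i : Lp_finite p (GK i).
Proof. by case: hG => _ /(_ i) Gi _; exact: (Lp_finite_patch p1 oD Gi). Qed.

Let WK_Lp i : Lp_finite p (WK i).
Proof.
have Wi := continuous_Lp_loc p1 oD (@cW i).
exact: (Lp_finite_patch p1 oD Wi).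
Qed.

Let Z_Lp i : Lp_finite p (Z i). Proof. exact: Lp_finiteB. Qed.

Let GK_int i : mu.-integrable setT (EFin \o GK i).
Proof. by apply: (Lp_finite_integrable1 p1) => //; exact: bounded_support_patch. Qed.

Let WK_int i : mu.-integrable setT (EFin \o WK i).
Proof. by apply: (Lp_finite_integrable1 p1) => //; exact: bounded_support_patch. Qed.

Let Z_int i : mu.-integrable setT (EFin \o Z i).
Proof. exact: (@integrableB _ _ _ mu _ measurableT _ _ (GK_int i) (WK_int i)). Qed.

Let Z_translation i : translation_continuous p (Z i).
Proof.
have [mZ fZ] := Z_Lp i.
have [M M0 hM] : exists2 M, 0 < M & forall x, M <= `|x| -> Z i x = 0.
  apply/bounded_support_gt0/(compact_bounded_support cK) => x nKx.
  by rewrite /Z /= /GK /WK !patchE memNset// subrr.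
exact: (translation_continuous_Lp (lt_trans ltr01 p1) M0).
Qed.

Lemma weak_gradient_difference phi i : smooth phi ->
  (forall x, phi x != 0 -> K x) ->
  \int[mu]_x (g x * partial i phi x) = - \int[mu]_x (Z i x * phi x).
Proof.
move=> sphi phiK.
have tphi : test_function D phi by exact: (inner_test_function bD r0).
have bphi : bounded_support phi by exact: (inner_bounded_support bD r0).
have spp := smooth_partial i sphi; have bpp := bounded_support_partial i bphi.
have [C C0 hC] := continuous_bounded_support_bounded (smooth_continuous sphi) bphi.
have phi0 x : ~ K x -> phi x = 0.
  by move=> nKx; apply/eqP; apply: contra_notT nKx; exact: phiK.
have pp0 x : ~ D x -> partial i phi x = 0.
  by move=> nDx; apply: (partial_inner _ phiK) => /KD.
have iw : mu.-integrable setT (EFin \o (fun x => w x * partial i phi x)).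
  apply: smooth_bounded_support_integrable; last exact: bounded_supportMr.
  move=> x; apply: continuousM; first exact: cw.
  exact: smooth_continuous.
have ig : mu.-integrable setT (EFin \o (fun x => g x * partial i phi x)).
  apply: bounded_support_integrable.
  - by apply: measurable_funM => //; exact: continuous_measurable_rV (smooth_continuous spp).
  - exact: bounded_supportMr.
  - have [B gB] := g_bounded.
    have [E E0 hE'] := continuous_bounded_support_bounded (smooth_continuous spp) bpp.
    by exists (B * E) => x; rewrite normrM ler_pM.
have iGphi : mu.-integrable setT (EFin \o (fun x => GK i x * phi x)).
  apply: integrableMr => //; last by exists C.
  exact: continuous_measurable_rV (smooth_continuous sphi).
have iWphi : mu.-integrable setT (EFin \o (fun x => WK i x * phi x)).
  apply: integrableMr => //; last by exists C.
  exact: continuous_measurable_rV (smooth_continuous sphi).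
(* On [D] the integrand is [h] times the derivative, and outside [D] the derivative vanishes. Both
   summands are integrable, so the part of [w] can be split off afterwards. *)
have Eh : \int[mu]_x (g x * partial i phi x + w x * partial i phi x) =
    - \int[mu]_x (GK i x * phi x).
  case: hG => _ _ /(_ phi tphi i) /(congr1 fine); rewrite fineN => H.
  rewrite -(@Rintegral_zero_outside _ _ D); last by move=> x /pp0 ->; rewrite !mulr0 addr0.
  transitivity (\int[mu]_(x in D) (h x * partial i phi x)).
    apply: eq_Rintegral => x xD; rewrite -mulrDl; congr (_ * _).
    by rewrite /g patchE xD /= subrK.
  apply: etrans H _; congr (- _).
  transitivity (\int[mu]_(x in D) (GK i x * phi x)).
    apply: eq_Rintegral => x _; rewrite /GK patchE; case: ifPn => // /negP xK.
    by rewrite phi0 ?mulr0// => Kx; apply: xK; rewrite inE.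
  by apply: Rintegral_zero_outside => x nDx; rewrite phi0 ?mulr0// => /KD.
have Ew : \int[mu]_x (w x * partial i phi x) = - \int[mu]_x (WK i x * phi x).
  rewrite wW//; congr (- _); apply: eq_Rintegral => x _.
  rewrite /WK patchE; case: ifPn => // /negP xK.
  by rewrite phi0 ?mulr0// => Kx; apply: xK; rewrite inE.
move: Eh; rewrite RintegralD// Ew => /eqP; rewrite subr_eq => /eqP ->.
under [in RHS]eq_Rintegral do rewrite /Z /= mulrBl.
by rewrite RintegralB// opprB addrC.
Qed.


(** A single p-integrable bound for |G| and |W| on [K]; the factor [n] compares the Euclidean norm
    with the sup norm. *)
Let T x := n%:R * \sum_i (`|GK i x| + `|WK i x|).

Let T0 x : 0 <= T x.
Proof. by rewrite mulr_ge0// sumr_ge0. Qed.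

Let T_Lp : Lp_finite p T.
Proof.
apply: Lp_finiteZ; apply: (Lp_finite_sum p1) => i.
by apply: (Lp_finiteD p1); exact: (Lp_finite_norm p1).
Qed.

Let enorm_le_T (F : 'rV[R]_n) x :
  (forall i, `|F ord0 i| <= `|GK i x| + `|WK i x|) -> enorm F <= T x.
Proof.
move=> hF; apply: le_trans (enorm_le_norm _) _; rewrite ler_wpM2l//.
apply: rV_norm_le => [|i]; first by rewrite sumr_ge0.
by rewrite (bigD1 i)//= (le_trans (hF i))// lerDl sumr_ge0.
Qed.

Let enorm_G x : K x -> enorm (G x) <= T x.
Proof.
move=> Kx; apply: enorm_le_T => i.
by rewrite /GK patchE mem_set//= lerDl.
Qed.

Let enorm_W x : K x -> enorm (W x) <= T x.
Proof.
move=> Kx; apply: enorm_le_T => i.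
by rewrite /WK [X in _ <= _ + `|X|]patchE mem_set//= lerDr.
Qed.

Let FG i : 'rV[R]_n -> R := (fun x => pflux p (G x) ord0 i) \_ N.
Let FW i : 'rV[R]_n -> R := (fun x => pflux p (W x) ord0 i) \_ N.
Let B i : 'rV[R]_n -> R := FG i \- FW i.

Let p10 : 0 <= p - 1. Proof. by rewrite subr_ge0 ltW. Qed.

Let FG_le i x : `|FG i x| <= T x `^ (p - 1).
Proof.
rewrite /FG patchE; case: ifPn => [/set_mem Nx|_]; last by rewrite normr0 powR_ge0.
apply: le_trans (pflux_coord_le p _ _) _.
by apply: ge0_ler_powR; rewrite ?nnegrE ?enorm_ge0 ?T0//; apply/enorm_G/NK.
Qed.

Let FW_le i x : `|FW i x| <= T x `^ (p - 1).
Proof.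
rewrite /FW patchE; case: ifPn => [/set_mem Nx|_]; last by rewrite normr0 powR_ge0.
apply: le_trans (pflux_coord_le p _ _) _.
by apply: ge0_ler_powR; rewrite ?nnegrE ?enorm_ge0 ?T0//; apply/enorm_W/NK.
Qed.

Let B_le i x : `|B i x| <= 2 * T x `^ (p - 1).
Proof.
rewrite /B /=; apply: le_trans (ler_normB _ _) _.
by have := FG_le i x; have := FW_le i x; lra.
Qed.

Let mFG i : measurable_fun setT (FG i).
Proof.
apply/(measurable_restrictT _ mN).
have mGi j : measurable_fun N (fun x => G x ord0 j).
  case: hG => _ /(_ j)[mG _] _; apply: (measurable_funS mD) mG => x /NK; exact: KD.
rewrite (_ : (fun _ => _) = (fun x => enorm (G x) `^ (p - 2) * G x ord0 i)); last first.
  by apply/funext => x; rewrite mxE.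
apply: measurable_funM => //.
apply: (measurableT_comp (measurable_powR (p - 2))).
rewrite (_ : (fun _ => _) = (fun x => Num.sqrt (\sum_j G x ord0 j * G x ord0 j))) //.
apply: (measurableT_comp (continuous_measurable_fun (@sqrt_continuous R))).
by apply: measurable_sum => j; exact: measurable_funM.
Qed.

Let mFW i : measurable_fun setT (FW i).
Proof.
apply/(measurable_restrictT _ mN); apply: measurable_funTS.
exact: (continuous_measurable_rV (@cA i)).
Qed.

Let powR_T i (F : 'rV[R]_n -> R) x : `|F x| <= T x `^ (p - 1) ->
  `|F x| <= 1 + `|T x| `^ p.
Proof.
move=> hF; rewrite (ger0_norm (T0 x)); apply: le_trans hF _.
by apply: powR_le1D => //; rewrite gerBl.
Qed.

Let FG_int i : mu.-integrable setT (EFin \o FG i).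
Proof.
apply: (Lp_finite_integrable (mFG i) _ T_Lp); first exact: bounded_support_patch.
by move=> x; apply: powR_T => //; exact: FG_le.
Qed.

Let FW_int i : mu.-integrable setT (EFin \o FW i).
Proof.
apply: (Lp_finite_integrable (mFW i) _ T_Lp); first exact: bounded_support_patch.
by move=> x; apply: powR_T => //; exact: FW_le.
Qed.

Let mB i : measurable_fun setT (B i). Proof. exact: measurable_funB. Qed.

(** The equation of [h] has right-hand side 0 and that of [w] has [c]; their difference leaves the
    strict term with a sign opposite to monotonicity. *)
Lemma energy_identity phi : smooth phi -> (forall x, phi x != 0 -> N x) ->
  \sum_i \int[mu]_x (B i x * partial i phi x) = - \int[mu]_x (c x * phi x).
Proof.
move=> sphi phiN.
have rr0 : 0 < r + r by rewrite addr_gt0.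
have tphi : test_function D phi by exact: (inner_test_function bD rr0).
have bphi : bounded_support phi by exact: (inner_bounded_support bD rr0).
have pp0 i x : ~ N x -> partial i phi x = 0 by exact: partial_inner.
have im i F : mu.-integrable setT (EFin \o F) ->
    mu.-integrable setT (EFin \o (fun x => F x * partial i phi x)).
  move=> iF; have spp := smooth_partial i sphi.
  have bpp := bounded_support_partial i bphi.
  apply: integrableMr => //.
    exact: continuous_measurable_rV (smooth_continuous spp).
  have [C _ hC] := continuous_bounded_support_bounded (smooth_continuous spp) bpp.
  by exists C.
have dotE (F : 'rV[R]_n -> 'rV[R]_n) x :
    dotv (F x) (gradient phi x) =
    \sum_i ((fun y => F y ord0 i) \_ N) x * partial i phi x.
  apply: eq_bigr => i _; rewrite mxE patchE; case: ifPn => // /negP xN.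
  by rewrite pp0 ?mulr0// => Nx; apply: xN; rewrite inE.
have EG : \sum_i \int[mu]_x (FG i x * partial i phi x) = 0.
  have [_ <-] := Rintegral_sum (mu := mu) measurableT (index_enum 'I_n)
    (fun i => im i _ (FG_int i)).
  have /(congr1 fine) H := hE tphi.
  rewrite -[RHS]H -(@Rintegral_zero_outside _ _ D); last first.
    move=> x nDx; rewrite big1// => i _; rewrite pp0 ?mulr0//.
    by move=> /NK /KD.
  by apply: eq_Rintegral => x _; rewrite -dotvZl -/(pflux p (G x)) (dotE (pflux p \o G)).
have EW : \sum_i \int[mu]_x (FW i x * partial i phi x) = \int[mu]_x (c x * phi x).
  have [_ <-] := Rintegral_sum (mu := mu) measurableT (index_enum 'I_n)
    (fun i => im i _ (FW_int i)).
  rewrite -wc//.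
  by apply: eq_Rintegral => x _; rewrite (dotE (pflux p \o W)).
rewrite -EW -[RHS]sub0r -[X in X - _]EG -sumrB; apply: eq_bigr => i _.
under eq_Rintegral do rewrite /B /= mulrBl.
by rewrite RintegralB//; exact: im.
Qed.


(** * Testing with a function of the mollified difference *)

Section mollified.
Variables (s e : R) (s0 : 0 < s) (sr : s <= r) (e0 : 0 < e).
Hypothesis layer : forall x, D x -> e / 2 < h x - w x -> inner D (r + r + r) x.

Let gs := convol (mollifier s) g.
Let q : 'rV[R]_n -> R := gs + cst (- e).

Let sgs : smooth gs.
Proof.
have [b gb] := g_bounded.
exact: (smooth_convol mg gb (smooth_mollifier s) (mollifier_bounded_support s0)).
Qed.

Let sq : smooth q. Proof. by apply: smoothD => //; exact: smooth_cst. Qed.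

(** An average above [e] forces a value of [g] above e / 2 within distance [s] of [x]; that point
    has depth 3r by [layer], and s <= r leaves depth 2r at [x]. *)
Let q_gt0 x : 0 < q x -> N x.
Proof.
rewrite /q fctE /cst subr_gt0 => qx.
have [H|] := pselect (forall y, `|y| < s -> g (y + x) <= e / 2).
  have gx : gs x <= e / 2 := convol_le s0 mg g_bounded H.
  by have := lt_le_trans qx gx; rewrite ltNge ler_pdivrMr// ler_peMr ?(ltW e0)// ler1n.
move=> /existsNP[y /not_implyP[ys /negP]]; rewrite -ltNge => gy.
have Dy : D (y + x).
  apply: contrapT => nD; move: gy; rewrite /g patchE memNset//= ltNge.
  by rewrite divr_ge0// ltW.
have D3 : inner D (r + r + r) (y + x).
  by apply: layer => //; move: gy; rewrite /g patchE mem_set.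
have yr : `|- y| <= r by rewrite normrN ltW// (lt_le_trans ys sr).
by have := inner_shift D3 yr; rewrite addrAC subrr add0r.
Qed.

(** For [x] in [N] the mollifier centred at [x] is supported in [K], hence is itself a test function
    for the weak gradient. The signs from the reflected kernel and from the weak gradient cancel. *)
Lemma partial_mollified i x : N x -> partial i gs x = convol (mollifier s) (Z i) x.
Proof.
move=> Nx; have [b gb] := g_bounded.
rewrite /gs (partial_convol mg gb _ (smooth_mollifier s) (mollifier_bounded_support s0)).
rewrite fctE /convol.
pose psi y := mollifier s (y - x).
have spsi : smooth psi by exact: smooth_shift (smooth_mollifier s).
have psiK y : psi y != 0 -> K y.
  move=> psiy; rewrite -(subrK x y) addrC; apply: (inner_shift Nx).
  rewrite leNgt; apply: contra psiy => /ltW ry; apply/eqP.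
  by apply: (mollifier_support s0); exact: le_trans ry.
have := weak_gradient_difference i spsi psiK.
by rewrite /psi partial_shift => ->; rewrite opprK.
Qed.

Let phi := flat 1 \o q.
(** The derivative of exp(-1/t) at [q], so that the gradient of [phi] is [theta] times that of
    [gs]. *)
Let theta := flat ('X^2 * (1 - 1^`())) \o q.

Let sphi : smooth phi. Proof. exact: smooth_flat. Qed.

Let theta_bounds x : 0 <= theta x <= 2. Proof. exact: flat1_deriv_bounds. Qed.

Let phiN x : phi x != 0 -> N x.
Proof.
move=> phix; apply: q_gt0; rewrite ltNge; apply: contra phix => qx.
by rewrite /phi /= flat_le0.
Qed.

Let partial_phi i x : partial i phi x = theta x * partial i gs x.
Proof.
rewrite /phi partial_flat; last by move=> y; exact: smooth_differentiable.
rewrite /q partialD; last 2 first.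
- by move=> y; exact: smooth_differentiable.
- by move=> y; exact: differentiable_cst.
by rewrite partial_cst fctE [in X in _ * X]fctE addr0.
Qed.

Let BZ_ge0 x : 0 <= \sum_i B i x * Z i x.
Proof.
have [Nx|nNx] := pselect (N x); last first.
  by rewrite big1// => i _; rewrite /B /FG /FW /= !patchE memNset// subrr mul0r.
have := pflux_monotone p1 (G x) (W x); congr (0 <= _); apply: eq_bigr => i _.
rewrite /B /Z /FG /FW /GK /WK /= !patchE !mem_set//; last exact: NK.
by rewrite !mxE.
Qed.

(** Write B . grad phi as theta (B . Z) + theta B . (grad gs - Z). The first term is nonnegative by
    monotonicity of the flux; since theta <= 2, each coordinate of the second costs at most 2k. The
    energy identity concludes. *)
Lemma mollified_inequality (k : R) :
  (forall i, (\int[mu]_x (`|B i x| * `|partial i gs x - Z i x|)%:E <= k%:E)%E) ->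
  \int[mu]_x (c x * phi x) <= n%:R * (2 * k).
Proof.
move=> hk; have bphi : bounded_support phi.
  by apply: (inner_bounded_support bD _ phiN); rewrite addr_gt0.
have mth : measurable_fun setT theta.
  by apply: continuous_measurable_rV; apply: smooth_continuous; exact: smooth_flat.
have B_int i : mu.-integrable setT (EFin \o B i).
  exact: (@integrableB _ _ _ mu _ measurableT _ _ (FG_int i) (FW_int i)).
have iphi i : mu.-integrable setT (EFin \o (fun x => B i x * partial i phi x)).
  have spp := smooth_partial i sphi; have bpp := bounded_support_partial i bphi.
  apply: integrableMr => //.
    exact: continuous_measurable_rV (smooth_continuous spp).
  have [C _ hC] := continuous_bounded_support_bounded (smooth_continuous spp) bpp.
  by exists C.
have iBZ i : mu.-integrable setT (EFin \o (fun x => B i x * Z i x)).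
  have i1 := Lp_finite_integrable_powR T_Lp.
  have i2 := Lp_finite_integrable_powR (Z_Lp i).
  have i3 : mu.-integrable setT
      (EFin \o (fun x => 2 * (`|T x| `^ p + `|Z i x| `^ p))).
    rewrite (_ : EFin \o _ = fun x => 2%:E * ((`|T x| `^ p)%:E + (`|Z i x| `^ p)%:E))%E//.
    by apply: integrableZl => //; exact: (@integrableD _ _ _ mu _ measurableT _ _ i1 i2).
  apply: le_integrable i3 => //.
    by apply/measurable_EFinP; apply: measurable_funM => //; case: (Z_Lp i).
  move=> x _; rewrite /= lee_fin normrM [leRHS]ger0_norm ?mulr_ge0 ?addr_ge0 ?powR_ge0//.
  rewrite (ger0_norm (T0 x)).
  apply: le_trans (ler_wpM2r (normr_ge0 _) (B_le i x)) _.
  rewrite -mulrA ler_wpM2l//.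
  by have := powR_young p1 ltr01 (T0 x) (normr_ge0 (Z i x)); rewrite invr1 powR1 !mul1r.
have iJ i : mu.-integrable setT (EFin \o (fun x => B i x * Z i x * theta x)).
  apply: integrableMr => //; exists 2 => x.
  by have /andP[th0 th2] := theta_bounds x; rewrite ger0_norm.
have iE i : mu.-integrable setT
    (EFin \o (fun x => B i x * partial i phi x - B i x * Z i x * theta x)).
  exact: (@integrableB _ _ _ mu _ measurableT _ _ (iphi i) (iJ i)).
have Ek i : - (2 * k) <= \int[mu]_x (B i x * partial i phi x - B i x * Z i x * theta x).
  rewrite lerNl; apply: le_trans (ler_norm _) _; rewrite normrN -lee_fin.
  apply: (@le_trans _ _ (\int[mu]_x (2%:E * (`|B i x| * `|partial i gs x - Z i x|)%:E))%E).
    rewrite EFin_normr_Rintegral//.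
    apply: le_trans (le_abse_integral _ _ _) _ => //; first by case/integrableP : (iE i).
    apply: ge0_le_integral => //.
    - by case/integrableP : (iE i) => mE _; exact: measurableT_comp.
    - apply: measurable_funeM; apply/measurable_EFinP; apply: measurable_funM.
        exact: measurableT_comp.
      apply: measurableT_comp => //; apply: measurable_funB.
        exact: continuous_measurable_rV (smooth_continuous (smooth_partial i sgs)).
      by case: (Z_Lp i).
    - move=> x _; rewrite /= -EFinM lee_fin partial_phi.
      have -> : B i x * (theta x * partial i gs x) - B i x * Z i x * theta x =
        theta x * (B i x * (partial i gs x - Z i x)) by ring.
      have /andP[th0 th2] := theta_bounds x.
      by rewrite !normrM (ger0_norm th0) ler_wpM2r ?mulr_ge0.
  rewrite ge0_integralZl//; last first.
    apply/measurable_EFinP; apply: measurable_funM; first exact: measurableT_comp.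
    apply: measurableT_comp => //; apply: measurable_funB.
      exact: continuous_measurable_rV (smooth_continuous (smooth_partial i sgs)).
    by case: (Z_Lp i).
  by rewrite EFinM; apply: lee_wpmul2l; [rewrite lee_fin|exact: hk].
have EN := energy_identity sphi phiN.
have : \sum_i \int[mu]_x (B i x * partial i phi x) =
    \sum_i \int[mu]_x (B i x * Z i x * theta x) +
    \sum_i \int[mu]_x (B i x * partial i phi x - B i x * Z i x * theta x).
  rewrite -big_split; apply: eq_bigr => i _ /=.
  by rewrite RintegralB// addrC subrK.
have J0 : 0 <= \sum_i \int[mu]_x (B i x * Z i x * theta x).
  have [_ <-] := Rintegral_sum (mu := mu) measurableT (index_enum 'I_n) iJ.
  apply: Rintegral_ge0 => x _; rewrite -mulr_suml mulr_ge0//.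
  by case/andP : (theta_bounds x).
have E2 : - (n%:R * (2 * k)) <=
    \sum_i \int[mu]_x (B i x * partial i phi x - B i x * Z i x * theta x).
  apply: le_trans (ler_sum _ (fun i _ => Ek i)).
  by rewrite sumr_const card_ord -[leRHS]mulr_natl mulrN.
by rewrite EN; lra.
Qed.

Lemma mollified_integrable :
  mu.-integrable setT (EFin \o (fun x => c x * phi x)).
Proof.
have bphi : bounded_support phi.
  by apply: (inner_bounded_support bD _ phiN); rewrite addr_gt0.
apply: smooth_bounded_support_integrable; last exact: bounded_supportMr.
by move=> x; apply: continuousM; [exact: cc|exact: smooth_continuous].
Qed.

End mollified.

Lemma mollified_positive_part (e k : R) : 0 < e -> 0 < k ->
  (forall x, D x -> e / 2 < h x - w x -> inner D (r + r + r) x) ->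
  exists2 d, 0 < d & forall s, 0 < s -> s < d ->
    mu.-integrable setT
      (EFin \o (fun x => c x * flat 1 (convol (mollifier s) g x - e))) /\
    \int[mu]_x (c x * flat 1 (convol (mollifier s) g x - e)) <= k.
Proof.
(* Chosen so that the [n] coordinate errors 2k' add up to at most [k]. *)
move=> e0 k0 layer; pose k' := k / (2 * (n%:R + 1)).
have k'0 : 0 < k' by rewrite divr_gt0// mulr_gt0// ltr_wpDl.
have H i := mollification_error p1 (Z_translation i) (Z_int i) (mB i) T_Lp.1 T0
  (ler0n R 2) (B_le i) T_Lp.2 k'0.
have /choice[d hd] : forall i, exists d, 0 < d /\ forall s zc, 0 < s -> s < d ->
    measurable_fun setT zc ->
    (forall x, B i x != 0 -> zc x = convol (mollifier s) (Z i) x) ->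
    (\int[mu]_x (`|B i x| * `|zc x - Z i x|)%:E <= k'%:E)%E.
  by move=> i; have [d d0 hd] := H i; exists d.
exists (\big[Num.min/r]_i d i).
  by apply/bigmin_gtP; split => // i _; case: (hd i).
move=> s s0 /bigmin_gtP[sr sd].
split; first exact: (mollified_integrable s0 (ltW sr) e0 layer).
apply: le_trans (mollified_inequality s0 (ltW sr) e0 layer (k := k') _) _.
  move=> i; have [_ hi] := hd i; apply: (hi s _ s0 (sd i isT)).
    have [b gb] := g_bounded; apply: continuous_measurable_rV.
    apply: smooth_continuous; apply: smooth_partial.
    exact: (smooth_convol mg gb (smooth_mollifier s) (mollifier_bounded_support s0)).
  move=> x Bx; apply: (partial_mollified s0 (ltW sr)).
  apply: contrapT => nNx; move: Bx; rewrite /B /FG /FW /= !patchE memNset//.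
  by rewrite subrr eqxx.
have -> : n%:R * (2 * k') = k * (n%:R / (n%:R + 1)).
  rewrite /k'; have nn : (n%:R + 1 : R) != 0 by rewrite gt_eqF// ltr_wpDl.
  by field; rewrite nn.
by rewrite ler_piMr ?(ltW k0)// ler_pdivrMr ?ltr_wpDl// mul1r lerDl.
Qed.

End fixed_radius.

Lemma comparison x : D x -> h x <= w x.
Proof.
move=> Dx; rewrite leNgt; apply/negP => wh.
(* Half the excess at [x]: near [x], [g] stays above 3e / 2, so after mollifying and subtracting [e]
   at least e / 2 remains. *)
pose e := (h x - w x) / 2; have e0 : 0 < e by rewrite divr_gt0// subr_gt0.
have chw : {within closure D, continuous (h \- w)}.
  by move=> y; apply: continuousB; [exact: ch|exact: continuous_subspaceT].
have hwb y : boundary D y -> (h \- w) y <= 0.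
  by move=> /hw; rewrite /= subr_le0.
have e20 : 0 < e / 2 by rewrite divr_gt0.
have [d d0 hd] := boundary_layer oD bD chw hwb e20.
pose r := d / 3; have r0 : 0 < r by rewrite divr_gt0.
have layer y : D y -> e / 2 < h y - w y -> inner D (r + r + r) y.
  move=> Dy /(hd _ Dy); suff -> : r + r + r = d by [].
  by rewrite /r; field.
(* The bounds hold up to distance 2 rho, so that for |y - x| < rho and s < rho the average at [y]
   sees only such values. *)
have [rho rho0 hrho] : exists2 rho, 0 < rho & forall y, `|y| < rho + rho ->
    e * 3 / 2 <= g (y + x) /\ c x / 2 <= c (y + x).
  have near1 : \forall y \near x, closure D y -> e * 3 / 2 < h y - w y.
    have /subspace_continuousP H := chw.
    apply: (cvgr_gt _ (H x (subset_closure Dx))).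
    change (e * 3 / 2 < h x - w x).
    have -> : h x - w x = e * 2 by rewrite /e; field.
    lra.
  have /cvgr_gt/(_ (c x / 2)) := @cc x.
  rewrite ltr_pdivrMr// ltr_pMr// ltr1n => /(_ isT) near2.
  have nearD : nbhs x D by exact: open_nbhs_nbhs.
  have /nbhs_ballP[a /= a0 ha] : nbhs x [set y | e * 3 / 2 <= g y /\ c x / 2 <= c y].
    near=> y; have Dy : D y by near: y.
    split; last by apply: ltW; near: y.
    rewrite /g patchE mem_set//; apply: ltW.
    suff : closure D y -> e * 3 / 2 < h y - w y by apply; exact: subset_closure.
    by near: y; exact: near1.
  exists (a / 2) => [|y ya]; first by rewrite divr_gt0.
  apply: ha; rewrite -ball_normE /= opprD addrCA subrr addr0 normrN.
  by rewrite (lt_le_trans ya)// -splitr.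
(* A lower bound of the strict term that does not depend on [s]; allowing an error c1 / 2 then gives
   the contradiction. *)
pose c1 := c x / 2 * flat 1 (e / 2) * (rho *+ 2) ^+ n.
have c10 : 0 < c1.
  by rewrite !mulr_gt0 ?flat1_gt0 ?exprn_gt0// mulrn_wgt0.
have c120 : 0 < c1 / 2 by rewrite divr_gt0.
have [d' d'0 hd'] := mollified_positive_part r0 e0 c120 layer.
pose s := Num.min rho d' / 2.
have s0 : 0 < s by rewrite divr_gt0// lt_min rho0.
have [srho sd'] : s < rho /\ s < d'.
  have : s < Num.min rho d'.
    by rewrite /s ltr_pdivrMr// ltr_pMr ?lt_min ?rho0// ltr1n.
  by rewrite lt_min => /andP.
have [iphi Ile] := hd' s s0 sd'.
suff : c1 <= \int[mu]_x (c x * flat 1 (convol (mollifier s) g x - e)) by lra.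
apply: (@Rintegral_gt0 _ _ _ _ _ x) => //.
- by apply/measurable_EFinP; case/integrableP : iphi.
- by move=> y; rewrite mulr_ge0 ?flat1_ge0// ltW.
- by rewrite mulr_gt0 ?divr_gt0// flat1_gt0.
- move=> y; rewrite -ball_normE /= => xy; apply: ler_pM.
  + by rewrite divr_ge0// ltW.
  + exact: flat1_ge0.
  + have [|_] := hrho (y - x); last by rewrite subrK.
    by rewrite distrC (lt_trans xy)// ltrDl.
  + apply: flat1_nondecreasing; rewrite lerBrDr.
    have -> : e / 2 + e = e * 3 / 2 by field.
    apply: (convol_ge s0 mg g_bounded) => v vs.
    have [|+ _] := hrho (v + (y - x)); last by rewrite -addrA subrK.
    apply: le_lt_trans (ler_normD _ _) _; rewrite distrC.
    by apply: ltrD => //; exact: lt_trans srho.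
Unshelve. all: by end_near. Qed.

End comparison.

(** * The barrier *)

Lemma partial_sum (R : realType) (n : nat) (I : Type) (s : seq I)
    (F : I -> 'rV[R]_n -> R) j :
  (forall i, smooth (F i)) ->
  partial j (\sum_(i <- s) F i) = \sum_(i <- s) partial j (F i).
Proof.
move=> sF; elim: s => [|i s ih]; first by rewrite !big_nil; exact: (partial_cst 0).
rewrite !big_cons partialD ?ih// => z; apply: smooth_differentiable => //.
exact: smooth_sum.
Qed.

Section barrier.
Context {R : realType} {m : nat}.
Implicit Types (z : 'rV[R]_(m + 1)) (i : 'I_(m + 1)).
Local Notation mu := (lebesgue_rV (m + 1) : {measure set 'rV[R]_(m + 1) -> \bar R}).

Variables (a : 'rV[R]_(m + 1)) (b k lam p : R).
Hypotheses (b0 : 0 < b) (k0 : 0 < k) (p1 : 1 < p) (p2 : p <= 2).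
Hypothesis lamE : lam * (p - 1) = 2 * b * (m + 1)%:R.

Let last_coord : 'I_(m + 1) := rshift m ord0.
(** Selects the horizontal coordinates. *)
Let kap i : R := (i != last_coord)%:R.
Let u i z : R := z ord0 i - a ord0 i.

(* [y - b |x - x0|^2] in the coordinates [z = (x, y)], with [a = (x0, 0)]. *)
Definition paraboloid z : R := z ord0 last_coord - b * \sum_i kap i * u i z ^+ 2.

(** [Q] is the gradient of the paraboloid and [rho] its squared Euclidean norm. *)
Let Q i z : R := (i == last_coord)%:R - 2 * b * kap i * u i z.
Let rho z : R := \sum_i Q i z ^+ 2.

Let u_smooth i : smooth (u i).
Proof.
rewrite (_ : u i = (fun z => z ord0 i) + cst (- a ord0 i)); last by [].
by apply: smoothD; [exact: smooth_coord|exact: smooth_cst].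
Qed.

Let partial_u i j : partial j (u i) = cst ((j == i)%:R).
Proof.
rewrite (_ : u i = (fun z => z ord0 i) + cst (- a ord0 i)); last by [].
rewrite partialD; last 2 first.
- by move=> z; exact: differentiable_coord.
- by move=> z; exact: differentiable_cst.
by rewrite partial_coord partial_cst; apply/funext => z; rewrite !fctE addr0.
Qed.

Let QE i : Q i = cst ((i == last_coord)%:R) + cst (- (2 * b * kap i)) * u i.
Proof. by apply/funext => z; rewrite !fctE /cst /Q mulNr. Qed.

Let Q_smooth i : smooth (Q i).
Proof.
by rewrite QE; apply: smoothD; [|apply: smoothM => //]; exact: smooth_cst.
Qed.

Let partial_Q i j z : partial j (Q i) z = - (2 * b * kap i) * (j == i)%:R.
Proof.
have du y : differentiable (u i) y by exact: smooth_differentiable.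
rewrite QE partialD//; last by move=> y; exact: differentiableM.
by rewrite partialM// !partial_cst partial_u !fctE /cst mulr0 addr0 add0r.
Qed.

Let rhoE : rho = \sum_i Q i * Q i.
Proof. by apply/funext => z; rewrite /rho fct_sumE; apply: eq_bigr => i _; rewrite expr2. Qed.

Let rho_smooth : smooth rho.
Proof. by rewrite rhoE; apply: smooth_sum => i; exact: smoothM. Qed.

Let partial_rho j z : partial j rho z = - (4 * b * kap j) * Q j z.
Proof.
rewrite rhoE partial_sum; last by move=> i; exact: smoothM.
rewrite fct_sumE (bigD1 j)//= big1 ?addr0.
  rewrite partialM; [|by move=> y; exact: smooth_differentiable..].
  by rewrite !fctE !partial_Q eqxx !mulr1; ring.
move=> i ij; rewrite partialM; [|by move=> y; exact: smooth_differentiable..].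
by rewrite !fctE !partial_Q [j == i]eq_sym (negbTE ij) !mulr0 addr0.
Qed.

Let paraboloidE : paraboloid =
  (fun z => z ord0 last_coord) + cst (- b) * \sum_i cst (kap i) * (u i * u i).
Proof.
by apply/funext => z; rewrite !fctE fct_sumE /cst mulNr; congr (_ - _ * _).
Qed.

Lemma paraboloid_smooth : smooth paraboloid.
Proof.
rewrite paraboloidE; apply: smoothD; first exact: smooth_coord.
apply: smoothM; first exact: smooth_cst.
by apply: smooth_sum => i; apply: smoothM; [exact: smooth_cst|exact: smoothM].
Qed.

Let partial_paraboloid j z : partial j paraboloid z = Q j z.
Proof.
have s1 i : smooth (cst (kap i) * (u i * u i)).
  by apply: smoothM; [exact: smooth_cst|exact: smoothM].
have du i y : differentiable (u i) y by exact: smooth_differentiable.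
have ds y : differentiable (\sum_i cst (kap i) * (u i * u i)) y.
  by apply: smooth_differentiable; exact: smooth_sum.
rewrite paraboloidE partialD; last 2 first.
- by move=> y; exact: differentiable_coord.
- by move=> y; exact: differentiableM.
rewrite partial_coord partialM// partial_cst partial_sum// !fctE fct_sumE /cst mulr0 addr0.
rewrite (bigD1 j)//= big1 ?addr0.
  rewrite partialM//; last by move=> y; exact: differentiableM.
  rewrite partialM// partial_cst partial_u !fctE /cst eqxx mulr1 /Q eq_sym; ring.
move=> i ij; rewrite partialM//; last by move=> y; exact: differentiableM.
by rewrite partialM// partial_cst partial_u !fctE /cst [j == i]eq_sym (negbTE ij) !mulr0 !addr0 ?mulr0.
Qed.

(** The vertical component of the gradient is 1. The gradient never vanishes, so all real powers of
    [rho] are differentiable, even with negative exponent. *)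
Let rho_ge1 z : 1 <= rho z.
Proof.
rewrite /rho (bigD1 last_coord)//= {1}/Q /kap eqxx /= mulr0 mul0r subr0 expr1n lerDl.
by apply: sumr_ge0 => i _; exact: sqr_ge0.
Qed.

Let rho_gt0 z : 0 < rho z. Proof. exact: lt_le_trans (rho_ge1 z). Qed.

(** [E] is exp(lam q) raised to the power p - 1, and [Np s] is |grad q|^(2s). *)
Let E z : R := expR (lam * (p - 1) * paraboloid z).
Let Np (s : R) z : R := rho z `^ s.

Let d_rho z : differentiable rho z. Proof. exact: smooth_differentiable. Qed.
Let d_par z : differentiable paraboloid z.
Proof. exact/smooth_differentiable/paraboloid_smooth. Qed.

Let expR_par (l : R) i z :
  differentiable (fun y => expR (l * paraboloid y)) z /\
  partial i (fun y => expR (l * paraboloid y)) z = l * Q i z * expR (l * paraboloid z).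
Proof.
have dl : differentiable (cst l * paraboloid) z.
  by apply: differentiableM => //; exact: differentiable_cst.
have [_ D] := is_derive_comp (delta_mx ord0 i) dl (is_derive_expR _).
split.
  apply: (@differentiable_comp _ _ _ _ (cst l * paraboloid) expR) => //.
  by apply/derivable1_diffP.
rewrite /partial; apply: etrans D _.
have -> : 'D_(delta_mx ord0 i) (cst l * paraboloid) z = l * Q i z.
  rewrite -[LHS]/(partial i _ z) partialM//.
  by rewrite partial_cst !fctE /cst mulr0 addr0 partial_paraboloid.
by rewrite mulrC.
Qed.

Let Np_derive (s : R) i z :
  differentiable (Np s) z /\
  partial i (Np s) z = s * Np (s - 1) z * partial i rho z.
Proof.
have D0 := is_derive1_powR s (rho_gt0 z).
have [_ D] := is_derive_comp (delta_mx ord0 i) (d_rho z) D0.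
split; last exact: D.
apply: (@differentiable_comp _ _ _ _ rho (fun x => x `^ s)) => //.
by apply/derivable1_diffP; case: D0.
Qed.


(** Halved because [rho] is a squared norm. Up to the factor A^(p-1), [flux] is the p-flux of the
    barrier; the three terms of [dflux] differentiate [E], the power of [rho] and [Q] in turn. *)
Let s2 := (p - 2) / 2.
Let flux i z : R := E z * Np s2 z * Q i z.
Let dflux i z : R := E z * (lam * (p - 1) * Np s2 z * Q i z ^+ 2 +
  (2 - p) * 2 * b * kap i * Np (s2 - 1) z * Q i z ^+ 2 - 2 * b * kap i * Np s2 z).

Let dE z : differentiable E z.
Proof. by have [] := expR_par (lam * (p - 1)) last_coord z. Qed.
Let dNp (s : R) z : differentiable (Np s) z.
Proof. by have [] := Np_derive s last_coord z. Qed.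
Let dQ i z : differentiable (Q i) z. Proof. exact: smooth_differentiable. Qed.

Let dflux_differentiable i z : differentiable (flux i) z.
Proof. exact: (differentiableM (differentiableM (dE z) (dNp s2 z)) (dQ i z)). Qed.

Let partial_flux i : partial i (flux i) = dflux i.
Proof.
apply/funext => z; rewrite -[LHS]/(partial i (E * Np s2 * Q i) z).
rewrite partialM//; last by move=> y; exact: differentiableM.
rewrite partialM// !fctE partial_Q eqxx (Np_derive s2 i z).2 partial_rho.
rewrite (expR_par (lam * (p - 1)) i z).2 -/(E z) mulr1 /dflux /s2; by field.
Qed.

Let continuous_dflux i : continuous (dflux i).
Proof.
have dc (l : R) (y : 'rV[R]_(m + 1)) : differentiable (cst l) y by exact: differentiable_cst.
rewrite (_ : dflux i = E * (cst (lam * (p - 1)) * Np s2 * (Q i * Q i) +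
  cst ((2 - p) * 2 * b * kap i) * Np (s2 - 1) * (Q i * Q i) -
  cst (2 * b * kap i) * Np s2)); last first.
  by apply/funext => z; rewrite !fctE /cst /dflux expr2.
have dQQ y := differentiableM (dQ i y) (dQ i y).
have d1 y := differentiableM (differentiableM (dc (lam * (p - 1)) y) (dNp s2 y)) (dQQ y).
have d2 y := differentiableM
  (differentiableM (dc ((2 - p) * 2 * b * kap i) y) (dNp (s2 - 1) y)) (dQQ y).
have d3 y := differentiableM (dc (2 * b * kap i) y) (dNp s2 y).
move=> z; apply: differentiable_continuous.
exact: (differentiableM (dE z) (differentiableB (differentiableD (d1 z) (d2 z)) (d3 z))).
Qed.

Let sum_kap : \sum_i kap i = m%:R.
Proof.
rewrite big_split_ord/= big_ord1 /kap eqxx addr0.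
rewrite (eq_bigr (fun _ => 1)) => [|i _]; first by rewrite sumr_const card_ord.
suff -> : (lshift 1 i != last_coord) by [].
by rewrite -val_eqE /= addn0 neq_ltn ltn_ord.
Qed.

(** The middle term is nonnegative because p <= 2. By the choice of [lam] the first terms sum to 2 b
    (m + 1) [Np s2 z] rho, and rho >= 1, against 2 b m [Np s2 z] for the last ones. *)
Let dflux_gt0 z : 0 < \sum_i dflux i z.
Proof.
rewrite -mulr_sumr mulr_gt0 ?expR_gt0//.
have N0 : 0 < Np s2 z by exact: powR_gt0.
apply: (@lt_le_trans _ _ (\sum_i (2 * b * (m + 1)%:R * Np s2 z * Q i z ^+ 2 -
    2 * b * kap i * Np s2 z))).
  rewrite sumrB -mulr_sumr -/(rho z).
  under eq_bigr do rewrite mulrAC.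
  rewrite -mulr_sumr sum_kap natrD.
  have : 2 * b * Np s2 z * (m%:R + 1) <= 2 * b * Np s2 z * (m%:R + 1) * rho z.
    by rewrite ler_peMr ?rho_ge1// !mulr_ge0 ?(ltW b0) ?(ltW N0).
  have P0 : 0 < 2 * b * Np s2 z by rewrite !mulr_gt0.
  by move=> h; lra.
apply: ler_sum => i _; rewrite lamE lerB// lerDl.
rewrite mulr_ge0 ?sqr_ge0// mulr_ge0 ?powR_ge0//.
by rewrite !mulr_ge0 ?subr_ge0 ?(ltW b0).
Qed.

Hypothesis lam0 : 0 < lam.
Let A := k * lam.
Let A0 : 0 < A. Proof. exact: mulr_gt0. Qed.

Definition barrier z : R := k * (expR (lam * paraboloid z) - 1).

Let W z : 'rV[R]_(m + 1) := \row_i (- (A * expR (lam * paraboloid z)) * Q i z).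

Let barrierE : \- barrier = cst k + cst (- k) * (fun z => expR (lam * paraboloid z)).
Proof. by apply/funext => z; rewrite /barrier /= !fctE /cst; ring. Qed.

Let barrier_differentiable z : differentiable (\- barrier) z.
Proof.
rewrite barrierE; apply: differentiableD; first exact: differentiable_cst.
apply: differentiableM; first exact: differentiable_cst.
by have [] := expR_par lam last_coord z.
Qed.

Lemma continuous_barrier : continuous (\- barrier).
Proof. by move=> z; exact/differentiable_continuous. Qed.

Let partial_barrier i : partial i (\- barrier) = (fun z => W z ord0 i).
Proof.
have de y : differentiable (fun z => expR (lam * paraboloid z)) y.
  by have [] := expR_par lam last_coord y.
apply/funext => z; rewrite barrierE partialD//; last by move=> y; exact: differentiableM.
rewrite partialM// !partial_cst !fctE /cst mulr0 addr0 add0r (expR_par lam i z).2 mxE /A.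
ring.
Qed.

Let continuous_W i : continuous (fun z => W z ord0 i).
Proof.
rewrite (_ : (fun _ => _) = cst (- A) * (fun z => expR (lam * paraboloid z)) * Q i).
  move=> z; apply: differentiable_continuous; apply: differentiableM => //.
  apply: differentiableM; first exact: differentiable_cst.
  by have [] := expR_par lam last_coord z.
by apply/funext => z; rewrite mxE !fctE /cst; ring.
Qed.

(** The flux is homogeneous of degree p - 1, and |W| = A exp(lam q) rho^(1/2). *)
Let pflux_W i z : pflux p (W z) ord0 i = - A `^ (p - 1) * flux i z.
Proof.
pose e := expR (lam * paraboloid z); have e0 : 0 < e := expR_gt0 _.
have Ae0 : 0 < A * e by rewrite mulr_gt0.
have nW : enorm (W z) = A * e * rho z `^ 2^-1.
  rewrite powR12_sqrt ?(ltW (rho_gt0 z))// -[X in X * _](ger0_norm (ltW Ae0)).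
  rewrite -sqrtr_sqr -sqrtrM ?sqr_ge0// /enorm /dotv /rho mulr_sumr.
  by congr (Num.sqrt _); apply: eq_bigr => j _; rewrite !mxE -/e; ring.
rewrite mxE mxE nW powRM ?(ltW Ae0) ?powR_ge0// -powRrM.
have -> : 2^-1 * (p - 2) = s2 by rewrite mulrC.
have Ap : (A * e) `^ (p - 2) * (A * e) = A `^ (p - 1) * E z.
  rewrite powR_pred2// powRM ?(ltW A0) ?(ltW e0)//; congr (_ * _).
  by rewrite /E /e -expRM; congr expR; ring.
rewrite -/e -/(Np s2 z) /flux.
have -> : (A * e) `^ (p - 2) * Np s2 z * (- (A * e) * Q i z) =
  - ((A * e) `^ (p - 2) * (A * e)) * (Np s2 z * Q i z) by ring.
by rewrite Ap; ring.
Qed.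

(** The p-Laplacian of the barrier, that is, minus that of its opposite. *)
Let c z : R := A `^ (p - 1) * \sum_i dflux i z.

Let continuous_c : continuous c.
Proof.
have cs : continuous (fun z => \sum_i dflux i z).
  by apply: continuous_sum => i; exact: continuous_dflux.
rewrite (_ : c = cst (A `^ (p - 1)) \* (fun z => \sum_i dflux i z))//.
by move=> z; apply: continuousM; [exact: cst_continuous|exact: cs].
Qed.

Let continuous_pflux_W i : continuous (fun z => pflux p (W z) ord0 i).
Proof.
rewrite (_ : (fun _ => _) = cst (- A `^ (p - 1)) * flux i); last first.
  by apply/funext => z; rewrite pflux_W.
move=> z; apply: differentiable_continuous.
exact: differentiableM (differentiable_cst _ _) (dflux_differentiable i z).
Qed.

Let weak_gradient_barrier phi i : smooth phi -> bounded_support phi ->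
  \int[mu]_z ((\- barrier) z * partial i phi z) = - \int[mu]_z (W z ord0 i * phi z).
Proof.
move=> sphi bphi; rewrite Rintegral_by_parts//.
- by rewrite partial_barrier.
- by move=> z; exact: smooth_differentiable.
- by rewrite partial_barrier.
- exact/smooth_continuous/smooth_partial.
Qed.

Let weak_supersolution phi : smooth phi -> bounded_support phi ->
  \int[mu]_z dotv (pflux p (W z)) (gradient phi z) = \int[mu]_z (c z * phi z).
Proof.
move=> sphi bphi.
have cphi := smooth_continuous sphi.
have cf i : continuous (flux i).
  by move=> z; exact/differentiable_continuous/dflux_differentiable.
have i1 i : mu.-integrable setT (EFin \o (fun z => flux i z * partial i phi z)).
  apply: smooth_bounded_support_integrable.
    by move=> z; apply: continuousM; [exact: cf|exact/smooth_continuous/smooth_partial].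
  exact/bounded_supportMr/bounded_support_partial.
have i2 i : mu.-integrable setT (EFin \o (fun z => dflux i z * phi z)).
  apply: smooth_bounded_support_integrable; last exact: bounded_supportMr.
  by move=> z; apply: continuousM; [exact: continuous_dflux|exact: cphi].
have [i1s e1] := Rintegral_sum (mu := mu) measurableT (index_enum 'I_(m + 1)) i1.
have [i2s e2] := Rintegral_sum (mu := mu) measurableT (index_enum 'I_(m + 1)) i2.
transitivity (\int[mu]_z (- A `^ (p - 1) * \sum_i flux i z * partial i phi z)).
  apply: eq_Rintegral => z _; rewrite /dotv mulr_sumr; apply: eq_bigr => i _.
  by rewrite pflux_W [in LHS]mxE [RHS]mulrA.
rewrite RintegralZl// e1.
transitivity (\int[mu]_z (A `^ (p - 1) * \sum_i dflux i z * phi z)); last first.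
  by apply: eq_Rintegral => z _; rewrite /c -mulrA mulr_suml.
rewrite RintegralZl// e2 mulNr -mulrN -sumrN; congr (_ * _).
apply: eq_bigr => i _; rewrite Rintegral_by_parts ?opprK//.
- by rewrite partial_flux.
- by move=> z; exact: smooth_differentiable.
- by rewrite partial_flux; exact: continuous_dflux.
- exact/smooth_continuous/smooth_partial.
Qed.

Lemma barrier_comparison D h : bounded_set D -> open D ->
  {within closure D, continuous h} -> p_harmonic_weak p D h ->
  (forall z, boundary D z -> h z <= (\- barrier) z) ->
  forall z, D z -> h z <= (\- barrier) z.
Proof.
move=> bD oD ch [G hG hE] hb.
have c0 z : 0 < c z by rewrite mulr_gt0 ?powR_gt0.
exact: (comparison p1 oD bD ch hG hE continuous_barrier continuous_W
  continuous_pflux_W continuous_c c0 weak_gradient_barrier weak_supersolution hb).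
Qed.

End barrier.

(** * Geometry of the cylinder *)

Section cylinder_geometry.
Context {R : realType} {m : nat}.
Implicit Types (z : 'rV[R]_(m + 1)) (x : 'rV[R]_m) (Rad H : R).

Lemma xpart_xy x (y : R) : xpart (xy_point x y) = x.
Proof. exact: row_mxKl. Qed.

Lemma ypart_xy x (y : R) : ypart (xy_point x y) = y.
Proof. by rewrite /ypart row_mxKr mxE. Qed.

Lemma continuous_xnorm : continuous (fun z => enorm (xpart z)).
Proof.
move=> z; apply: (@continuous_comp _ _ _ (@lsubmx R 1 m 1) (@enorm R m)).
  exact: continuous_lsubmx.
exact: continuous_enorm.
Qed.

Lemma continuous_ypart : continuous (@ypart R m).
Proof.
move=> z; rewrite (_ : @ypart R m = fun z => z ord0 (rshift m ord0)).
  exact: coord_continuous.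
by apply/funext => y; rewrite /ypart mxE.
Qed.

Lemma open_cylinder Rad H : open (cylinder Rad H : set 'rV[R]_(m + 1)).
Proof.
rewrite (_ : cylinder Rad H =
  ((fun z => enorm (xpart z)) @^-1` [set t | t < Rad]) `&`
  (@ypart R m @^-1` [set t | 0 < t]) `&` (@ypart R m @^-1` [set t | t < H])).
  apply: openI; first apply: openI.
  - by apply: open_comp (@open_lt _ _) => z _; exact: continuous_xnorm.
  - by apply: open_comp (@open_gt _ _) => z _; exact: continuous_ypart.
  - by apply: open_comp (@open_lt _ _) => z _; exact: continuous_ypart.
by apply/seteqP; split => z /=; [move=> [? /andP[]]|move=> [[? h1] h2]; rewrite /cylinder /= h1].
Qed.

Lemma closure_cylinder Rad H z : closure (cylinder Rad H) z ->
  [/\ enorm (xpart z) <= Rad, 0 <= ypart z & ypart z <= H].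
Proof.
pose B : set 'rV[R]_(m + 1) := ((fun z => enorm (xpart z)) @^-1` [set t | t <= Rad]) `&`
  (@ypart R m @^-1` [set t | 0 <= t]) `&` (@ypart R m @^-1` [set t | t <= H]).
have cB : closed B.
  apply: closedI; first apply: closedI.
  - by apply: preimage_closed (@closed_le _ _) => y _; exact: continuous_xnorm.
  - by apply: preimage_closed (@closed_ge _ _) => y _; exact: continuous_ypart.
  - by apply: preimage_closed (@closed_le _ _) => y _; exact: continuous_ypart.
have : closure (cylinder Rad H) `<=` B.
  rewrite [X in _ `<=` X](closure_id _).1//; apply: closure_subset => y.
  by move=> [/ltW h1 /andP[/ltW h2 /ltW h3]].
by move=> /[apply] -[[]].
Qed.

Lemma paraboloid_xy x0 (b : R) z : paraboloid (xy_point x0 0) b z =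
  ypart z - b * enorm (xpart z - x0) ^+ 2.
Proof.
rewrite /paraboloid /ypart mxE sqr_enorm; congr (_ - b * _).
rewrite big_split_ord/= big_ord1 eqxx mul0r addr0; apply: eq_bigr => i _.
have -> : (lshift 1 i != rshift m ord0) by rewrite -val_eqE /= addn0 neq_ltn ltn_ord.
by rewrite mul1r /xy_point row_mxEl expr2 !mxE.
Qed.

End cylinder_geometry.

Lemma limf_esup_continuous (R : realType) (T : topologicalType) (Q : set T) (f : T -> R) (z : T) :
  {for z, continuous f} ->
  (limf_esup (EFin \o f) (within Q (nbhs z)) <= (f z)%:E)%E.
Proof.
move=> cf; apply/lee_addgt0Pr => e e0.
have ze : f z < f z + e by rewrite ltrDl.
apply: (@le_trans _ _ (ereal_sup ((EFin \o f) @` [set y | f y < f z + e]))).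
  apply: ereal_inf_lbound; exists [set y | f y < f z + e] => //.
  by have /cvgr_lt/(_ _ ze) := cf; apply: filterS.
by apply: ge_ereal_sup => _ [y /= fy <-]; rewrite lee_fin ltW.
Qed.

(** * Membership of the barrier in the lower class *)

Section lower_class_barrier.
Context {R : realType} {m : nat}.
Variables (r Rad h H p lam : R) (x0 : 'rV[R]_m).
Hypotheses (hrR : r < Rad) (H0 : 0 < H) (p1 : 1 < p) (p2 : p <= 2).
Hypothesis hx0 : enorm x0 <= r.
Let b := H / (Rad - r) ^+ 2.
Hypotheses (lam0 : 0 < lam) (lamE : lam * (p - 1) = 2 * b * (m + 1)%:R).

Let Rr0 : 0 < Rad - r. Proof. by rewrite subr_gt0. Qed.
Let b0 : 0 < b. Proof. by rewrite divr_gt0// exprn_gt0. Qed.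
(** Normalisation giving the value 1 where the paraboloid equals [H]. *)
Let k := (expR (lam * H) - 1)^-1.
Let eH : 0 < expR (lam * H) - 1.
Proof. by rewrite subr_gt0 expR_gt1 mulr_gt0. Qed.
Let k0 : 0 < k. Proof. by rewrite invr_gt0. Qed.
Let v := barrier (xy_point x0 0) b k lam.

Let paraboloid_le_H z : ypart z <= H -> v z <= 1.
Proof.
move=> zH; rewrite /v /barrier mulrC ler_pdivrMr// mul1r lerB// ler_expR ler_wpM2l ?(ltW lam0)//.
by rewrite paraboloid_xy (le_trans _ zH)// gerBl mulr_ge0 ?sqr_ge0// ltW.
Qed.

Let paraboloid_le_0 z : paraboloid (xy_point x0 0) b z <= 0 -> v z <= 0.
Proof.
move=> z0; rewrite /v /barrier pmulr_rle0// subr_le0 -expR0 ler_expR.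
by rewrite pmulr_rle0.
Qed.

Lemma barrier_lower_class :
  lower_class p (cylinder Rad H) (top_indicator Rad H) v.
Proof.
have cNv : continuous (\- v) by exact: continuous_barrier.
have cv : continuous v.
  rewrite (_ : v = \- (\- v)); last by apply/funext => z; rewrite /= opprK.
  by move=> z; apply: continuousN; exact: cNv.
split.
- split.
    move=> z a /=; rewrite lte_fin => az.
    have : \forall y \near (z : subspace (cylinder Rad H)), a < (\- v) y.
      have /(_ z) := @continuous_subspaceT _ _ (cylinder Rad H) _ cNv.
      by move=> /cvgr_gt; exact.
    by move=> near_z; exists [set y | a < (\- v) y].
  move=> D g bD oD _ cg hg gv.
  exact: (barrier_comparison b0 k0 p1 p2 lamE lam0 bD oD cg hg gv).
- by exists 1 => z [_ /andP[_ /ltW]]; exact: paraboloid_le_H.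
- move=> z [cz nz]; have le_vz := @limf_esup_continuous R _ (cylinder Rad H) v z (cv z).
  apply: (le_trans le_vz).
  have [h1 h2 h3] := closure_cylinder cz.
  rewrite lee_fin /top_indicator; case: ifPn => [_|]; first exact: paraboloid_le_H.
  have nQ : ~ cylinder Rad H z.
    move=> Qz; apply: nz; apply: open_nbhs_nbhs; split => //.
    exact: open_cylinder.
  move=> nF; apply: paraboloid_le_0; rewrite paraboloid_xy.
  (* The side includes the upper rim, where the boundary datum is 0 although y = H. *)
  have [Rz|zR] := leP Rad (enorm (xpart z)).
    have : Rad - r <= enorm (xpart z - x0).
      have := enormD (xpart z - x0) x0; rewrite subrK => hD.
      by rewrite lerBlDr (le_trans Rz)// (le_trans hD)// lerD2l.
    move=> Rrz; rewrite subr_le0 (le_trans h3)//.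
    rewrite /b mulrAC ler_pdivlMr ?exprn_gt0// ler_wpM2l ?(ltW H0)//.
    by rewrite lerXn2r ?nnegrE ?enorm_ge0// ltW.
  (* With |x| < Rad, a point of positive height would lie in the open cylinder or on its top, both
     excluded. *)
  have zy : ypart z <= 0.
    rewrite leNgt; apply/negP => y0; apply: nQ; split => //; rewrite y0/=.
    by rewrite lt_neqAle h3 andbT; apply: contra nF => /eqP ->; rewrite eqxx zR.
  by rewrite subr_le0 (le_trans zy)// mulr_ge0 ?sqr_ge0// ltW.
Qed.

Lemma barrier_value : v (xy_point x0 h) = k * (expR (lam * h) - 1).
Proof.
rewrite /v /barrier paraboloid_xy xpart_xy ypart_xy subrr.
by rewrite sqr_enorm /dotv big1 ?mulr0 ?subr0// => i _; rewrite mxE mul0r.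
Qed.

End lower_class_barrier.

(** * The value of the barrier on the axis and the constant *)

Theorem lemma3p1 (R : realType) (r Rad h H : R)
    (hr : 0 < r) (hrR : r < Rad) (hh : 0 < h) (hhH : h < H) :
  exists C : R, 0 < C /\
    forall (d : nat) (p : R), (2 <= d)%N -> 1 < p -> p <= 2 ->
    forall u : 'rV[R]_(d.-1 + 1) -> R,
      p_harmonic_dirichlet p (cylinder Rad H) (top_indicator Rad H) u ->
      forall x0 : 'rV[R]_d.-1, enorm x0 <= r ->
        expR (- (C * d%:R / (p - 1))) <= u (xy_point x0 h).
Proof.
pose b := H / (Rad - r) ^+ 2.
have H0 : 0 < H by exact: lt_trans hhH.
have b0 : 0 < b by rewrite divr_gt0// exprn_gt0// subr_gt0.
have bh0 : 0 < 4 * b * h by apply: mulr_gt0 => //; apply: mulr_gt0.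
(* Absorbs the prefactor: lam h >= 4 b h >= exp(-s). The maximum with 0 allows exp(-s t) <= exp(-s)
   below. *)
pose s := Num.max 0 (- ln (4 * b * h)).
have s0 : 0 <= s by rewrite le_max lexx.
have es : expR (- s) <= 4 * b * h.
  by rewrite -[leRHS]lnK ?posrE// ler_expR lerNl le_max lexx orbT.
exists (2 * b * H + s); split; first by rewrite ltr_wpDr// mulr_gt0// mulr_gt0.
move=> d p d2 p1 p2 u hu x0 hx0.
have p10 : 0 < p - 1 by rewrite subr_gt0.
pose t := d%:R / (p - 1).
(* From d >= 2 and p - 1 <= 1; it makes lam = 2 b t at least 4 b. *)
have t2 : 2 <= t.
  by rewrite /t ler_pdivlMr// (@le_trans _ _ 2) ?ler_nat//; lra.
pose lam := 2 * b * t.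
have lam0 : 0 < lam.
  by rewrite mulr_gt0//; [exact: mulr_gt0|exact: lt_le_trans t2].
have dE : (d.-1 + 1)%N = d by rewrite addn1 prednK// (leq_trans _ d2).
have lamE : lam * (p - 1) = 2 * b * (d.-1 + 1)%:R.
  by rewrite dE /lam /t; field; rewrite gt_eqF.
pose z0 := xy_point x0 h.
have Qz0 : cylinder Rad H z0.
  by split; rewrite ?xpart_xy ?ypart_xy ?hh ?hhH// (le_lt_trans hx0).
have [_ low] := hu z0 Qz0.
have := barrier_lower_class hrR H0 p1 p2 hx0 lam0 lamE.
set v := barrier _ _ _ _ => vL.
have vu : v z0 <= u z0.
  by rewrite -lee_fin -low; apply: ereal_sup_ubound; exists v.
apply: le_trans vu; rewrite /v barrier_value.
have eh : lam * h <= expR (lam * h) - 1.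
  by rewrite lerBrDl expR_ge1Dx.
have eH : 0 < expR (lam * H) - 1 by rewrite subr_gt0 expR_gt1 mulr_gt0.
(* In C t = 2 b H t + s t the first part is exactly lam H, and the second pays for lam h. *)
apply: (@le_trans _ _ (expR (- (lam * H)) * (lam * h))).
  rewrite -mulrA -/t mulrDl opprD expRD.
  have -> : 2 * b * H * t = lam * H by rewrite /lam; ring.
  rewrite ler_wpM2l ?expR_ge0//; apply: (@le_trans _ _ (expR (- s))).
    by rewrite ler_expR lerN2 ler_peMr// (le_trans _ t2)// ler1n.
  apply: (le_trans es); rewrite /lam ler_wpM2r ?(ltW hh)//.
  rewrite -subr_ge0 (_ : 2 * b * t - 4 * b = 2 * b * (t - 2)); last by ring.
  by rewrite mulr_ge0 ?subr_ge0// mulr_ge0// ltW.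
have lh0 : 0 <= lam * h by apply: mulr_ge0; exact: ltW.
apply: ler_pM => //.
rewrite expRN lef_pV2 ?posrE ?expR_gt0//.
by rewrite gerBl.
Qed.
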